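(* Let $\delta > 0$. There exist positive constants $c_0, \epsilon_0, N_0, s_0$, depending only on $\delta$, such that the following statements hold for all $\mathbf{v} \in S_\delta \cap \mathbb{Z}_{\ge N_0}^2$, $s \ge s_0$, $w > 0$ and $z < 1$. (a) If $w \ge \zeta_{\mathbf{v}}-\epsilon_0 \min \{s^{1/2} \|\mathbf{v}\|^{-1/3}, 1\}$ then $$\mathbf{P}\{G^{w, \mathrm{hor}}_{\mathbf{v}} - G_{\mathbf{v}} \ge s\|\mathbf{v}\|^{1/3}\} \le \exp\{-c_0\min \{s^{3/2}, s\|\mathbf{v}\|^{1/3}\}\}.$$ (b) If $z \le \zeta_{\mathbf{v}} + \epsilon_0 \min \{s^{1/2} \|\mathbf{v}\|^{-1/3}, 1\}$ then $$\mathbf{P}\{G^{z, \mathrm{ver}}_{\mathbf{v}} - G_{\mathbf{v}} \ge s\|\mathbf{v}\|^{1/3}\} \le \exp\{-c_0\min \{s^{3/2}, s\|\mathbf{v}\|^{1/3}\}\}.$$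
   Context: $\mathrm{Exp}(\lambda)$ is the exponential distribution with rate $\lambda$. For $w>0$ and $z<1$, let $\{\omega^{w,z}_{\mathbf{v}}:\mathbf{v}\in\mathbb{Z}_{\ge0}^2\}$ be independent weights with $\omega^{w,z}_{\mathbf{v}}=\omega_{\mathbf{v}}\sim\mathrm{Exp}(1)$ for $\mathbf{v}\in\mathbb{Z}_{>0}^2$ (bulk weights, the same for all $w,z$), $\omega^{w,z}_{(i,0)}\sim\mathrm{Exp}(w)$ for $i\in\mathbb{Z}_{>0}$, $\omega^{w,z}_{(0,j)}\sim\mathrm{Exp}(1-z)$ for $j\in\mathbb{Z}_{>0}$, and $\omega^{w,z}_{(0,0)}=0$. $\Pi_{\mathbf{u},\mathbf{v}}$ is the set of up-right lattice paths from $\mathbf{u}$ to $\mathbf{v}$ with steps $(1,0)$ and $(0,1)$, viewed as vertex sets including both endpoints. Put $G_{\mathbf{v}}=\max_{\pi\in\Pi_{(1,1),\mathbf{v}}}\sum_{\mathbf{p}\in\pi}\omega_{\mathbf{p}}$ (bulk LPP), $G^{w,\mathrm{hor}}_{\mathbf{v}}=\max_{\pi\in\Pi_{(1,0),\mathbf{v}}}\sum_{\mathbf{p}\in\pi}\omega^{w,z}_{\mathbf{p}}$ (which does not depend on $z$) and $G^{z,\mathrm{ver}}_{\mathbf{v}}=\max_{\pi\in\Pi_{(0,1),\mathbf{v}}}\sum_{\mathbf{p}\in\pi}\omega^{w,z}_{\mathbf{p}}$ (which does not depend on $w$), for $\mathbf{v}\in\mathbb{Z}_{>0}^2$; these are all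 coupled through the common bulk weights. For $\mathbf{x}=(x,y)\in\mathbb{R}_{>0}^2$, $\zeta_{\mathbf{x}}=\frac{\sqrt{x}}{\sqrt{x}+\sqrt{y}}$. $\|\cdot\|$ is the $L^1$ norm. $S_\delta = \{(x,y)\in\mathbb{R}_{>0}^2: x\ge \delta y,\ y\ge\delta x\}$, and $\mathbb{Z}_{\ge N}=\{n\in\mathbb{Z}: n\ge N\}$. *)

(* Defs.v *)
From HB Require Import structures.
From mathcomp Require Import all_boot all_order all_algebra finmap.
From mathcomp Require Import all_classical all_reals all_analysis.
Set Implicit Arguments.
Unset Strict Implicit.
Unset Printing Implicit Defensive.
Import Order.TTheory GRing.Theory Num.Theory.
Local Open Scope classical_set_scope.
Local Open Scope ring_scope.

Section Paths.
Variable R : realType.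
Implicit Types (u v : nat * nat) (f : nat * nat -> R).

Definition up_right u v : bool := (v == (u.1.+1, u.2)) || (v == (u.1, u.2.+1)).

(* A path is represented by the list [p] of its vertices after the starting
   point [u]; the vertices of [u :: p] are pairwise distinct, so a sum over
   this list is a sum over the vertex set of the path. *)
Definition up_right_paths u v : set (seq (nat * nat)) :=
  [set p | path up_right u p /\ last u p = v].

Definition path_weight f u (p : seq (nat * nat)) : R := \sum_(q <- u :: p) f q.

(* The supremum is a maximum as soon as there is a path from [u] to [v]: see
   [lpp_max] below. *)
Definition lpp f u v : R := sup [set path_weight f u p | p in up_right_paths u v].

Lemma up_right_path_uniq u p : path up_right u p -> uniq (u :: p).
Proof.
move=> pu; apply: (@sorted_uniq _ (fun a b => a.1 + a.2 < b.1 + b.2)%N).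
- by move=> b a c /ltn_trans; apply.
- by move=> a; rewrite ltnn.
- rewrite /=; apply: sub_path pu => a b /orP[] /eqP -> /=.
    by rewrite addSn.
  by rewrite addnS.
Qed.

Lemma up_right_pathsP u v :
  (u.1 <= v.1)%N -> (u.2 <= v.2)%N -> up_right_paths u v !=set0.
Proof.
move=> h1 h2; case: u v h1 h2 => [a b] [c e] /= /subnK hc /subnK he.
move: (c - a)%N (e - b)%N hc he => m n <- <- {c e}.
elim: m n a b => [|m IH] n a b.
  elim: n b => [|n IHn] b; first by exists [::].
  have [p [pp pl]] := IHn b.+1; exists ((a, b.+1) :: p).
  by split; rewrite /= ?pp ?pl ?andbT /up_right /= ?eqxx ?orbT// addSnnS.
have [p [pp pl]] := IH n a.+1 b; exists ((a.+1, b) :: p).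
by split; rewrite /= ?pp ?pl ?andbT /up_right /= ?eqxx ?orbT// addSnnS.
Qed.

Lemma up_right_paths_finite u v : finite_set (up_right_paths u v).
Proof.
have fin n x : finite_set [set p | path up_right x p /\ size p = n].
  elim: n x => [|n IH] x.
    apply: (sub_finite_set (B := [set [::]])); last exact: finite_set1.
    by move=> p /= [_ /size0nil].
  apply: (sub_finite_set (B :=
      (cons (x.1.+1, x.2)) @` [set p | path up_right (x.1.+1, x.2) p /\ size p = n]
   `|` (cons (x.1, x.2.+1)) @` [set p | path up_right (x.1, x.2.+1) p /\ size p = n])).
    move=> [|y p] /= [] // /andP[/orP[] /eqP -> pp] [sp].
      by left; exists p.
    by right; exists p.
  by rewrite finite_setU; split; apply: finite_image; exact: IH.
apply: sub_finite_set (fin (v.1 + v.2 - (u.1 + u.2))%N u) => p /= [pp pl].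
split=> //; rewrite -pl {v pl}.
suff -> : ((last u p).1 + (last u p).2 = size p + (u.1 + u.2))%N by rewrite addnK.
elim: p u pp => [//|y p IH] u /= /andP[/orP[] /eqP -> pp]; rewrite IH//=.
  by rewrite !addSn addnS.
by rewrite !addnS addSn.
Qed.

Lemma lpp_max f u v : (u.1 <= v.1)%N -> (u.2 <= v.2)%N ->
  (exists2 p, up_right_paths u v p & lpp f u v = path_weight f u p) /\
  (forall p, up_right_paths u v p -> path_weight f u p <= lpp f u v).
Proof.
move=> uv1 uv2; have [p0 p0P] := up_right_pathsP uv1 uv2.
set A := [set path_weight f u p | p in up_right_paths u v].
have [s sA] : exists s : seq (seq (nat * nat)), up_right_paths u v = [set` s].
  by apply/finite_seqP; exact: up_right_paths_finite.
have p0s : p0 \in s by move: p0P; rewrite sA.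
have [q qs qmax] : exists2 q, q \in s &
    forall p, p \in s -> path_weight f u p <= path_weight f u q.
  clear sA p0P; elim: s p0 p0s => [//|a s IH] _ _.
  case: s IH => [_|b s /(_ b (mem_head _ _)) [q qs qm]].
    by exists a; rewrite ?mem_head// => p; rewrite inE => /eqP ->.
  have [aq|qa] := leP (path_weight f u a) (path_weight f u q).
    exists q; first by rewrite in_cons qs orbT.
    by move=> p; rewrite in_cons => /orP[/eqP ->//|/qm].
  exists a; first by rewrite mem_head.
  move=> p; rewrite in_cons => /orP[/eqP ->//|/qm h].
  exact: le_trans h (ltW qa).
have qA : up_right_paths u v q by rewrite sA.
have ubq : ubound A (path_weight f u q).
  by move=> _ [p + <-]; rewrite sA => /qmax.
have E : lpp f u v = path_weight f u q.
  apply/eqP; rewrite eq_le; apply/andP; split.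
    by apply: ge_sup => //; exists (path_weight f u q); exists q.
  by apply: ub_le_sup; [exists (path_weight f u q) | exists q].
split; first by exists q.
by move=> p; rewrite sA E => /qmax.
Qed.

End Paths.

Definition l1norm (R : realType) (v : nat * nat) : R := (v.1 + v.2)%:R.

Definition zeta (R : realType) (x : R * R) : R :=
  Num.sqrt x.1 / (Num.sqrt x.1 + Num.sqrt x.2).

Definition cone (R : realType) (delta : R) : set (R * R) :=
  [set x | [/\ 0 < x.1, 0 < x.2, delta * x.2 <= x.1 & delta * x.1 <= x.2]].

Definition real_point (R : realType) (v : nat * nat) : R * R := (v.1%:R, v.2%:R).

Section Weights.
Context (R : realType) (d : measure_display) (T : measurableType d).
Variable P : probability T R.

Definition mutually_independent (I : choiceType) (X : I -> {RV P >-> R}) : Prop :=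
  forall (J : {fset I}) (A : I -> set R), (forall i, measurable (A i)) ->
  P (\bigcap_(i in [set` J]) X i @^-1` A i) =
  (\prod_(i <- J) P (X i @^-1` A i))%E.

Definition exponential_rv (rate : R) (X : {RV P >-> R}) : Prop :=
  forall A : set R, measurable A -> distribution P X A = exponential_prob rate A.

(* [om] gives the common bulk weights (only its values on positive sites
   matter) and [omb w z] the weights with boundary parameters [w] and [z]. No
   joint law is prescribed across different values of [w] and [z], beyond what
   [bulk_weights], [hor_weights_z] and [ver_weights_w] state. *)
Record lpp_weights (om : nat * nat -> {RV P >-> R})
    (omb : R -> R -> nat * nat -> {RV P >-> R}) : Prop := {
  weights_independent : forall w z, 0 < w -> z < 1 ->
    mutually_independent (omb w z);
  bulk_weights : forall w z i j, 0 < w -> z < 1 ->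
    omb w z (i.+1, j.+1) =1 om (i.+1, j.+1);
  bulk_weights_exp : forall i j, exponential_rv 1 (om (i.+1, j.+1));
  hor_weights_exp : forall w z i, 0 < w -> z < 1 ->
    exponential_rv w (omb w z (i.+1, 0%N));
  ver_weights_exp : forall w z j, 0 < w -> z < 1 ->
    exponential_rv (1 - z) (omb w z (0%N, j.+1));
  origin_weight : forall w z, 0 < w -> z < 1 ->
    omb w z (0%N, 0%N) =1 (fun=> 0);
  hor_weights_z : forall w z z' i, 0 < w -> z < 1 -> z' < 1 ->
    omb w z (i.+1, 0%N) =1 omb w z' (i.+1, 0%N);
  ver_weights_w : forall w w' z j, 0 < w -> 0 < w' -> z < 1 ->
    omb w z (0%N, j.+1) =1 omb w' z (0%N, j.+1) }.

Definition G_bulk (om : nat * nat -> {RV P >-> R}) (v : nat * nat) (t : T) : R :=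
  lpp (fun q => om q t) (1%N, 1%N) v.

Definition G_hor (om : nat * nat -> {RV P >-> R}) (v : nat * nat) (t : T) : R :=
  lpp (fun q => om q t) (1%N, 0%N) v.

Definition G_ver (om : nat * nat -> {RV P >-> R}) (v : nat * nat) (t : T) : R :=
  lpp (fun q => om q t) (0%N, 1%N) v.

End Weights.

(* Main.v *)
Require Import Defs.
From HB Require Import structures.
From mathcomp Require Import all_boot all_order all_algebra finmap.
From mathcomp Require Import all_classical all_reals all_analysis.
From mathcomp Require Import measurable_realfun ring lra zify.
Set Implicit Arguments.
Unset Strict Implicit.
Unset Printing Implicit Defensive.
Import Order.TTheory GRing.Theory Num.Theory.
Local Open Scope classical_set_scope.
Local Open Scope ring_scope.

(** The passage time [G] from [(1, 1)] to [v = (m, n)] is of order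
    [gam = (sqrt m + sqrt n)^2]. If adding the bottom boundary gains [s], then
    either the passage time with the boundary exceeds [gam + s / 2], or the bulk
    passage time is below [gam - s / 2]; each event is rare.

    Everything rests on one identity. With both boundaries, of rates [w] and
    [1 - z], the passage time from the origin satisfies
    [E exp((w - z) G) = (w / z)^m ((1 - z) / (1 - w))^n] ([lpp_mgf]): tilting
    the rates of the bottom weights from [w] to [z] makes the model stationary,
    and by Burke's theorem ([vertical_increments_indep]) the vertical increments
    of a stationary model along a column are independent exponential variables.
    The logarithm of the right-hand side is the integral from [z] to [w] of
    [mean u = m / u + n / (1 - u)], whose minimum is [gam], attained at [zeta],
    and which is quadratic nearby. Elementary quadrature bounds for a convex
    function then give an upper tail for [z < w] ([lpp_upper_tail]) and a lower
    tail for [w < z] ([lpp_lower_tail]), sharp enough at parameters within [mu]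
    of [zeta] for deviations of order [mu^2 (m + n)] and probabilities
    [exp(- c mu^3 (m + n))]. The first tail bounds the passage time with a bottom
    boundary.

    For the bulk lower tail, passage times are maxima of sums of weights that
    are convex in the parameters, so they are convex along segments of
    parameters ([full_convex]). A lower bound at attracting parameters [w < z]
    and an upper bound further out therefore extrapolate to a lower bound at
    repelling parameters. It remains to pass from a model with repelling
    boundaries to the bulk. After a half-turn, the boundary of rate
    [zeta + 2 mu] is one more row on top of the bulk; surround the picture by a
    stationary model of parameter [zeta + mu]. With high probability its optimal
    path starts along the left boundary ([ver_dominates]); bulk increments are
    then controlled by stationary ones, and the gain due to the additional row
    is at most one vertical increment of the enlarged stationary model
    ([bulk_top_increment]), which is exponential with rate [mu]
    ([hor_minus_blk_tail]). Exchanging the axes treats the other boundary, and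
    the bulk lower tail follows ([blk_lower_tail]).

    Fresh weights needed for auxiliary models are taken from sites of the
    quadrant outside the rectangle, suitably relabelled and scaled. *)

(** * Integration against exponential densities *)

Section density.
Import HBNNSimple.

(** Simple functions reduce to level sets, and monotone convergence does the rest. *)
Lemma ge0_integral_density d (T : measurableType d) (R : realType)
    (mu nu : {measure set T -> \bar R}) (g : T -> R) :
  measurable_fun setT g -> (forall x, 0 <= g x) ->
  (forall A, measurable A -> nu A = \int[mu]_(x in A) (g x)%:E)%E ->
  forall f : T -> \bar R, measurable_fun setT f -> (forall x, 0 <= f x)%E ->
  (\int[nu]_x f x = \int[mu]_x ((g x)%:E * f x))%E.
Proof.
move=> mg g0 nuE f mf f0.
have mgE : measurable_fun setT (EFin \o g) by exact/measurable_EFinP.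
pose h := nnsfun_approx measurableT mf.
have hcvg x : EFin \o h^~ x @ \oo --> f x by apply: cvg_nnsfun_approx.
have mh n : measurable_fun setT (EFin \o h n).
  by apply/measurable_EFinP; exact/measurable_funP.
have -> : (\int[nu]_x f x = limn (fun n => \int[nu]_x (h n x)%:E))%E.
  rewrite -monotone_convergence//; last 2 first.
    by move=> n x _; rewrite lee_fin.
    by move=> x _ a b ab; rewrite lee_fin; exact/lefP/nd_nnsfun_approx.
  by apply: eq_integral => x _; apply/esym/cvg_lim => //; exact: hcvg.
have -> : (\int[mu]_x ((g x)%:E * f x) =
    limn (fun n => \int[mu]_x ((g x)%:E * (h n x)%:E)))%E.
  rewrite -monotone_convergence//.
  - apply: eq_integral => x _; apply/esym/cvg_lim => //.
    by apply: cvgeZl => //; exact: hcvg.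
  - by move=> n; apply: emeasurable_funM => //; exact: mh.
  - by move=> n x _; rewrite -EFinM lee_fin mulr_ge0.
  - move=> x _ a b ab; rewrite -!EFinM lee_fin ler_wpM2l//.
    exact/lefP/nd_nnsfun_approx.
congr (limn _); apply/funext => n.
transitivity (\int[nu]_x (\sum_(y \in range (h n)) (y * \1_(h n @^-1` [set y]) x)%:E))%E.
  by apply: eq_integral => t _; rewrite /= (fimfunE (h n)) -fsumEFin.
transitivity (\int[mu]_x (\sum_(y \in range (h n))
    (y%:E * ((g x)%:E * (\1_(h n @^-1` [set y]) x)%:E))))%E; last first.
  apply: eq_integral => t _; rewrite /= (fimfunE (h n)) -fsumEFin//.
  rewrite ge0_mule_fsumr; last by move=> y; rewrite lee_fin; exact: nnfun_muleindic_ge0.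
  by apply: eq_fsbigr => y _; rewrite -!EFinM mulrCA.
rewrite !ge0_integral_fsum//; last 4 first.
- move=> y; apply: measurable_funeM; apply: emeasurable_funM => //.
  by apply/measurable_EFinP; exact: measurable_indic.
- move=> y x _; rewrite muleCA mule_ge0 ?lee_fin//.
  exact: nnfun_muleindic_ge0.
- by move=> y; apply/measurable_EFinP; apply: measurable_funM => //; exact: measurable_indic.
- by move=> y x _; rewrite lee_fin; exact: nnfun_muleindic_ge0.
apply: eq_fsbigr => y /set_mem [x0 _ yE].
have y0 : 0 <= y by rewrite -yE.
under eq_integral do rewrite EFinM.
rewrite ge0_integralZl//; last first.
  by apply: measurableT_comp => //; exact: measurable_indic.
rewrite [RHS]ge0_integralZl//; last 2 first.
- apply: emeasurable_funM => //.
  by apply: measurableT_comp => //; exact: measurable_indic.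
- by move=> ? _; rewrite mule_ge0// lee_fin.
congr (_ * _)%E.
rewrite integral_indic// setIT nuE//.
rewrite [LHS]integral_mkcond; apply: eq_integral => x _.
by rewrite patchE indicE; case: ifPn => _; rewrite ?mule1 ?mule0.
Qed.

End density.

(** Packages an image measure with its change of variables, so that the proof that
    [phi] is measurable need not be carried inside the measure. *)
Lemma image_measure d1 d2 (T1 : measurableType d1) (T2 : measurableType d2)
    (R : realType) (mu : {measure set T1 -> \bar R}) (phi : T1 -> T2) :
  measurable_fun setT phi ->
  exists2 nu : {measure set T2 -> \bar R},
    (forall A, nu A = mu (phi @^-1` A)) &
    forall f : T2 -> \bar R, measurable_fun setT f -> (forall y, 0 <= f y)%E ->
      (\int[nu]_y f y = \int[mu]_x f (phi x))%E.
Proof.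
move=> mphi.
exists (measure_function_pushforward__canonical__measure_function_Measure mu mphi) => //.
by move=> f mf f0; rewrite ge0_integral_pushforward.
Qed.

(** The scaled image of Lebesgue measure gives intervals their length. *)
Lemma ge0_integral_affine (R : realType) (a b : R) (f : R -> \bar R) : 0 < a ->
  measurable_fun setT f -> (forall x, 0 <= f x)%E ->
  (\int[lebesgue_measure]_x f (a * x + b)%R =
   (a^-1)%:E * \int[lebesgue_measure]_x f x)%E.
Proof.
move=> a0 mf f0; pose phi (x : R) : R := a * x + b.
have mphi : measurable_fun [set: measurableTypeR R] (phi : _ -> measurableTypeR R).
  by apply: measurable_funD => //; exact: measurable_funM.
have [nu nuE intnu] := image_measure (@lebesgue_measure R) mphi.
have ag0 : 0 <= a by exact: ltW.
pose m := mscale (NngNum ag0) nu.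
have mE A : measurable A -> lebesgue_measure A = m A.
  apply: (lebesgue_measure_unique (mu := m)) => _ [[x y] _ <-] /=.
  rewrite lebesgue_measure_itv /m /mscale /= nuE.
  have -> : phi @^-1` `]x, y] = `](x - b) / a, (y - b) / a]%classic.
    apply/seteqP; split => u /=; rewrite !in_itv/= /phi ltr_pdivrMr// ler_pdivlMr// => /andP[? ?]; apply/andP; split; lra.
  have := lebesgue_measure_itv `](x - b) / a, (y - b) / a].
  rewrite /= !lte_fin ltr_pM2r ?invr_gt0// ltrD2r => itvE.
  transitivity (a%:E * (if (x < y)%R then ((y - b) / a)%:E + (- ((x - b) / a)%R)%:E
                        else 0))%E; last by congr (_ * _)%E; exact/esym/itvE.
  case: ifP => _; last by rewrite mule0.
  by rewrite -!EFinB -EFinM; congr EFin; field; rewrite gt_eqF.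
have -> : (\int[lebesgue_measure]_x f x = \int[m]_x f x)%E.
  by apply: eq_measure_integral => A mA _; exact: mE.
rewrite ge0_integral_mscale//= muleA -EFinM mulVf ?gt_eqF// mul1e.
by rewrite intnu.
Qed.

Section expint.
Variable R : realType.
Implicit Types (r z w j : R) (f g : R -> \bar R).

(** Expectation under the exponential law of rate [r], as an operator: iterating
    it stands for integration against a product law. *)
Definition expint r f : \bar R :=
  (\int[lebesgue_measure]_u ((exponential_pdf r u)%:E * f u))%E.

Let mpdf r : measurable_fun setT (fun u => (exponential_pdf r u)%:E).
Proof. by apply/measurable_EFinP; exact: measurable_exponential_pdf. Qed.

Let mpdfM r f : measurable_fun setT f ->
  measurable_fun setT (fun u => (exponential_pdf r u)%:E * f u)%E.
Proof. by move=> mf; apply: emeasurable_funM. Qed.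

Let pdf0 r : 0 < r -> forall u, 0 <= exponential_pdf r u.
Proof. by move=> r0 u; rewrite exponential_pdf_ge0// ltW. Qed.

Let pdfM0 r f : 0 < r -> (forall u, 0 <= f u)%E ->
  forall u, (0 <= (exponential_pdf r u)%:E * f u)%E.
Proof. by move=> r0 f0 u; rewrite mule_ge0// lee_fin pdf0. Qed.

Lemma expint_ge0 r f : 0 < r -> (forall u, 0 <= f u)%E -> (0 <= expint r f)%E.
Proof. by move=> r0 f0; apply: integral_ge0 => u _; exact: pdfM0. Qed.

Lemma eq_expint r f g : (forall u, 0 <= u -> f u = g u) -> expint r f = expint r g.
Proof.
move=> fg; apply: eq_integral => u _.
have [u0|u0] := leP 0 u; first by rewrite fg.
by rewrite lt0_exponential_pdf// !mul0e.
Qed.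

Lemma expint_cst r (c : \bar R) : 0 < r -> (0 <= c)%E -> expint r (cst c) = c.
Proof.
move=> r0 c0; rewrite /expint ge0_integralZr//=.
- by rewrite integral_exponential_pdf// mul1e.
- exact: mpdf.
- by move=> u _; rewrite lee_fin pdf0.
Qed.

Lemma expintZl r f (c : \bar R) : 0 < r -> (0 <= c)%E ->
  measurable_fun setT f -> (forall u, 0 <= f u)%E ->
  expint r (fun u => c * f u)%E = (c * expint r f)%E.
Proof.
move=> r0 c0 mf f0; rewrite /expint.
under eq_integral do rewrite muleCA.
by rewrite ge0_integralZl//; [exact: mpdfM | move=> u _; exact: pdfM0].
Qed.

Lemma expintD r f g : 0 < r ->
  measurable_fun setT f -> (forall u, 0 <= f u)%E ->
  measurable_fun setT g -> (forall u, 0 <= g u)%E ->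
  expint r (fun u => f u + g u)%E = (expint r f + expint r g)%E.
Proof.
move=> r0 mf f0 mg g0; rewrite /expint.
under eq_integral do rewrite ge0_muleDr//.
by rewrite ge0_integralD//; [move=> u _; exact: pdfM0|exact: mpdfM|move=> u _; exact: pdfM0|exact: mpdfM].
Qed.

Lemma measurable_expint d (T : measurableType d) r (F : T * R -> \bar R) : 0 < r ->
  measurable_fun setT F -> (forall p, 0 <= F p)%E ->
  measurable_fun setT (fun t => expint r (fun u => F (t, u))).
Proof.
move=> r0 mF F0.
pose G (p : T * R) := ((exponential_pdf r p.2)%:E * F p)%E.
have mG : measurable_fun setT G.
  apply: emeasurable_funM => //.
  by apply: measurableT_comp => //; apply: measurableT_comp => //; exact: measurable_exponential_pdf.
apply: (measurable_fun_fubini_tonelli_F (m2 := @lebesgue_measure R) G) => //.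
by move=> p; rewrite mule_ge0// lee_fin pdf0.
Qed.

Lemma expint_exchange r r' (F : R * R -> \bar R) : 0 < r -> 0 < r' ->
  measurable_fun setT F -> (forall p, 0 <= F p)%E ->
  expint r (fun u => expint r' (fun v => F (u, v))) =
  expint r' (fun v => expint r (fun u => F (u, v))).
Proof.
move=> r0 r'0 mF F0; rewrite /expint.
pose G (p : R * R) := ((exponential_pdf r p.1)%:E * ((exponential_pdf r' p.2)%:E * F p))%E.
have m1 : measurable_fun setT (fun p : R * R => (exponential_pdf r p.1)%:E).
  by apply: measurableT_comp => //; apply: measurableT_comp => //; exact: measurable_exponential_pdf.
have m2 : measurable_fun setT (fun p : R * R => (exponential_pdf r' p.2)%:E).
  by apply: measurableT_comp => //; apply: measurableT_comp => //; exact: measurable_exponential_pdf.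
have mG : measurable_fun setT G.
  by apply: emeasurable_funM => //; apply: emeasurable_funM.
have G0 p : (0 <= G p)%E by rewrite !mule_ge0// lee_fin pdf0.
transitivity (\int[lebesgue_measure]_u \int[lebesgue_measure]_v G (u, v))%E.
  apply: eq_integral => u _; rewrite -ge0_integralZl//.
  - by apply: mpdfM; exact: (measurableT_comp mF (measurable_pair1 _)).
  - by move=> v _; rewrite mule_ge0// lee_fin pdf0.
  - by rewrite lee_fin pdf0.
rewrite fubini_tonelli//; apply: eq_integral => v _.
rewrite /G/=; under eq_integral do rewrite muleCA.
rewrite ge0_integralZl//.
- by apply: mpdfM; exact: (measurableT_comp mF (measurable_pair2 _)).
- by move=> u _; rewrite mule_ge0// lee_fin pdf0.
- by rewrite lee_fin pdf0.
Qed.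

(** The factor [expR ((w - z) * u)] turns the density of rate [w] into a multiple of
    the density of rate [z]. *)
Lemma expint_tilt w z f : 0 < w -> 0 < z ->
  measurable_fun setT f -> (forall u, 0 <= f u)%E ->
  expint w (fun u => (expR ((w - z) * u))%:E * f u)%E = ((w / z)%:E * expint z f)%E.
Proof.
move=> w0 z0 mf f0.
have wz0 : (0 <= (w / z)%:E)%E by rewrite lee_fin divr_ge0 ?(ltW w0) ?(ltW z0).
rewrite -(expintZl z0 wz0 mf f0).
apply: eq_integral => u _.
rewrite !muleA -!EFinM; congr (_%:E * _)%E.
have [u0|u0] := leP 0 u; last by rewrite !lt0_exponential_pdf// !mul0r.
rewrite !exponential_pdfE// -mulrA -expRD.
have -> : - w * u + (w - z) * u = - z * u by ring.
by field; rewrite gt_eqF.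
Qed.

Lemma expint_scale r f : 0 < r ->
  measurable_fun setT f -> (forall u, 0 <= f u)%E ->
  expint 1 (fun u => f (u / r)) = expint r f.
Proof.
move=> r0 mf f0; rewrite /expint.
transitivity (\int[lebesgue_measure]_u (r^-1%:E *
    ((exponential_pdf r (r^-1 * u + 0)%R)%:E * f (r^-1 * u + 0)%R)))%E.
  apply: eq_integral => u _; rewrite addr0 [_ * u]mulrC muleA -EFinM; congr (_%:E * _)%E.
  have [u0|u0] := leP 0 u; last first.
    by rewrite !lt0_exponential_pdf ?mulr0// pmulr_llt0// invr_gt0.
  rewrite !exponential_pdfE ?divr_ge0 ?(ltW r0)// mul1r mulKf ?gt_eqF//.
  by congr expR; field; rewrite gt_eqF.
pose g u := ((exponential_pdf r u)%:E * f u)%E.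
rewrite ge0_integralZl//; last 3 first.
- apply: (@measurableT_comp _ _ _ _ _ _ g); first exact: mpdfM.
  by apply: measurable_funD => //; exact: measurable_funM.
- by move=> u _; exact: pdfM0.
- by rewrite lee_fin invr_ge0 ltW.
rewrite (@ge0_integral_affine _ _ _ g) ?invr_gt0//; last 2 first.
- exact: mpdfM.
- exact: pdfM0.
by rewrite muleA -EFinM invrK mulVf ?mul1e// gt_eqF.
Qed.

(** Lack of memory. The flag [s] says on which side the null event of a tie
    falls. *)
Lemma expint_memoryless (s : bool) z j f : 0 < z -> 0 <= j ->
  measurable_fun setT f -> (forall u, 0 <= f u)%E ->
  expint z (fun u => if j < u ?<= if s then f (u - j)%R else 0%E) =
  ((expR (- (z * j)))%:E * expint z f)%E.
Proof.
move=> z0 j0 mf f0.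
have mc : measurable_fun setT (fun v : R => if 0 < v ?<= if s then f v else 0%E).
  apply: measurable_fun_ifT => //; case: s => /=.
    by apply: measurable_fun_ler.
  by apply: measurable_fun_ltr.
have c0 v : (0 <= if (0 < v ?<= if s)%R then f v else 0)%E by case: ifP.
pose h v := ((exponential_pdf z (v + j))%:E * if (0 < v ?<= if s)%R then f v else 0)%E.
transitivity (\int[lebesgue_measure]_v h v)%E.
  have := @ge0_integral_affine R 1 (- j) h ltr01.
  rewrite invr1 mul1e => <-.
  - apply: eq_integral => u _; rewrite /h !mul1r subrK.
    congr (_ * _)%E; case: s {mc c0 h} => /=; first by rewrite subr_ge0.
    by rewrite subr_gt0.
  - apply: emeasurable_funM => //; apply: measurableT_comp => //.
    apply: measurableT_comp; first exact: measurable_exponential_pdf.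
    by apply: measurable_funD.
  - by move=> v; apply: mule_ge0; [rewrite lee_fin pdf0|exact: c0].
rewrite -expintZl//.
rewrite /expint -(@integral_setD1 R _ 0)//; last first.
  apply: measurable_funTS; apply: emeasurable_funM => //.
    apply: measurableT_comp => //; apply: measurableT_comp; first exact: measurable_exponential_pdf.
    by apply: measurable_funD.
  by apply: measurableD.
rewrite -[RHS](@integral_setD1 R _ 0)//; last first.
  by apply: measurable_funTS; apply: mpdfM; exact: measurable_funeM.
  by apply: measurableD.
apply: eq_integral => v; rewrite inE /= => -[_ /eqP v0].
rewrite muleA -EFinM /h.
have [v1|v1|/esym/eqP] := ltgtP 0 v; last by rewrite (negbTE v0).
  have -> : 0 < v ?<= if s by case: (s) => //=; exact: ltW.
  rewrite !exponential_pdfE ?(ltW v1) ?addr_ge0 ?(ltW v1)//.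
  congr (_%:E * _)%E.
  have -> : - z * (v + j) = - z * v + - (z * j) by ring.
  by rewrite expRD; ring.
have -> : 0 < v ?<= if s = false.
  by case: (s) => /=; [rewrite leNgt v1|rewrite ltNge (ltW v1)].
by rewrite mule0 (lt0_exponential_pdf _ v1) mul0r mul0e.
Qed.

End expint.

(** * Burke's identity for three exponential variables *)

Section burke_law.
Variable R : realType.
Implicit Types z y b : R.

Lemma expint3_rev z y b (F : R * R * R -> \bar R) : 0 < z -> 0 < y -> 0 < b ->
  measurable_fun setT F -> (forall p, 0 <= F p)%E ->
  expint z (fun i => expint y (fun j => expint b (fun u => F (i, j, u)))) =
  expint b (fun u => expint y (fun j => expint z (fun i => F (i, j, u)))).
Proof.
move=> z0 y0 b0 mF F0.
transitivity (expint z (fun i => expint b (fun u => expint y (fun j => F (i, j, u))))).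
  apply: eq_expint => i _.
  apply: (expint_exchange (F := fun p => F (i, p.1, p.2))) => //.
  by apply: (measurableT_comp mF); apply: measurable_fun_pair => //; exact: measurable_fun_pair.
pose G (p : R * R) := expint y (fun j => F (p.1, j, p.2)).
transitivity (expint b (fun u => expint z (fun i => G (i, u)))).
  apply: (expint_exchange (F := G)) => // [|p]; last exact: expint_ge0.
  apply: (measurable_expint (F := fun q : R * R * R => F (q.1.1, q.2, q.1.2))) => //.
  apply: (measurableT_comp mF); apply: measurable_fun_pair => //; last exact: measurableT_comp.
  by apply: measurable_fun_pair => //; exact: measurableT_comp.
apply: eq_expint => u _.
apply: (expint_exchange (F := fun p => F (p.1, p.2, u))) => //.
apply: (measurableT_comp mF); apply: measurable_fun_pair => //.
by apply: measurable_fun_pair.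
Qed.

Section half.
Variables (s : bool) (z y : R) (phi : R * R -> \bar R).
Hypotheses (z0 : 0 < z) (y0 : 0 < y).
Hypotheses (mphi : measurable_fun setT phi) (phi0 : forall p, (0 <= phi p)%E).

Let mlt d (T : measurableType d) (f g : T -> R) :
  measurable_fun setT f -> measurable_fun setT g ->
  measurable_fun setT (fun t => f t < g t ?<= if s).
Proof.
by move=> mf mg; case: s => /=; [exact: measurable_fun_ler|exact: measurable_fun_ltr].
Qed.

Let mphi2 d (T : measurableType d) (f g : T -> R) :
  measurable_fun setT f -> measurable_fun setT g ->
  measurable_fun setT (fun t => phi (f t, g t)).
Proof. by move=> mf mg; apply: (measurableT_comp mphi); exact: measurable_fun_pair. Qed.

(** When [i] exceeds [j], lack of memory replaces [i - j] by a fresh variable [v],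
    at the price of the factor [y / (z + y)]. The change of variables
    [x = u + v] then recombines the exponential factors into densities of rates
    [z] for [x] and [y] for [u]. *)
Lemma burke_law_half :
  expint z (fun i => expint y (fun j => expint (z + y) (fun u =>
    if j < i ?<= if s then phi (u + (i - j), u) else 0%E))) =
  expint z (fun i => expint y (fun j =>
    if j < i ?<= if s then phi (i, j) else 0%E)).
Proof.
have b0 : 0 < z + y by rewrite addr_gt0.
pose F (p : R * R * R) : \bar R :=
  if p.1.2 < p.1.1 ?<= if s then phi (p.2 + (p.1.1 - p.1.2), p.2) else 0%E.
have mF : measurable_fun setT F.
  apply: measurable_fun_ifT => //.
    by apply: mlt; exact: measurableT_comp.
  apply: mphi2 => //; apply: measurable_funD => //.
  by apply: measurable_funB; exact: measurableT_comp.
have F0 p : (0 <= F p)%E by rewrite /F; case: ifP.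
rewrite [LHS](expint3_rev z0 y0 b0 mF F0).
pose K u := expint z (fun v => phi (u + v, u)).
have mK : measurable_fun setT K.
  apply: (measurable_expint (F := fun p : R * R => phi (p.1 + p.2, p.1))) => //.
  by apply: mphi2 => //; exact: measurable_funD.
have K0 u : (0 <= K u)%E by apply: expint_ge0.
transitivity (expint (z + y) (fun u => (y / (z + y))%:E * K u)%E).
  apply: eq_expint => u _.
  transitivity (expint y (fun j => (expR (- (z * j)))%:E * K u)%E).
    apply: eq_expint => j j_ge0.
    rewrite -(expint_memoryless s (f := fun v => phi (u + v, u)))//.
    by apply: mphi2 => //; exact: measurable_funD.
  transitivity (expint y (fun j => (expR ((y - (z + y)) * j))%:E * K u)%E).
    by apply: eq_expint => j _; congr (_%:E * _)%E; congr expR; ring.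
  rewrite (expint_tilt (f := cst (K u)))//; last by move=> ?; exact: K0.
  by rewrite expint_cst.
pose L u := expint z (fun x => if u < x ?<= if s then phi (x, u) else 0%E).
have mL : measurable_fun setT L.
  apply: (measurable_expint (F := fun p : R * R =>
    if p.1 < p.2 ?<= if s then phi (p.2, p.1) else 0%E)) => //.
    apply: measurable_fun_ifT => //; first exact: mlt.
    exact: mphi2.
  by move=> p; case: ifP.
have L0 u : (0 <= L u)%E by apply: expint_ge0 => // x; case: ifP.
transitivity (expint (z + y) (fun u =>
    (expR (((z + y) - y) * u))%:E * ((y / (z + y))%:E * L u))%E).
  apply: eq_expint => u u0; rewrite muleCA; congr (_ * _)%E.
  have -> : L u = ((expR (- (z * u)))%:E * K u)%E.
    rewrite -(expint_memoryless s (f := fun v => phi (u + v, u)))//.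
      by apply: eq_expint => x _; case: ifP => // _; congr (phi (_, _)); ring.
    by apply: mphi2 => //; exact: measurable_funD.
  by rewrite muleA -EFinM -expRD (_ : _ + _ = 0) ?expR0 ?mul1e//; ring.
have c0 : (0 <= (y / (z + y))%:E)%E by rewrite lee_fin divr_ge0// ltW.
rewrite expint_tilt//; last 2 first.
- exact: measurable_funeM.
- by move=> u; rewrite mule_ge0.
rewrite expintZl// muleA -EFinM (_ : _ * _ = 1) ?mul1e; last first.
  by field; rewrite !gt_eqF.
symmetry; apply: (expint_exchange (F := fun p : R * R =>
    if p.2 < p.1 ?<= if s then phi p else 0%E)) => //.
- by apply: measurable_fun_ifT => //; exact: mlt.
- by move=> p; case: ifP.
Qed.

End half.

(** Across a unit square, [i] and [j] are the horizontal and vertical increments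
    on the lower and left sides and [u] is the weight of the upper right corner;
    the arguments of [phi] are the increments on the two opposite sides. The
    halves where [i] or [j] is larger are exchanged by symmetry. *)
Lemma burke_law z y (phi : R * R -> \bar R) : 0 < z -> 0 < y ->
  measurable_fun setT phi -> (forall p, 0 <= phi p)%E ->
  expint z (fun i => expint y (fun j => expint (z + y) (fun u =>
    phi (u + Num.max (i - j) 0, u + Num.max (j - i) 0)))) =
  expint z (fun i => expint y (fun j => phi (i, j))).
Proof.
move=> z0 y0 mphi phi0; have b0 : 0 < z + y by rewrite addr_gt0.
pose A (p : R * R * R) : \bar R :=
  if p.1.2 < p.1.1 ?<= if false then phi (p.2 + (p.1.1 - p.1.2), p.2) else 0%E.
pose B (p : R * R * R) : \bar R :=
  if p.1.1 < p.1.2 ?<= if true then phi (p.2, p.2 + (p.1.2 - p.1.1)) else 0%E.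
have mA : measurable_fun setT A.
  apply: measurable_fun_ifT => //.
    by apply: measurable_fun_ltr; exact: measurableT_comp.
  apply: (measurableT_comp mphi); apply: measurable_fun_pair => //.
  by apply: measurable_funD => //; apply: measurable_funB; exact: measurableT_comp.
have mB : measurable_fun setT B.
  apply: measurable_fun_ifT => //.
    by apply: measurable_fun_ler; exact: measurableT_comp.
  apply: (measurableT_comp mphi); apply: measurable_fun_pair => //.
  by apply: measurable_funD => //; apply: measurable_funB; exact: measurableT_comp.
have A0 p : (0 <= A p)%E by rewrite /A; case: ifP.
have B0 p : (0 <= B p)%E by rewrite /B; case: ifP.
have m3 (G : R * R * R -> \bar R) i j : measurable_fun setT G ->
    measurable_fun setT (fun u => G (i, j, u)).
  by move=> mG; exact: (measurableT_comp mG (measurable_pair1 _)).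
have mG3 (G : R * R * R -> \bar R) : measurable_fun setT G -> (forall p, 0 <= G p)%E ->
    measurable_fun setT (fun p : R * R => expint (z + y) (fun u => G (p.1, p.2, u))).
  move=> mG G0; apply: (measurable_expint (F := fun q => G (q.1.1, q.1.2, q.2))) => //.
  rewrite [X in measurable_fun _ X](_ : _ = G)//.
  by apply/funext => -[[i j] u].
have m2 (G : R * R * R -> \bar R) i : measurable_fun setT G -> (forall p, 0 <= G p)%E ->
    measurable_fun setT (fun j => expint (z + y) (fun u => G (i, j, u))).
  by move=> mG G0; exact: (measurableT_comp (mG3 _ mG G0) (measurable_pair1 _)).
have m1 (G : R * R * R -> \bar R) : measurable_fun setT G -> (forall p, 0 <= G p)%E ->
    measurable_fun setT (fun i => expint y (fun j => expint (z + y) (fun u => G (i, j, u)))).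
  move=> mG G0; apply: (measurable_expint (F := fun p : R * R =>
    expint (z + y) (fun u => G (p.1, p.2, u)))) => //; first exact: mG3.
  by move=> p; exact: expint_ge0.
transitivity (expint z (fun i => expint y (fun j => expint (z + y) (fun u => A (i, j, u))) +
    expint y (fun j => expint (z + y) (fun u => B (i, j, u))))%E).
  apply: eq_expint => i _; rewrite -expintD//; last 4 first.
  - exact: m2.
  - by move=> j; exact: expint_ge0.
  - exact: m2.
  - by move=> j; exact: expint_ge0.
  apply: eq_expint => j _; rewrite -expintD//; last 2 first.
  - exact: m3.
  - exact: m3.
  apply: eq_expint => u _; rewrite /A /B /=.
  have [ij|ji] := leP i j.
    rewrite add0e; congr (phi (_, _)).
      by rewrite (_ : Num.max _ _ = 0) ?addr0//; apply/max_idPr; rewrite subr_le0.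
    by congr (_ + _); apply/max_idPl; rewrite subr_ge0.
  rewrite adde0; congr (phi (_, _)).
    by congr (_ + _); apply/max_idPl; rewrite subr_ge0 ltW.
  by rewrite (_ : Num.max _ _ = 0) ?addr0//; apply/max_idPr; rewrite subr_le0 ltW.
rewrite expintD//; last 4 first.
- exact: m1.
- by move=> i; apply: expint_ge0 => // j; exact: expint_ge0.
- exact: m1.
- by move=> i; apply: expint_ge0 => // j; exact: expint_ge0.
rewrite [X in (X + _)%E](burke_law_half false z0 y0 mphi phi0).
have -> : expint z (fun i => expint y (fun j => expint (z + y) (fun u => B (i, j, u)))) =
    expint z (fun i => expint y (fun j => if i < j ?<= if true then phi (i, j) else 0%E)).
  transitivity (expint y (fun j => expint z (fun i =>
      expint (z + y) (fun u => B (i, j, u))))).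
    apply: (expint_exchange (F := fun p =>
      expint (z + y) (fun u => B (p.1, p.2, u)))) => // [|p]; first exact: mG3.
    exact: expint_ge0.
  rewrite [z + y]addrC.
  transitivity (expint y (fun j => expint z (fun i =>
      if i < j ?<= if true then phi (i, j) else 0%E))).
    apply: (@burke_law_half true y z (fun p => phi (p.2, p.1))) => //.
    by apply: (measurableT_comp mphi); exact: measurable_fun_pair.
  apply: (expint_exchange (F := fun p : R * R =>
      if p.2 < p.1 ?<= if true then phi (p.2, p.1) else 0%E)) => // [|p]; last by case: ifP.
  apply: measurable_fun_ifT => //; first exact: measurable_fun_ler.
  by apply: (measurableT_comp mphi); exact: measurable_fun_pair.
have mA' : measurable_fun setT (fun p : R * R => if p.2 < p.1 ?<= if false then phi p else 0%E).
  by apply: measurable_fun_ifT => //; exact: measurable_fun_ltr.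
have mB' : measurable_fun setT (fun p : R * R => if p.1 < p.2 ?<= if true then phi p else 0%E).
  by apply: measurable_fun_ifT => //; exact: measurable_fun_ler.
rewrite -expintD//; last 4 first.
- apply: (measurable_expint y0 mA') => p; by case: ifP.
- by move=> i; apply: expint_ge0 => // j; case: ifP.
- apply: (measurable_expint y0 mB') => p; by case: ifP.
- by move=> i; apply: expint_ge0 => // j; case: ifP.
apply: eq_expint => i _; rewrite -expintD//; last 4 first.
- exact: (measurableT_comp mA' (measurable_pair1 _)).
- by move=> j; case: ifP.
- exact: (measurableT_comp mB' (measurable_pair1 _)).
- by move=> j; case: ifP.
apply: eq_expint => j _ /=.
by have [ij|ji] := leP i j; rewrite ?add0e ?adde0.
Qed.

End burke_law.

(** * Random configurations with independent exponential coordinates *)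

Definition site : Type := (nat * nat)%type.
HB.instance Definition _ := Choice.on site.

Definition config (R : realType) : Type := site -> R.

(** Finite-dimensional events: a pi-system that generates the product
    sigma-algebra. *)
Definition cylinder (R : realType) : set (set (config R)) :=
  [set B | exists (J : seq site) (A : site -> set R),
     (forall k, measurable (A k)) /\
     B = [set x | forall k, k \in J -> A k (x k)]].

HB.instance Definition _ (R : realType) := gen_eqMixin (config R).
HB.instance Definition _ (R : realType) := gen_choiceMixin (config R).
HB.instance Definition _ (R : realType) := isPointed.Build (config R) (fun=> 0).
HB.instance Definition _ (R : realType) :=
  @isMeasurable.Build (sigma_display (@cylinder R)) (config R) <<s @cylinder R >>
    (@sigma_algebra0 _ setT _) (@sigma_algebraC _ _)
    (@sigma_algebra_bigcup _ setT _).

Definition upd (R : realType) (k : site) (u : R) (x : config R) : config R :=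
  fun l => if l == k then u else x l.

Section config_measurability.
Variable R : realType.

Lemma measurable_coord (k : site) :
  measurable_fun setT (fun x : config R => x k).
Proof.
move=> _ A mA; rewrite setTI; apply: sub_sigma_algebra.
exists [:: k], (fun=> A); split => //.
by apply/seteqP; split => x /=; [move=> Ax l; rewrite inE => /eqP -> | apply; rewrite inE].
Qed.

Lemma measurable_config d (T : measurableType d) (f : T -> config R) :
  (forall k, measurable_fun setT (fun t => f t k)) -> measurable_fun setT f.
Proof.
move=> mf; apply: (measurability (@cylinder R)) => //.
move=> _ [_ [J [A [mA ->]]] <-]; rewrite setTI.
have -> : f @^-1` [set x | forall k, k \in J -> A k (x k)] =
    \bigcap_(k in [set` J]) ((fun t => f t k) @^-1` A k).
  by apply/seteqP; split => t /=; apply.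
apply: fin_bigcap_measurable; first exact: finite_seq.
by move=> k _; rewrite -[X in measurable X]setTI; exact: mf.
Qed.

Lemma measurable_upd (k : site) :
  measurable_fun setT (fun p : config R * R => upd k p.2 p.1).
Proof.
apply: measurable_config => l; rewrite /upd; case: (l == k).
  exact: measurable_snd.
exact: (measurableT_comp (measurable_coord l)).
Qed.

Lemma measurable_upd1 d (T : measurableType d) (k : site) (f : T -> config R)
    (g : T -> R) : measurable_fun setT f -> measurable_fun setT g ->
  measurable_fun setT (fun t => upd k (g t) (f t)).
Proof.
by move=> mf mg; exact: (measurableT_comp (measurable_upd k) (measurable_fun_pair mf mg)).
Qed.

Lemma updC (k l : site) (a b : R) x : k != l -> upd k a (upd l b x) = upd l b (upd k a x).
Proof.
move=> kl; apply/funext => m; rewrite /upd; case: eqP => // ->.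
by rewrite (negbTE kl).
Qed.

Lemma upd_at (k : site) (a : R) x : upd k a x k = a.
Proof. by rewrite /upd eqxx. Qed.

Lemma upd_other (k l : site) (a : R) x : l != k -> upd k a x l = x l.
Proof. by rewrite /upd => /negbTE ->. Qed.

Lemma measurable_expint_upd r k (F : config R -> \bar R) : 0 < r ->
  measurable_fun setT F -> (forall x, 0 <= F x)%E ->
  measurable_fun setT (fun x => expint r (fun u => F (upd k u x))).
Proof.
move=> r0 mF F0.
apply: (measurable_expint (F := fun p : config R * R => F (upd k p.2 p.1))) => //.
exact: (measurableT_comp mF (measurable_upd k)).
Qed.

End config_measurability.

Section indep_exp.
Context d (T : measurableType d) (R : realType) (P : probability T R).
Implicit Types (S : {pred site}) (r : site -> R) (X Y : T -> config R).

(** The coordinates in [S] are exponential, mutually independent, and independent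
    of the others. Stating this as invariance under the resampling of one
    coordinate makes it stable under maps that update finitely many
    coordinates. *)
Definition indep_exp S r X : Prop :=
  [/\ measurable_fun setT X, forall k, k \in S -> 0 < r k &
      forall k, k \in S -> forall F : config R -> \bar R,
        measurable_fun setT F -> (forall x, 0 <= F x)%E ->
        (\int[P]_t F (X t) = \int[P]_t expint (r k) (fun u => F (upd k u (X t))))%E].

(** This is [expint_tilt] for one resampled coordinate. It converts exponential
    moments of a model with two parameters into expectations for a stationary
    one. *)
Lemma indep_exp_tilt S S' r r' X Y k (F : config R -> \bar R) :
  indep_exp S r X -> indep_exp S' r' Y -> k \in S -> k \in S' ->
  (forall t l, l != k -> X t l = Y t l) ->
  measurable_fun setT F -> (forall x, 0 <= F x)%E ->
  (\int[P]_t ((expR ((r k - r' k) * X t k))%:E * F (X t)) =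
   (r k / r' k)%:E * \int[P]_t F (Y t))%E.
Proof.
move=> [mX r0 indX] [mY r'0 indY] kS kS' XY mF F0.
have mG : measurable_fun setT (fun x : config R => ((expR ((r k - r' k) * x k))%:E * F x)%E).
  apply: emeasurable_funM => //; apply: measurableT_comp => //.
  apply: measurableT_comp => //; apply: measurable_funM => //.
  exact: measurable_coord.
rewrite (indX k kS _ mG); last by move=> x; rewrite mule_ge0// lee_fin expR_ge0.
rewrite (indY k kS' _ mF F0) -ge0_integralZl//; last 3 first.
- exact: (measurableT_comp (measurable_expint_upd k (r'0 _ kS') mF F0) mY).
- by move=> t _; apply: expint_ge0 => //; exact: r'0.
- by rewrite lee_fin divr_ge0// ltW ?r0 ?r'0.
apply: eq_integral => t _.
have -> : (fun u => F (upd k u (Y t))) = (fun u => F (upd k u (X t))).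
  apply/funext => u; congr F; apply/funext => l; rewrite /upd.
  by case: eqP => // /eqP lk; rewrite XY.
transitivity (expint (r k)
    (fun u => (expR ((r k - r' k) * u))%:E * F (upd k u (X t)))%E).
  by apply: eq_expint => u _; rewrite upd_at.
apply: (@expint_tilt _ _ _ (fun u => F (upd k u (X t))) (r0 _ kS) (r'0 _ kS')).
  by apply: (measurableT_comp mF); exact: measurable_upd1.
by move=> u; exact: F0.
Qed.

Definition rescale S r (sigma : site -> site) (x : config R) : config R :=
  fun k => if k \in S then x (sigma k) / r k else 0.

(** By injectivity, resampling a coordinate of the relabelled configuration
    amounts to resampling a coordinate of the original one. *)
Lemma indep_exp_reindex S S0 r (sigma : site -> site) X :
  indep_exp S0 (fun=> 1) X ->
  {in S &, injective sigma} -> (forall k, k \in S -> sigma k \in S0) ->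
  (forall k, k \in S -> 0 < r k) ->
  indep_exp S r (fun t => rescale S r sigma (X t)).
Proof.
move=> [mX _ indX] inj_s sS0 r0.
have mres : measurable_fun setT (rescale S r sigma : config R -> config R).
  apply: measurable_config => k; rewrite /rescale; case: (k \in S) => //.
  by apply: measurable_funM => //; exact: measurable_coord.
split=> //; first exact: (measurableT_comp mres).
move=> k kS F mF F0.
etransitivity.
  apply: (indX _ (sS0 _ kS) (F \o rescale S r sigma)) => [|x]; last exact: F0.
  exact: (measurableT_comp mF).
apply: eq_integral => t _.
transitivity (expint 1 (fun u => F (upd k (u / r k) (rescale S r sigma (X t))))); last first.
  apply: (@expint_scale _ _ (fun u => F (upd k u (rescale S r sigma (X t)))) (r0 _ kS)).
    by apply: (measurableT_comp mF); exact: measurable_upd1.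
  by move=> u; exact: F0.
apply: eq_expint => u _ /=; congr F; apply/funext => l.
rewrite /rescale /upd; have [lS|lS] := ifPn.
  by rewrite (inj_in_eq inj_s)//; case: eqP => [->|].
by case: eqP => // lk; rewrite lk kS in lS.
Qed.

Section burke_step.
Variables (S : {pred site}) (r : site -> R) (X : T -> config R) (k1 k2 k3 : site).
Hypotheses (indX : indep_exp S r X) (k1S : k1 \in S) (k2S : k2 \in S) (k3S : k3 \in S).
Hypotheses (k12 : k1 != k2) (k13 : k1 != k3) (k23 : k2 != k3).
Hypothesis r3 : r k3 = r k1 + r k2.

(** The cells [k1] and [k2] exchange incoming for outgoing increments, and the
    weight in [k3] is consumed. *)
Definition burke_map (k1 k2 k3 : site) (x : config R) : config R :=
  upd k3 0 (upd k2 (x k3 + Num.max (x k2 - x k1) 0)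
           (upd k1 (x k3 + Num.max (x k1 - x k2) 0) x)).

Lemma measurable_burke_map : measurable_fun setT (burke_map k1 k2 k3).
Proof.
have m l : measurable_fun setT (fun x : config R => x l) := measurable_coord l.
apply: measurable_upd1 => //; apply: measurable_upd1.
  apply: measurable_upd1 => //.
  by apply: measurable_funD => //; apply: measurable_maxr => //; exact: measurable_funB.
by apply: measurable_funD => //; apply: measurable_maxr => //; exact: measurable_funB.
Qed.

Let base a b (x : config R) := upd k3 0 (upd k2 b (upd k1 a x)).

Let mbase d' (T' : measurableType d') (f : T' -> config R) (g h : T' -> R) :
  measurable_fun setT f -> measurable_fun setT g -> measurable_fun setT h ->
  measurable_fun setT (fun t => base (g t) (h t) (f t)).
Proof. by move=> mf mg mh; do 3 apply: measurable_upd1 => //. Qed.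

Let r1_gt0 : 0 < r k1. Proof. by case: indX => _ r0 _; exact: r0. Qed.
Let r2_gt0 : 0 < r k2. Proof. by case: indX => _ r0 _; exact: r0. Qed.
Let r3_gt0 : 0 < r k3. Proof. by case: indX => _ r0 _; exact: r0. Qed.

Let burke_integral (F : config R -> \bar R) :
  measurable_fun setT F -> (forall x, 0 <= F x)%E ->
  (\int[P]_t F (burke_map k1 k2 k3 (X t)) =
   \int[P]_t expint (r k1) (fun a => expint (r k2) (fun b => F (base a b (X t)))))%E.
Proof.
move=> mF F0; case: indX => mX _ ind.
pose F' x := F (burke_map k1 k2 k3 x).
have mF' : measurable_fun setT F' by exact: (measurableT_comp mF measurable_burke_map).
have F'0 x : (0 <= F' x)%E by exact: F0.
pose F3 x := expint (r k3) (fun u => F' (upd k3 u x)).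
have mF3 : measurable_fun setT F3 by exact: measurable_expint_upd.
have F30 x : (0 <= F3 x)%E by apply: expint_ge0.
pose F2 x := expint (r k2) (fun u => F3 (upd k2 u x)).
have mF2 : measurable_fun setT F2 by exact: measurable_expint_upd.
have F20 x : (0 <= F2 x)%E by apply: expint_ge0.
transitivity (\int[P]_t expint (r k1) (fun u => F2 (upd k1 u (X t))))%E.
  by rewrite -(ind _ k1S F2)// -(ind _ k2S F3)// -(ind _ k3S F').
apply: eq_integral => t _.
symmetry; etransitivity.
  symmetry; apply: (@burke_law _ _ _ (fun p => F (base p.1 p.2 (X t)))) => //.
  by apply: (measurableT_comp mF); exact: mbase.
symmetry.
apply: eq_expint => i _; apply: eq_expint => j _; rewrite -r3; apply: eq_expint => u _.
rewrite /F' /= /burke_map upd_at (upd_other _ _ k23) upd_at (upd_other _ _ k13).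
rewrite (upd_other _ _ k12) upd_at; congr F; rewrite /base.
by apply/funext => l; rewrite /upd; do 3 case: eqP => //.
Qed.

(** Expectations after the update are computed by resampling the three cells
    beforehand and applying [burke_law]; this displays [k1] and [k2] as
    independent exponential coordinates, which can be resampled again. *)
Lemma indep_exp_burke :
  indep_exp [pred k in S | k != k3] r (fun t => burke_map k1 k2 k3 (X t)).
Proof.
have [mX r0 ind] := indX; split.
- exact: (measurableT_comp measurable_burke_map).
- by move=> k; rewrite inE => /andP[/r0].
move=> k; rewrite inE => /andP[kS kk3] F mF F0.
have mFupd : measurable_fun setT (fun x => expint (r k) (fun u => F (upd k u x))).
  by apply: measurable_expint_upd => //; exact: r0.
have Fupd0 x : (0 <= expint (r k) (fun u => F (upd k u x)))%E.
  by apply: expint_ge0 => //; exact: r0.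
have [kk1|kk1] := eqVneq k k1; [|have [kk2|kk2] := eqVneq k k2].
- subst k; rewrite (burke_integral mF F0) [RHS](burke_integral mFupd Fupd0).
  apply: eq_integral => t _.
  transitivity (expint (r k1) (fun a => expint (r k2) (fun b => expint (r k1)
      (fun u => F (base u b (X t)))))); last first.
    apply: eq_expint => a _; apply: eq_expint => b _; apply: eq_expint => u _.
    by congr F; apply/funext => l; rewrite /base /upd; have [->|//] := eqVneq l k1; rewrite (negbTE k13) (negbTE k12).
  symmetry; etransitivity.
    apply: (@expint_cst _ _ (expint (r k2) (fun b => expint (r k1)
      (fun u => F (base u b (X t)))))) => //.
    by apply: expint_ge0 => // b; exact: expint_ge0.
  symmetry.
  apply: (expint_exchange (F := fun p => F (base p.1 p.2 (X t)))) => //.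
  by apply: (measurableT_comp mF); exact: mbase.
- subst k; rewrite (burke_integral mF F0) [RHS](burke_integral mFupd Fupd0).
  apply: eq_integral => t _; apply: eq_expint => a _.
  transitivity (expint (r k2) (fun b => expint (r k2)
      (fun u => F (base a u (X t))))); last first.
    apply: eq_expint => b _; apply: eq_expint => u _.
    by congr F; apply/funext => l; rewrite /base /upd; have [->|//] := eqVneq l k2; rewrite (negbTE k23).
  symmetry; apply: (@expint_cst _ _ (expint (r k2) (fun u => F (base a u (X t))))) => //.
  exact: expint_ge0.
etransitivity.
  apply: (ind _ kS (F \o burke_map k1 k2 k3)) => [|x]; last exact: F0.
  exact: (measurableT_comp mF measurable_burke_map).
apply: eq_integral => t _; apply: eq_expint => u _ /=; congr F.
rewrite /burke_map !(upd_other u) 1?eq_sym//.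
by rewrite (updC _ _ _ kk3) (updC _ _ _ kk2) (updC _ _ _ kk1).
Qed.

End burke_step.

End indep_exp.

Definition nonorigin : {pred site} := [pred k : site | k != (0%N, 0%N)].

Lemma expint_law (R : realType) (r : R) (nu : {measure set R -> \bar R})
    (f : R -> \bar R) : 0 < r ->
  (forall A, measurable A ->
     nu A = \int[lebesgue_measure]_(x in A) (exponential_pdf r x)%:E)%E ->
  measurable_fun setT f -> (forall x, 0 <= f x)%E ->
  (\int[nu]_x f x = expint r f)%E.
Proof.
move=> r0 nuE mf f0.
(* Lebesgue measure is defined on another copy of the measurable space [R]; its
   image under the identity is a measure on this one. *)
have mid : measurable_fun setT (idfun : measurableTypeR R -> R).
  by move=> _ A mA; rewrite setTI.
have [lam _ intlam] := image_measure (@lebesgue_measure R) mid.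
have mpdf : measurable_fun setT (fun x : R => (exponential_pdf r x)%:E).
  by apply/measurable_EFinP; exact: measurable_exponential_pdf.
have pdf0 x : 0 <= exponential_pdf r x by rewrite exponential_pdf_ge0// ltW.
rewrite (ge0_integral_density (mu := lam) (g := exponential_pdf r))//.
- rewrite intlam//; first exact: emeasurable_funM.
  by move=> x; rewrite mule_ge0// lee_fin.
- exact: measurable_exponential_pdf.
- move=> A mA; rewrite nuE// [LHS]integral_mkcond [RHS]integral_mkcond intlam//.
    apply: (iffLR (measurable_restrictT _ mA)).
    apply: measurable_funS mpdf => //.
  by move=> x; rewrite patchE; case: ifP => // _; rewrite lee_fin.
Qed.

Section indep_exp_of_independent.
Context d (T : measurableType d) (R : realType) (P : probability T R).

(** Rate-one weights. The truncation makes them nonnegative at every point of the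
    sample space, so that passage times can be compared pointwise. *)
Definition normalized (rho : site -> R) (X : site -> T -> R) (t : T) : config R :=
  fun k => if k \in nonorigin then Num.max 0 (rho k * X k t) else 0.

Lemma normalized_ge0 rho X t k : 0 <= normalized rho X t k.
Proof. by rewrite /normalized; case: ifP => // _; rewrite le_max lexx. Qed.

Lemma exponential_rv_lt0 (rho : R) (X : {RV P >-> R}) : 0 < rho ->
  exponential_rv rho X -> P [set t | X t < 0] = 0%E.
Proof.
move=> rho0 /(_ [set u | u < 0]) XE.
have m0 : measurable [set u : R | u < 0].
  rewrite (_ : [set _ | _] = `]-oo, 0[%classic)//.
transitivity (distribution P X [set u | u < 0]) => //.
rewrite (XE m0) /exponential_prob; apply: integral0_eq => u /= u0.
by rewrite lt0_exponential_pdf.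
Qed.

Lemma exponential_law_normalized (rho : R) (X : {RV P >-> R}) (A : set R) : 0 < rho ->
  exponential_rv rho X -> measurable A ->
  P ((fun t => Num.max 0 (rho * X t)) @^-1` A) =
  (\int[lebesgue_measure]_(u in A) (exponential_pdf 1 u)%:E)%E.
Proof.
move=> rho0 XE mA.
pose h (u : R) : R := Num.max 0 (rho * u).
have mh : measurable_fun setT h by apply: measurable_maxr => //; exact: measurable_funM.
have mhA : measurable (h @^-1` A) by rewrite -[X in measurable X]setTI; exact: mh.
transitivity (distribution P X (h @^-1` A)) => //.
rewrite (XE _ mhA) /exponential_prob.
have m1 (B : set R) : measurable B -> measurable_fun setT (fun u : R => (\1_B u)%:E : \bar R).
  by move=> mB; apply/measurable_EFinP; exact: measurable_indic.
have indE (r : R) (B : set R) : measurable B ->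
    (\int[lebesgue_measure]_(u in B) (exponential_pdf r u)%:E =
     expint r (fun u => (\1_B u)%:E))%E.
  move=> mB; rewrite /expint integral_mkcond; apply: eq_integral => u _.
  by rewrite patchE indicE; case: ifP => _; rewrite ?mule1 ?mule0.
rewrite !indE//.
transitivity (expint rho (fun u => (\1_A (rho * u))%:E)).
  apply: eq_expint => u u0; congr EFin; rewrite !indicE; congr (nat_of_bool _)%:R.
  have <- : h u = rho * u by apply/max_idPr; rewrite mulr_ge0// ltW.
  by apply/idP/idP; rewrite !inE.
rewrite -expint_scale//; last first.
  by apply: (measurableT_comp (m1 _ mA)); exact: measurable_funM.
by apply: eq_expint => u _; rewrite mulrC divfK// gt_eqF.
Qed.

(** The law of the configuration and its law after resampling a coordinate agree
    on cylinders by the product rule, hence on all measurable sets. *)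
Lemma indep_exp_normalized (rho : site -> R) (X : site -> {RV P >-> R}) :
  mutually_independent (I := (nat * nat)%type) X ->
  (forall k, k \in nonorigin -> 0 < rho k) ->
  (forall k, k \in nonorigin -> exponential_rv (rho k) (X k)) ->
  indep_exp P nonorigin (fun=> 1) (normalized rho X).
Proof.
move=> iX rho0 XE; pose U := normalized rho X.
pose h k (u : R) : R := if k \in nonorigin then Num.max 0 (rho k * u) else 0.
have mh k : measurable_fun setT (h k).
  rewrite /h; case: (k \in nonorigin) => //.
  by apply: measurable_maxr => //; exact: measurable_funM.
have Uh t k : U t k = h k (X k t) by [].
have mUk k : measurable_fun setT (fun t => U t k).
  exact: (measurableT_comp (mh k) (measurable_funPT (X k))).
have mU : measurable_fun setT U by apply: measurable_config.
split => // k kS F mF F0.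
have [nu1 nu1E int1] := image_measure P mU.
pose Ukmix := isMeasurableFun.Build _ _ _ _ (fun t => U t k) (mUk k).
pose Uk : {mfun T >-> R} := HB.pack (fun t => U t k) Ukmix.
pose Q := distribution P Uk.
have [nu2 nu2E int2] : exists2 nu : {measure set (config R) -> \bar R},
    (forall A, nu A = (P \x Q)%E ((fun p : T * R => upd k p.2 (U p.1)) @^-1` A)) &
    forall f : config R -> \bar R, measurable_fun setT f -> (forall y, 0 <= f y)%E ->
      (\int[nu]_y f y = \int[P \x Q]_p f (upd k p.2 (U p.1)))%E.
  apply: image_measure; apply: measurable_upd1 => //.
  exact: (measurableT_comp mU).
have PJ (J : {fset nat * nat}) (A : site -> set R) : (forall l, measurable (A l)) ->
    P [set t | forall l, l \in J -> A l (U t l)] =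
    (\prod_(l <- J) P ((fun t => U t l) @^-1` A l))%E.
  move=> mA; rewrite -(iX J (fun l => h l @^-1` A l)); last first.
    by move=> l; rewrite -[X in measurable X]setTI; exact: mh.
  by congr (P _); apply/seteqP; split => t /=; apply.
have cyl_eq A : cylinder A -> nu1 A = nu2 A.
  move=> [J [B [mB ->]]]; rewrite nu1E nu2E.
  pose B' := if k \in J then B k else setT.
  have mB' : measurable B' by rewrite /B'; case: ifP.
  pose J' : {fset nat * nat} := [fset l in [seq l <- J | l != k]]%fset.
  pose C l := if l == k then B' else B l.
  have mC l : measurable (C l) by rewrite /C; case: ifP.
  have J'E l : (l \in J') = (l \in J) && (l != k).
    by rewrite !inE mem_filter andbC.
  have kJ' : k \notin J' by rewrite J'E eqxx andbF.
  have -> : (fun p : T * R => upd k p.2 (U p.1)) @^-1`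
      [set x | forall l, l \in J -> B l (x l)] =
      [set t | forall l, l \in J' -> C l (U t l)] `*` B'.
    apply/seteqP; split => -[t u] /=.
      move=> H; split; first by move=> l; rewrite J'E => /andP[lJ lk]; have := H _ lJ; rewrite /C upd_other// (negbTE lk).
      by rewrite /B'; case: ifPn => // kJ; have := H _ kJ; rewrite upd_at.
    move=> [H Bu] l lJ; have [lk|lk] := eqVneq l k.
      by subst l; rewrite upd_at; move: Bu; rewrite /B' lJ.
    by rewrite upd_other//; have := H l; rewrite J'E lJ lk /C (negbTE lk); exact.
  rewrite product_measure1E//; last first.
    have -> : [set t | forall l, l \in J' -> C l (U t l)] =
        \bigcap_(l in [set` J']) ((fun t => U t l) @^-1` C l).
      by apply/seteqP; split => t /=; apply.
    apply: fin_bigcap_measurable => // l _.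
    by rewrite -[X in measurable X]setTI; exact: (mUk l).
  transitivity (P [set t | forall l, l \in (k |` J')%fset -> C l (U t l)]).
    congr (P _); apply/seteqP; split => t /= H l.
      rewrite in_fset1U J'E => /orP[/eqP -> |]; last by move=> /andP[lJ lk]; rewrite /C (negbTE lk); exact: H.
      by rewrite /C eqxx /B'; case: ifPn => // kJ; exact: H.
    move=> lJ; have := H l; rewrite in_fset1U J'E lJ /= /C.
    by have [lk|lk] := eqVneq l k; [subst l; rewrite /B' lJ; exact|exact].
  rewrite !PJ// big_fsetU1//= muleC; congr (_ * _)%E; first by rewrite PJ.
  by have -> : C k = B' by rewrite /C eqxx.
have nuE A : measurable A -> nu1 A = nu2 A.
  move=> mA.
  have cylI : setI_closed (@cylinder R).
    move=> _ _ [J1 [B1 [mB1 ->]]] [J2 [B2 [mB2 ->]]].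
    exists (J1 ++ J2), (fun l => (if l \in J1 then B1 l else setT) `&`
                               (if l \in J2 then B2 l else setT)); split.
      by move=> l; apply: measurableI; case: ifP.
    apply/seteqP; split => x /=.
      move=> [H1 H2] l _; split; first by case: ifP => // lJ; exact: H1.
      by case: ifP => // lJ; exact: H2.
    move=> H; split => l lJ; have := H l; rewrite mem_cat lJ ?orbT => /(_ isT) [] //.
  have cT : @cylinder R setT.
    by exists [::], (fun=> setT); split => //; apply/seteqP; split.
  apply: (measure_unique (@cylinder R) (fun=> setT)) => //.
  - by apply/seteqP; split => // x _; exists 0%N.
  - move=> _; rewrite nu1E [X in (X < _)%E](_ : _ = 1%E) ?ltry//.
    exact: (@probability_setT _ _ _ P).
rewrite -int1//.
transitivity (\int[nu2]_x F x)%E.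
  by apply: eq_measure_integral => A mA _; exact: nuE.
rewrite int2// fubini_tonelli1//; last first.
  by apply: (measurableT_comp mF); apply: measurable_upd1 => //; exact: (measurableT_comp mU).
apply: eq_integral => t _; rewrite /fubini_F /=.
apply: (@expint_law _ 1 (distribution P Uk) (fun u => F (upd k u (U t)))) => //.
- move=> A mA; rewrite -(exponential_law_normalized (rho0 _ kS) (XE _ kS) mA).
  rewrite /Q /distribution /pushforward; congr (P _).
  by apply/seteqP; split => s; rewrite /= /U /normalized kS.
- by apply: (measurableT_comp mF); exact: measurable_upd1.
Qed.

End indep_exp_of_independent.

(** * Recursions and comparisons for last-passage times *)

Section lpp_recursion.
Variable R : realType.
Implicit Types (f : config R) (u v w : site).

Definition le_site u v := (u.1 <= v.1)%N && (u.2 <= v.2)%N.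

Lemma up_right_le u v : up_right u v -> le_site u v.
Proof. by case: u v => [a b] [c e] /orP[] /eqP[-> ->]; rewrite /le_site/= leqnn leqnSn. Qed.

Lemma le_site_trans v u w : le_site u v -> le_site v w -> le_site u w.
Proof.
move=> /andP[h1 h2] /andP[h3 h4].
by apply/andP; split; [exact: leq_trans h1 h3|exact: leq_trans h2 h4].
Qed.

Lemma path_le_last u p : path up_right u p -> le_site u (last u p).
Proof.
elim: p u => [|w p IH] u /=; first by rewrite /le_site !leqnn.
by move=> /andP[/up_right_le uw /IH]; exact: le_site_trans.
Qed.

Lemma path_weight_cons f u w p : path_weight f u (w :: p) = f u + path_weight f w p.
Proof. by rewrite /path_weight big_cons. Qed.

Lemma path_weight_rcons f u p w : path_weight f u (rcons p w) = path_weight f u p + f w.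
Proof. by rewrite /path_weight -rcons_cons big_rcons /= addrC. Qed.

Lemma lpp_attained f u v : le_site u v ->
  exists2 p, up_right_paths u v p & lpp f u v = path_weight f u p.
Proof. by move=> /andP[h1 h2]; case: (lpp_max f h1 h2). Qed.

Lemma path_weight_le_lpp f u v p : up_right_paths u v p -> path_weight f u p <= lpp f u v.
Proof.
move=> pP; have /andP[h1 h2] : le_site u v by case: pP => pp <-; exact: path_le_last.
by case: (lpp_max f h1 h2) => _; apply.
Qed.

Lemma lpp_refl f u : lpp f u u = f u.
Proof.
have uu : le_site u u by rewrite /le_site !leqnn.
have [p [pp pl] ->] := lpp_attained f uu.
case: p pp pl => [|w p]; first by rewrite /path_weight big_seq1.
move=> /= /andP[uw pw] pl; have := path_le_last pw; rewrite pl => /andP[h1 h2].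
case: u w uw h1 h2 {uu pw pl} => [a b] [c e] /orP[] /eqP[-> ->] /=.
  by rewrite ltnn.
by rewrite ltnn.
Qed.

Lemma lpp_last_le f u w v : le_site u w -> up_right w v -> lpp f u w + f v <= lpp f u v.
Proof.
move=> uw wv; have [p [pp pl] ->] := lpp_attained f uw.
rewrite -path_weight_rcons; apply: path_weight_le_lpp; split.
  by rewrite rcons_path pp pl.
by rewrite last_rcons.
Qed.

Lemma lpp_last_ex f u v : le_site u v -> u != v ->
  exists w, [/\ le_site u w, up_right w v & lpp f u v = lpp f u w + f v].
Proof.
move=> uv nuv; have [p [pp pl] E] := lpp_attained f uv.
case/lastP: p pp pl E => [|p w]; first by move=> _ /= uE; rewrite uE eqxx in nuv.
rewrite rcons_path last_rcons => /andP[pp wv] wE; subst w => E.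
exists (last u p); split => //; first exact: path_le_last.
apply/eqP; rewrite eq_le lpp_last_le ?path_le_last// andbT E path_weight_rcons lerD2r.
exact: path_weight_le_lpp.
Qed.

Lemma lpp_first_le f u w v : up_right u w -> le_site w v -> f u + lpp f w v <= lpp f u v.
Proof.
move=> uw wv; have [p [pp pl] ->] := lpp_attained f wv.
rewrite -path_weight_cons; apply: path_weight_le_lpp; split => //=.
by rewrite uw.
Qed.

Lemma lpp_first_ex f u v : le_site u v -> u != v ->
  exists w, [/\ le_site w v, up_right u w & lpp f u v = f u + lpp f w v].
Proof.
move=> uv nuv; have [p [pp pl] E] := lpp_attained f uv.
case: p pp pl E => [|w p]; first by move=> _ /= uE; rewrite uE eqxx in nuv.
move=> /= /andP[uw pp] pl E.
have wv : le_site w v by rewrite -pl; exact: path_le_last.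
exists w; split => //.
apply/eqP; rewrite eq_le lpp_first_le// andbT E path_weight_cons lerD2l.
exact: path_weight_le_lpp.
Qed.

(** The last-passage recursion on a rectangle, with weights [g]: it determines
    the table [H], whichever corner the paths grow from. *)
Definition lpp_table (I J : nat) (g H : nat -> nat -> R) : Prop :=
  [/\ H 0%N 0%N = g 0%N 0%N,
      forall i, (i < I)%N -> H i.+1 0%N = H i 0%N + g i.+1 0%N,
      forall j, (j < J)%N -> H 0%N j.+1 = H 0%N j + g 0%N j.+1 &
      forall i j, (i < I)%N -> (j < J)%N ->
        H i.+1 j.+1 = Num.max (H i j.+1) (H i.+1 j) + g i.+1 j.+1].

Lemma lpp_table_uniq I J g H g' H' : lpp_table I J g H -> lpp_table I J g' H' ->
  (forall i j, (i <= I)%N -> (j <= J)%N -> g i j = g' i j) ->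
  forall i j, (i <= I)%N -> (j <= J)%N -> H i j = H' i j.
Proof.
move=> [a1 a2 a3 a4] [b1 b2 b3 b4] gg'; elim=> [|i IH]; elim=> [|j IHj] iI jJ.
- by rewrite a1 b1 gg'.
- by rewrite a3// b3// gg'// IHj// ltnW.
- by rewrite a2// b2// gg'// IH// ltnW.
- by rewrite a4// b4// gg'// IHj ?IH// ltnW.
Qed.

Lemma lpp_table_last f u I J :
  lpp_table I J (fun i j => f (u.1 + i, u.2 + j)%N) (fun i j => lpp f u (u.1 + i, u.2 + j)%N).
Proof.
have le0 i j : le_site u (u.1 + i, u.2 + j)%N by rewrite /le_site/= !leq_addr.
split.
- by rewrite !addn0 -surjective_pairing lpp_refl.
- move=> i _; have [|w [uw wv ->]] := lpp_last_ex f (le0 i.+1 0%N).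
    by case: u {le0} => a b; apply/eqP => -[]; lia.
  congr (lpp f u _ + _); case: u w uw wv {le0} => a b [c e] /andP[/= h1 h2] /orP[] /eqP[]; rewrite ?addnS.
    by move=> [->] <-.
  by lia.
- move=> j _; have [|w [uw wv ->]] := lpp_last_ex f (le0 0%N j.+1).
    by case: u {le0} => a b; apply/eqP => -[]; lia.
  congr (lpp f u _ + _); case: u w uw wv {le0} => a b [c e] /andP[/= h1 h2] /orP[] /eqP[]; rewrite ?addnS.
    by lia.
  by move=> <- [->].
- move=> i j _ _; apply/eqP; rewrite eq_le; apply/andP; split; last first.
    rewrite -lerBrDr ge_max !lerBrDr; apply/andP; split; apply: lpp_last_le => //.
      by rewrite /up_right/= !addnS eqxx.
    by rewrite /up_right/= !addnS eqxx orbT.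
  have [|w [uw wv ->]] := lpp_last_ex f (le0 i.+1 j.+1).
    by case: u {le0} => a b; apply/eqP => -[]; lia.
  rewrite lerD2r le_max; case: u w uw wv {le0} => a b [c e] _ /orP[] /eqP[]; rewrite ?addnS.
    by move=> [->] <-; rewrite lexx.
  by move=> <- [->]; rewrite lexx orbT.
Qed.

Lemma lpp_table_first f v I J : (I <= v.1)%N -> (J <= v.2)%N ->
  lpp_table I J (fun i j => f (v.1 - i, v.2 - j)%N) (fun i j => lpp f (v.1 - i, v.2 - j)%N v).
Proof.
move=> Iv Jv.
have le0 i j : le_site (v.1 - i, v.2 - j)%N v by rewrite /le_site/= !leq_subr.
split.
- by rewrite !subn0 -surjective_pairing lpp_refl.
- move=> i iI; have [|w [uw wv ->]] := lpp_first_ex f (le0 i.+1 0%N).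
    by case: v Iv {le0 Jv} => a b /=; apply: contraTneq => -[]; lia.
  rewrite addrC; congr (lpp f _ v + _).
  case: v w uw wv Iv {le0 Jv} => a b [c e] /andP[/= h1 h2] /orP[] /eqP[] /=; last by lia.
  by move=> -> -> ?; congr (_, _); lia.
- move=> j jJ; have [|w [uw wv ->]] := lpp_first_ex f (le0 0%N j.+1).
    by case: v Jv {le0 Iv} => a b /=; apply: contraTneq => -[]; lia.
  rewrite addrC; congr (lpp f _ v + _).
  case: v w uw wv Jv {le0 Iv} => a b [c e] /andP[/= h1 h2] /orP[] /eqP[] /=; first by lia.
  by move=> -> -> ?; congr (_, _); lia.
- move=> i j iI jJ; apply/eqP; rewrite eq_le; apply/andP; split; last first.
    rewrite -lerBrDr ge_max !lerBrDr addrC [X in _ && (X <= _)]addrC; apply/andP; split; apply: lpp_first_le => //.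
      by apply/orP; left; apply/eqP; congr (_, _) => /=; lia.
    by apply/orP; right; apply/eqP; congr (_, _) => /=; lia.
  have [|w [uw wv ->]] := lpp_first_ex f (le0 i.+1 j.+1).
    by case: v Jv {le0 Iv} => a b /=; apply: contraTneq => -[]; lia.
  rewrite addrC lerD2r le_max; apply/orP.
  case: v w uw wv Jv Iv {le0} => a b [c e] _ /orP[] /eqP[] /= -> -> ? ?.
    left; rewrite (_ : (a - i.+1).+1 = a - i)%N//; lia.
  right; rewrite (_ : (b - j.+1).+1 = b - j)%N//; lia.
Qed.

Lemma lpp_agree f f' u v : le_site u v ->
  (forall q, le_site u q -> le_site q v -> f q = f' q) -> lpp f u v = lpp f' u v.
Proof.
move=> /andP[h1 h2].
have -> : v = (u.1 + (v.1 - u.1), u.2 + (v.2 - u.2))%N by case: v h1 h2 => a b /= h1 h2; congr (_, _); lia.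
move: (v.1 - u.1)%N (v.2 - u.2)%N => I J ff'.
apply: (lpp_table_uniq (lpp_table_last f u _ _) (lpp_table_last f' u _ _) _ (leqnn _) (leqnn _)).
by move=> i j iI jJ; apply: ff'; rewrite /le_site/= ?leq_addr// !leq_add2l iI.
Qed.

Definition transpose (x : config R) : config R := fun k => x (k.2, k.1).

Lemma lpp_transpose f u v : le_site u v ->
  lpp (transpose f) (u.2, u.1) (v.2, v.1) = lpp f u v.
Proof.
move=> /andP[h1 h2].
have -> : v = (u.1 + (v.1 - u.1), u.2 + (v.2 - u.2))%N by case: v h1 h2 => a b /= h1 h2; congr (_, _); lia.
move: (v.1 - u.1)%N (v.2 - u.2)%N => i j /=.
have [b1 b2 b3 b4] := lpp_table_last f u i j.
have T : lpp_table j i (fun j i => f (u.1 + i, u.2 + j)%N) (fun j i => lpp f u (u.1 + i, u.2 + j)%N).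
  by split => // k l kj li; rewrite maxC; exact: b4.
exact: (lpp_table_uniq (lpp_table_last (transpose f) (u.2, u.1) j i) T _ (leqnn _) (leqnn _)).
Qed.

(** Paths may be grown from either end: both ways of filling the table obey the
    same recursion. *)
Lemma lpp_reverse f f' v I J : (I <= v.1)%N -> (J <= v.2)%N ->
  (forall i j, (i <= I)%N -> (j <= J)%N -> f (v.1 - i, v.2 - j)%N = f' (i.+1, j.+1)) ->
  lpp f (v.1 - I, v.2 - J)%N v = lpp f' (1%N, 1%N) (I.+1, J.+1).
Proof.
move=> Iv Jv ff'.
exact: (lpp_table_uniq (lpp_table_first f Iv Jv) (lpp_table_last f' (1%N, 1%N) I J) ff' (leqnn _) (leqnn _)).
Qed.

(** The path that is optimal for [f0] competes for [f1] and for [f2]. *)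
Lemma lpp_le_comb (a b : R) f0 f1 f2 u v : le_site u v -> 0 <= a -> 0 <= b ->
  (forall q, f0 q <= a * f1 q + b * f2 q) ->
  lpp f0 u v <= a * lpp f1 u v + b * lpp f2 u v.
Proof.
move=> uv a0 b0 f012; have [p pP ->] := lpp_attained f0 uv.
apply: (@le_trans _ _ (a * path_weight f1 u p + b * path_weight f2 u p)).
  rewrite /path_weight !mulr_sumr -big_split /=; apply: ler_sum => q _; exact: f012.
by apply: lerD; apply: ler_wpM2l => //; exact: path_weight_le_lpp.
Qed.

Lemma lpp_le f0 f1 u v : le_site u v -> (forall q, f0 q <= f1 q) -> lpp f0 u v <= lpp f1 u v.
Proof.
move=> uv f01; have := @lpp_le_comb 1 0 f0 f1 f1 u v uv ler01 (lexx 0).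
rewrite !mul1r !mul0r addr0; apply => q; by rewrite mul1r mul0r addr0.
Qed.

Lemma lpp_ge0 f u v : le_site u v -> (forall q, 0 <= f q) -> 0 <= lpp f u v.
Proof.
move=> uv f0; have [p pP ->] := lpp_attained f uv.
by apply: sumr_ge0 => q _; exact: f0.
Qed.

Section corner.
Variable f : config R.

Lemma lpp_origin_S0 i : lpp f (0%N, 0%N) (i.+1, 0%N) = lpp f (0%N, 0%N) (i, 0%N) + f (i.+1, 0%N).
Proof. by have [_ H _ _] := lpp_table_last f (0%N, 0%N) i.+1 0%N; exact: (H i). Qed.

Lemma lpp_origin_0S j : lpp f (0%N, 0%N) (0%N, j.+1) = lpp f (0%N, 0%N) (0%N, j) + f (0%N, j.+1).
Proof. by have [_ _ H _] := lpp_table_last f (0%N, 0%N) 0%N j.+1; exact: (H j). Qed.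

Lemma lpp_origin_SS i j : lpp f (0%N, 0%N) (i.+1, j.+1) =
  Num.max (lpp f (0%N, 0%N) (i, j.+1)) (lpp f (0%N, 0%N) (i.+1, j)) + f (i.+1, j.+1).
Proof. by have [_ _ _ H] := lpp_table_last f (0%N, 0%N) i.+1 j.+1; exact: (H i j). Qed.

Lemma lpp_ver_S0 i : lpp f (0%N, 1%N) (i.+1, 1%N) = lpp f (0%N, 1%N) (i, 1%N) + f (i.+1, 1%N).
Proof. by have [_ H _ _] := lpp_table_last f (0%N, 1%N) i.+1 0%N; exact: (H i). Qed.

Lemma lpp_ver_SS i j : lpp f (0%N, 1%N) (i.+1, j.+2) =
  Num.max (lpp f (0%N, 1%N) (i, j.+2)) (lpp f (0%N, 1%N) (i.+1, j.+1)) + f (i.+1, j.+2).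
Proof. by have [_ _ _ H] := lpp_table_last f (0%N, 1%N) i.+1 j.+1; exact: (H i j). Qed.

Lemma lpp_bulk_S0 i : lpp f (1%N, 1%N) (i.+2, 1%N) = lpp f (1%N, 1%N) (i.+1, 1%N) + f (i.+2, 1%N).
Proof. by have [_ H _ _] := lpp_table_last f (1%N, 1%N) i.+1 0%N; exact: (H i). Qed.

Lemma lpp_bulk_0S j : lpp f (1%N, 1%N) (1%N, j.+2) = lpp f (1%N, 1%N) (1%N, j.+1) + f (1%N, j.+2).
Proof. by have [_ _ H _] := lpp_table_last f (1%N, 1%N) 0%N j.+1; exact: (H j). Qed.

Lemma lpp_bulk_SS i j : lpp f (1%N, 1%N) (i.+2, j.+2) =
  Num.max (lpp f (1%N, 1%N) (i.+1, j.+2)) (lpp f (1%N, 1%N) (i.+2, j.+1)) + f (i.+2, j.+2).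
Proof. by have [_ _ _ H] := lpp_table_last f (1%N, 1%N) i.+1 j.+1; exact: (H i j). Qed.

Lemma lpp_origin_max i j : f (0%N, 0%N) = 0 ->
  lpp f (0%N, 0%N) (i.+1, j.+1) =
  Num.max (lpp f (1%N, 0%N) (i.+1, j.+1)) (lpp f (0%N, 1%N) (i.+1, j.+1)).
Proof.
move=> f0; apply/eqP; rewrite eq_le; apply/andP; split; last first.
  by rewrite ge_max -[X in X <= _]add0r -[X in _ && (X <= _)]add0r -f0 !lpp_first_le.
have [//|//|w [_ + ->]] := @lpp_first_ex f (0%N, 0%N) (i.+1, j.+1).
rewrite f0 add0r le_max; case: w => a b /orP[] /eqP[-> ->]; first by rewrite lexx.
by rewrite lexx orbT.
Qed.

(** The outgoing increments of a unit square are monotone in the incoming ones: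
    more horizontal and less vertical on entry gives the same on exit. The
    comparison is plain on the first row and column, hence holds everywhere. *)
Lemma ver_bulk_increments i j :
  lpp f (0%N, 1%N) (i.+2, j.+1) - lpp f (0%N, 1%N) (i.+1, j.+1) <=
    lpp f (1%N, 1%N) (i.+2, j.+1) - lpp f (1%N, 1%N) (i.+1, j.+1) /\
  lpp f (1%N, 1%N) (i.+1, j.+2) - lpp f (1%N, 1%N) (i.+1, j.+1) <=
    lpp f (0%N, 1%N) (i.+1, j.+2) - lpp f (0%N, 1%N) (i.+1, j.+1).
Proof.
elim: j i => [|j IHj].
  have H i : lpp f (0%N, 1%N) (i.+2, 1%N) - lpp f (0%N, 1%N) (i.+1, 1%N) <=
      lpp f (1%N, 1%N) (i.+2, 1%N) - lpp f (1%N, 1%N) (i.+1, 1%N).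
    by rewrite lpp_ver_S0 lpp_bulk_S0; lra.
  elim=> [|i [_ V]]; split => //.
    rewrite lpp_bulk_0S lpp_ver_SS.
    have : lpp f (0%N, 1%N) (1%N, 1%N) <= Num.max (lpp f (0%N, 1%N) (0%N, 2%N)) (lpp f (0%N, 1%N) (1%N, 1%N)).
      by rewrite le_max lexx orbT.
    lra.
  have := H i; rewrite lpp_bulk_SS lpp_ver_SS.
  move: V; set A := lpp f (0%N, 1%N) _; set B := lpp f (0%N, 1%N) (i.+2, _).
  set C := lpp f (0%N, 1%N) _; set A' := lpp f (1%N, 1%N) _; set B' := lpp f (1%N, 1%N) (i.+2, _).
  set C' := lpp f (1%N, 1%N) _.
  by case: (leP A B); case: (leP A' B'); lra.
have H i : lpp f (0%N, 1%N) (i.+2, j.+2) - lpp f (0%N, 1%N) (i.+1, j.+2) <=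
    lpp f (1%N, 1%N) (i.+2, j.+2) - lpp f (1%N, 1%N) (i.+1, j.+2).
  have [] := IHj i.
  rewrite [lpp f (1%N, 1%N) (i.+2, j.+2)]lpp_bulk_SS [lpp f (0%N, 1%N) (i.+2, j.+2)]lpp_ver_SS.
  move: (lpp f (0%N, 1%N) (i.+2, j.+1)) (lpp f (0%N, 1%N) (i.+1, j.+1)) (lpp f (0%N, 1%N) (i.+1, j.+2)) => A B C.
  move: (lpp f (1%N, 1%N) (i.+2, j.+1)) (lpp f (1%N, 1%N) (i.+1, j.+1)) (lpp f (1%N, 1%N) (i.+1, j.+2)) => A' B' C'.
  by case: (leP C A); case: (leP C' A'); lra.
elim=> [|i [_ V]]; split => //.
  rewrite lpp_bulk_0S lpp_ver_SS.
  have : lpp f (0%N, 1%N) (1%N, j.+2) <= Num.max (lpp f (0%N, 1%N) (0%N, j.+3)) (lpp f (0%N, 1%N) (1%N, j.+2)).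
    by rewrite le_max lexx orbT.
  lra.
have := H i; move: V; rewrite [lpp f (1%N, 1%N) (i.+2, j.+3)]lpp_bulk_SS [lpp f (0%N, 1%N) (i.+2, j.+3)]lpp_ver_SS.
move: (lpp f (0%N, 1%N) (i.+2, j.+2)) (lpp f (0%N, 1%N) (i.+1, j.+2)) (lpp f (0%N, 1%N) (i.+1, j.+3)) => A B C.
move: (lpp f (1%N, 1%N) (i.+2, j.+2)) (lpp f (1%N, 1%N) (i.+1, j.+2)) (lpp f (1%N, 1%N) (i.+1, j.+3)) => A' B' C'.
by case: (leP C A); case: (leP C' A'); lra.
Qed.

Lemma ver_bulk_row k i j : lpp f (0%N, 1%N) ((k + i).+1, j.+1) - lpp f (0%N, 1%N) (i.+1, j.+1) <=
    lpp f (1%N, 1%N) ((k + i).+1, j.+1) - lpp f (1%N, 1%N) (i.+1, j.+1).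
Proof.
elim: k => [|k IH]; first by rewrite !subrr.
have [+ _] := ver_bulk_increments (k + i) j; rewrite addSn; lra.
Qed.

(** If the left boundary carries the optimal path to [(m.+1, n.+1)], then moving
    back along row [n.+1] costs at least as much in the bulk as in the full
    model. Entering row [n.+2] early is thus less profitable in the bulk. *)
Lemma bulk_top_increment m n : f (0%N, 0%N) = 0 ->
  lpp f (1%N, 0%N) (m.+1, n.+1) <= lpp f (0%N, 1%N) (m.+1, n.+1) ->
  lpp f (1%N, 1%N) (m.+1, n.+2) - lpp f (1%N, 1%N) (m.+1, n.+1) <=
  lpp f (0%N, 0%N) (m.+1, n.+2) - lpp f (0%N, 0%N) (m.+1, n.+1).
Proof.
move=> f0 hv.
have G0 : lpp f (0%N, 0%N) (m.+1, n.+1) = lpp f (0%N, 1%N) (m.+1, n.+1).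
  by rewrite lpp_origin_max//; apply/max_idPr.
have ver_le i : lpp f (0%N, 1%N) (i.+1, n.+1) <= lpp f (0%N, 0%N) (i.+1, n.+1).
  by rewrite lpp_origin_max// le_max lexx orbT.
have row i : (i <= m)%N ->
    lpp f (1%N, 1%N) (i.+1, n.+1) - lpp f (1%N, 1%N) (m.+1, n.+1) <=
    lpp f (0%N, 0%N) (i.+1, n.+1) - lpp f (0%N, 0%N) (m.+1, n.+1).
  move=> im; have := ver_bulk_row (m - i) i n; rewrite subnK// G0.
  by have := ver_le i; lra.
suff H i : (i <= m)%N ->
    lpp f (1%N, 1%N) (i.+1, n.+2) - lpp f (1%N, 1%N) (m.+1, n.+1) <=
    lpp f (0%N, 0%N) (i.+1, n.+2) - lpp f (0%N, 0%N) (m.+1, n.+1) by exact: H.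
elim: i => [|i IH] im.
  have := row 0%N im; rewrite lpp_bulk_0S [lpp f (0%N, 0%N) (1%N, n.+2)]lpp_origin_SS.
  have : lpp f (0%N, 0%N) (1%N, n.+1) <= Num.max (lpp f (0%N, 0%N) (0%N, n.+2)) (lpp f (0%N, 0%N) (1%N, n.+1)).
    by rewrite le_max lexx orbT.
  lra.
have := row i.+1 im; have := IH (ltnW im); rewrite [lpp f (1%N, 1%N) (i.+2, n.+2)]lpp_bulk_SS [lpp f (0%N, 0%N) (i.+2, n.+2)]lpp_origin_SS.
move: (lpp f (1%N, 1%N) (m.+1, n.+1)) (lpp f (0%N, 0%N) (m.+1, n.+1)) => M M'.
move: (lpp f (0%N, 0%N) (i.+2, n.+1)) (lpp f (0%N, 0%N) (i.+1, n.+2)) => B C.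
move: (lpp f (1%N, 1%N) (i.+2, n.+1)) (lpp f (1%N, 1%N) (i.+1, n.+2)) => B' C'.
by case: (leP C B); case: (leP C' B'); lra.
Qed.

End corner.

End lpp_recursion.

Lemma measurable_lpp (R : realType) (u v : site) : le_site u v ->
  measurable_fun setT (fun x : config R => lpp x u v).
Proof.
move=> /andP[h1 h2].
have -> : v = (u.1 + (v.1 - u.1), u.2 + (v.2 - u.2))%N by case: v h1 h2 => a b /= h1 h2; congr (_, _); lia.
move: (v.1 - u.1)%N (v.2 - u.2)%N => {v h1 h2} i j.
elim: i j => [|i IH]; elim=> [|j IHj].
- rewrite [X in measurable_fun _ X](_ : _ = fun x => x (u.1 + 0, u.2 + 0)%N); first exact: measurable_coord.
  by apply/funext => x; have [-> _ _ _] := lpp_table_last x u 0 0.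
- rewrite [X in measurable_fun _ X](_ : _ = fun x => lpp x u (u.1 + 0, u.2 + j)%N + x (u.1 + 0, u.2 + j.+1)%N).
    by apply: measurable_funD => //; exact: measurable_coord.
  by apply/funext => x; have [_ _ H _] := lpp_table_last x u 0 j.+1; exact: (H j (ltnSn j)).
- rewrite [X in measurable_fun _ X](_ : _ = fun x => lpp x u (u.1 + i, u.2 + 0)%N + x (u.1 + i.+1, u.2 + 0)%N).
    by apply: measurable_funD; [exact: IH|exact: measurable_coord].
  by apply/funext => x; have [_ H _ _] := lpp_table_last x u i.+1 0; exact: (H i (ltnSn i)).
rewrite [X in measurable_fun _ X](_ : _ = fun x =>
    Num.max (lpp x u (u.1 + i, u.2 + j.+1)%N) (lpp x u (u.1 + i.+1, u.2 + j)%N) + x (u.1 + i.+1, u.2 + j.+1)%N).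
  by apply: measurable_funD; [apply: measurable_maxr => //; exact: IH|exact: measurable_coord].
by apply/funext => x; have [_ _ _ H] := lpp_table_last x u i.+1 j.+1; exact: (H i j (ltnSn i) (ltnSn j)).
Qed.

(** * Burke's theorem for the stationary model *)

Section burke_program.
Variables (R : realType) (m : nat).
Implicit Types x y : config R.

Local Notation G x i j := (lpp x (0%N, 0%N) (i, j)).

(** Sweeping the rectangle row by row, [burke_map] overwrites in place: once
    [i] sites of row [j.+1] have been treated, the bottom cells hold the
    horizontal increments along the current staircase and the left cells its
    vertical increments. *)
Definition staircase_increments (i j : nat) x y : Prop :=
  [/\ forall k, (k < i)%N -> y (k.+1, 0%N) = G x k.+1 j.+1 - G x k j.+1,
      forall k, (i <= k < m)%N -> y (k.+1, 0%N) = G x k.+1 j - G x k j,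
      forall l, (l < j)%N -> y (0%N, l.+1) = G x m l.+1 - G x m l,
      y (0%N, j.+1) = G x i j.+1 - G x i j &
      (forall l, (j < l)%N -> y (0%N, l.+1) = x (0%N, l.+1)) /\
      (forall k l, (j < l)%N || (l == j) && (i <= k)%N -> y (k.+1, l.+1) = x (k.+1, l.+1))].

Lemma staircase_start x : staircase_increments 0 0 x x.
Proof.
split=> //.
- by move=> k _; rewrite lpp_origin_S0; lra.
- by rewrite lpp_origin_0S; lra.
Qed.

Lemma staircase_next_row j x y : staircase_increments m j x y ->
  staircase_increments 0 j.+1 x y.
Proof.
move=> [h1 h2 h3 h4 [h5 h6]]; split=> //.
- by move=> l; rewrite ltnS leq_eqVlt => /orP[/eqP ->//|]; exact: h3.
- by rewrite h5// lpp_origin_0S; lra.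
- split; first by move=> l jl; apply: h5; exact: ltnW.
  move=> k l /orP[jl|/andP[/eqP -> _]]; apply: h6; first by rewrite (ltnW jl).
  by rewrite ltnSn.
Qed.

Lemma staircase_step i j x y : (i < m)%N -> staircase_increments i j x y ->
  staircase_increments i.+1 j x (burke_map (i.+1, 0%N) (0%N, j.+1) (i.+1, j.+1) y).
Proof.
move=> im [h1 h2 h3 h4 [h5 h6]].
have I : y (i.+1, 0%N) = G x i.+1 j - G x i j by rewrite h2// leqnn.
have B : y (i.+1, j.+1) = x (i.+1, j.+1) by rewrite h6// eqxx leqnn orbT.
have S := lpp_origin_SS x i j.
rewrite /burke_map; split.
- move=> k; rewrite ltnS leq_eqVlt => /orP[/eqP ->|ki].
    rewrite upd_other ?xpair_eqE ?andbF// upd_other// upd_at I h4 B S.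
    by case: (leP (G x i j.+1) (G x i.+1 j)) => ?; case: leP; lra.
  by rewrite !upd_other ?h1//; apply/eqP => -[]; lia.
- move=> k ik; rewrite !upd_other; first (by apply: h2; lia); by apply/eqP => -[]; lia.
- by move=> l lj; rewrite !upd_other ?h3//; apply/eqP => -[]; lia.
- rewrite upd_other// upd_at I h4 B S.
  by case: (leP (G x i j.+1) (G x i.+1 j)) => ?; case: leP; lra.
- split=> [l jl|k l jlk]; first by rewrite !upd_other ?h5//; apply/eqP => -[]; lia.
  rewrite !upd_other; first (by apply: h6; lia); by apply/eqP => -[]; lia.
Qed.

End burke_program.

Section burke.
Context d (T : measurableType d) (R : realType) (P : probability T R).
Implicit Types (S : {pred site}) (r : site -> R) (X Y : T -> config R).

Lemma indep_exp_sub S S' r X : indep_exp P S r X -> {subset S' <= S} ->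
  indep_exp P S' r X.
Proof. by move=> [mX r0 ind] SS'; split=> // k /SS' kS; [exact: r0|exact: ind]. Qed.

Definition boundary_box (m n : nat) : {pred site} :=
  [pred k : site | [&& k != (0%N, 0%N), (k.1 <= m)%N & (k.2 <= n)%N]].

Definition stationary_rates m n r : Prop :=
  forall i j, (i < m)%N -> (j < n)%N ->
    r (i.+1, j.+1) = r (i.+1, 0%N) + r (0%N, j.+1).

(** Burke's theorem. Each step of the sweep preserves independence, and at the
    end the left cells contain the increments along column [m]. *)
Lemma vertical_increments_indep m n r X :
  indep_exp P (boundary_box m n) r X -> stationary_rates m n r ->
  exists Y, indep_exp P [pred k : site | (k.1 == 0%N) && (0 < k.2 <= n)%N] r Y /\
    forall t j, (j < n)%N -> Y t (0%N, j.+1) =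
      lpp (X t) (0%N, 0%N) (m, j.+1) - lpp (X t) (0%N, 0%N) (m, j).
Proof.
move=> indX st.
(* the cells that still carry an increment or an unused weight after [i] sites of
   row [j.+1] *)
pose S i j : {pred site} := [pred k : site | (k \in boundary_box m n) &&
  [|| k.1 == 0%N, k.2 == 0%N, (j.+1 < k.2)%N | (k.2 == j.+1) && (i < k.1)%N]].
have step i j : (i < m)%N -> (j < n)%N ->
    (exists Y, indep_exp P (S i j) r Y /\ forall t, staircase_increments m i j (X t) (Y t)) ->
    exists Y, indep_exp P (S i.+1 j) r Y /\ forall t, staircase_increments m i.+1 j (X t) (Y t).
  move=> im jn [Y [indY stY]].
  exists (fun t => burke_map (i.+1, 0%N) (0%N, j.+1) (i.+1, j.+1) (Y t)); split; last first.
    by move=> t; exact: staircase_step.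
  apply: (@indep_exp_sub [pred k in S i j | k != (i.+1, j.+1)]).
    apply: indep_exp_burke => //.
    - by rewrite !inE/= im.
    - by rewrite !inE/= jn.
    - by rewrite !inE/= im jn ltnn !eqxx ltnSn.
    - by rewrite xpair_eqE andbF.
    - exact: st.
  move=> [a b]; rewrite !inE/= => /andP[/and3P[-> -> ->] ab] /=.
  apply/andP; split; first by move: ab; lia.
  by apply/eqP => -[]; move: ab; lia.
have rows j : (j < n)%N ->
    (exists Y, indep_exp P (S 0%N j) r Y /\ forall t, staircase_increments m 0 j (X t) (Y t)) ->
    forall i, (i <= m)%N ->
    exists Y, indep_exp P (S i j) r Y /\ forall t, staircase_increments m i j (X t) (Y t).
  by move=> jn H; elim=> [//|i IH] im; apply: step => //; apply: IH; exact: ltnW.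
have H j : (j <= n)%N ->
    exists Y, indep_exp P (S 0%N j) r Y /\ forall t, staircase_increments m 0 j (X t) (Y t).
  elim: j => [_|j IH jn].
    exists X; split; last by move=> t; exact: staircase_start.
    by apply: indep_exp_sub indX _ => k; rewrite inE => /andP[].
  have [Y [indY stY]] := rows j jn (IH (ltnW jn)) m (leqnn m).
  exists Y; split; last by move=> t; apply: staircase_next_row; exact: stY.
  apply: indep_exp_sub indY _ => -[a b]; rewrite !inE/= => /andP[/and3P[-> -> ->] ab] /=.
  by move: ab; lia.
have [Y [indY stY]] := H n (leqnn n).
exists Y; split; last by move=> t j jn; have [_ _ + _ _] := stY t; apply.
apply: indep_exp_sub indY _ => -[a b]; rewrite !inE/= => /andP[/eqP -> /andP[b0 bn]] /=.
by rewrite bn /= !andbT; apply/eqP => -[] b00; rewrite b00 in b0.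
Qed.

End burke.

(** * Exponential moments *)

Section moments.
Context d (T : measurableType d) (R : realType) (P : probability T R).
Implicit Types (S : {pred site}) (r : site -> R) (X Y U : T -> config R).

Lemma expint_expR (rho a : R) (c : \bar R) : 0 < rho -> a < rho -> (0 <= c)%E ->
  expint rho (fun u => (expR (a * u))%:E * c)%E = ((rho / (rho - a))%:E * c)%E.
Proof.
move=> rho0 arho c0; have b0 : 0 < rho - a by rewrite subr_gt0.
have := @expint_tilt R rho (rho - a) (cst c) rho0 b0 (measurable_cst _) (fun=> c0).
rewrite (expint_cst b0 c0) => <-; apply: eq_expint => u _.
by congr (_%:E * _)%E; congr expR; congr (_ * _); ring.
Qed.

Lemma integral_probability_cst (c : R) : (\int[P]_t c%:E = c%:E)%E.
Proof.
rewrite integral_cst// [X in (_ * X)%E](_ : _ = 1%E) ?mule1//.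
exact: (@probability_setT _ _ _ P).
Qed.

Lemma probability_le_integral (A : set T) (h : T -> R) : measurable A ->
  measurable_fun setT h -> (forall t, 0 <= h t) -> (forall t, A t -> 1 <= h t) ->
  (P A <= \int[P]_t (h t)%:E)%E.
Proof.
move=> mA mh h0 h1.
have -> : P A = (\int[P]_t (\1_A t)%:E)%E by rewrite integral_indic// setIT.
apply: ge0_le_integral => //.
- by apply/measurable_EFinP; exact: measurable_indic.
- exact/measurable_EFinP.
- move=> t _; rewrite lee_fin indicE; case: (boolP (t \in A)) => // tA.
  by apply: h1; rewrite inE in tA.
Qed.

Lemma measurable_config_fun (F : config R -> R) X : measurable_fun setT X ->
  measurable_fun setT F -> measurable_fun setT (fun t => F (X t)).
Proof. by move=> mX mF; exact: (measurableT_comp mF mX). Qed.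

Lemma measurable_set_le (f g : T -> R) : measurable_fun setT f -> measurable_fun setT g ->
  measurable [set t | f t <= g t].
Proof.
move=> mf mg; have := measurable_fun_ler mf mg; move=> /(_ measurableT [set true]).
by rewrite setTI; apply.
Qed.

Lemma indep_exp_mgf_prod r Y (rho a : R) n :
  indep_exp P [pred k : site | (k.1 == 0%N) && (0 < k.2 <= n)%N] r Y ->
  (forall j, (j < n)%N -> r (0%N, j.+1) = rho) -> 0 < rho -> a < rho ->
  (\int[P]_t (expR (a * \sum_(0 <= j < n) Y t (0%N, j.+1)))%:E =
    ((rho / (rho - a)) ^+ n)%:E)%E.
Proof.
move=> indY rE rho0 arho; have [mY _ ind] := indY.
suff H : forall k, (k <= n)%N -> (\int[P]_t (expR (a * \sum_(0 <= j < k) Y t (0%N, j.+1)))%:E =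
    ((rho / (rho - a)) ^+ k)%:E)%E by exact: H.
have mS k : measurable_fun setT (fun x : config R => expR (a * \sum_(0 <= j < k) x (0%N, j.+1))).
  apply: measurableT_comp => //; apply: measurable_funM => //.
  by apply: measurable_sum => j; exact: measurable_coord.
elim=> [_|k IH kn].
  under eq_integral do rewrite big_geq// mulr0 expR0.
  by rewrite integral_probability_cst.
pose F k (x : config R) : \bar R := (expR (a * \sum_(0 <= j < k) x (0%N, j.+1)))%:E.
have mF l : measurable_fun setT (F l) by apply/measurable_EFinP; exact: mS.
have F0 l x : (0 <= F l x)%E by rewrite lee_fin expR_ge0.
have kS : (0%N, k.+1) \in [pred k : site | (k.1 == 0%N) && (0 < k.2 <= n)%N].
  by rewrite inE.
transitivity (\int[P]_t F k.+1 (Y t))%E => //.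
rewrite (ind _ kS (F k.+1))//.
transitivity (\int[P]_t ((rho / (rho - a))%:E * F k (Y t)))%E.
  apply: eq_integral => t _; rewrite rE// -expint_expR//.
  apply: eq_expint => u _; rewrite /F -EFinM; congr EFin.
  rewrite big_nat_recr//= upd_at mulrDr expRD mulrC; congr (_ * expR (_ * _)).
  apply: eq_big_nat => j /andP[_ jk]; rewrite upd_other//.
  by apply/eqP => -[]; lia.
rewrite ge0_integralZl//; last 2 first.
- exact: (measurableT_comp (mF k) mY).
- by rewrite lee_fin divr_ge0// ltW// subr_gt0.
have -> : (\int[P]_t F k (Y t))%E = _ := IH (ltnW kn).
by rewrite -EFinM -exprS.
Qed.

Definition rate (w z : R) : site -> R :=
  fun k => if k.2 == 0%N then w else if k.1 == 0%N then 1 - z else 1.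

(** The weights with boundary rates [w] and [1 - z] obtained by scaling a
    family of rate-one weights, so that different parameters are coupled. *)
Definition weights (w z : R) (x : config R) : config R :=
  rescale nonorigin (rate w z) idfun x.

Lemma rate_gt0 w z k : 0 < w -> z < 1 -> 0 < rate w z k.
Proof. by move=> w0 z1; rewrite /rate; case: ifP => // _; case: ifP => // _; rewrite subr_gt0. Qed.

Lemma weights_indep w z U : indep_exp P nonorigin (fun=> 1) U -> 0 < w -> z < 1 ->
  indep_exp P nonorigin (rate w z) (fun t => weights w z (U t)).
Proof.
move=> indU w0 z1; apply: indep_exp_reindex indU _ _ _ => //.
by move=> k _; exact: rate_gt0.
Qed.

Lemma sum_bottom_row (x : config R) m : x (0%N, 0%N) = 0 ->
  lpp x (0%N, 0%N) (m, 0%N) = \sum_(0 <= k < m) x (k.+1, 0%N).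
Proof.
move=> x0; elim: m => [|m IH]; first by rewrite lpp_refl big_geq.
by rewrite lpp_origin_S0 IH big_nat_recr.
Qed.

(** The bottom weights are tilted one at a time, from rate [w] to rate [z]. Since
    their sum is the passage time to [(m, 0)], the remaining exponent is an
    increment along column [m] in a stationary model. *)
Lemma lpp_mgf w z m n U : indep_exp P nonorigin (fun=> 1) U ->
  0 < w < 1 -> 0 < z < 1 ->
  (\int[P]_t (expR ((w - z) * lpp (weights w z (U t)) (0%N, 0%N) (m, n)))%:E =
   ((w / z) ^+ m * ((1 - z) / (1 - w)) ^+ n)%:E)%E.
Proof.
move=> indU /andP[w0 w1] /andP[z0 z1].
(* the bottom weights up to column [i] have been tilted *)
pose r i : site -> R := fun k => if (k.2 == 0%N) && (k.1 <= i)%N then z else rate w z k.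
pose X i t := rescale nonorigin (r i) idfun (U t).
have r0 i k : 0 < r i k by rewrite /r; case: ifP => // _; exact: rate_gt0.
have indX i : indep_exp P nonorigin (r i) (X i).
  by apply: indep_exp_reindex indU _ _ _.
pose F (x : config R) : \bar R :=
  (expR ((w - z) * (lpp x (0%N, 0%N) (m, n) - lpp x (0%N, 0%N) (m, 0%N))))%:E.
pose H i (x : config R) : \bar R :=
  ((expR ((w - z) * \sum_(i <= k < m) x (k.+1, 0%N)))%:E * F x)%E.
have mF : measurable_fun setT F.
  apply/measurable_EFinP; apply: measurableT_comp => //; apply: measurable_funM => //.
  by apply: measurable_funB; exact: measurable_lpp.
have mH i : measurable_fun setT (H i).
  apply: emeasurable_funM => //; apply/measurable_EFinP.
  apply: measurableT_comp => //; apply: measurable_funM => //.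
  by apply: measurable_sum => j; exact: measurable_coord.
have H0 i x : (0 <= H i x)%E by rewrite mule_ge0// lee_fin expR_ge0.
have step i : (i < m)%N ->
    (\int[P]_t H i (X i t) = (w / z)%:E * \int[P]_t H i.+1 (X i.+1 t))%E.
  move=> im; have kS : (i.+1, 0%N) \in nonorigin by [].
  have ri : r i (i.+1, 0%N) = w by rewrite /r /rate /= ltnn.
  have ri1 : r i.+1 (i.+1, 0%N) = z by rewrite /r /= leqnn.
  have := indep_exp_tilt (indX i) (indX i.+1) kS kS _ (mH i.+1) (H0 i.+1).
  rewrite ri ri1 => <-.
    by apply: eq_integral => t _; rewrite {1}/H big_ltn// mulrDr expRD EFinM -muleA.
  move=> t l lk; rewrite /X /rescale; case: ifP => // _; congr (_ / _).
  rewrite /r; case: l lk => a [|b] //= lk.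
  suff -> : (a <= i.+1)%N = (a <= i)%N by [].
  by move: lk; rewrite xpair_eqE andbT; lia.
have steps i : (i <= m)%N -> (\int[P]_t H 0%N (X 0%N t) =
    ((w / z) ^+ i)%:E * \int[P]_t H i (X i t))%E.
  elim: i => [_|i IH im]; first by rewrite expr0 mul1e.
  rewrite (IH (ltnW im)) (step _ im) muleA -EFinM -exprSr.
  reflexivity.
transitivity (\int[P]_t H 0%N (X 0%N t))%E.
  apply: eq_integral => t _; rewrite /H /F -EFinM -expRD -mulrDr.
  have -> : X 0%N t = weights w z (U t).
    apply/funext => k; rewrite /X /weights /rescale; case: ifP => // kS.
    congr (_ / _); rewrite /r; case: ifP => // /andP[k2 k1].
    by move: kS; case: k k1 k2 => [[|a] [|b]].
  by rewrite sum_bottom_row//; congr (expR (_ * _))%:E; ring.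
rewrite (steps m)// EFinM; congr (_ * _)%E.
have st : stationary_rates m n (r m).
  by move=> i j im jn; rewrite /r /rate /= im/=; lra.
have indXm : indep_exp P (boundary_box m n) (r m) (X m).
  by apply: indep_exp_sub (indX m) _ => k; rewrite inE => /and3P[].
have [Y [indY YE]] := vertical_increments_indep indXm st.
rewrite -(_ : (1 - z) - (w - z) = 1 - w); last by ring.
rewrite -(indep_exp_mgf_prod indY)//; last 2 first.
- by rewrite subr_gt0.
- by rewrite ltrD2r.
apply: eq_integral => t _; rewrite /H /F big_geq// mulr0 expR0 mul1e.
congr (expR (_ * _))%:E; elim: n {F mF H mH H0 step steps st indXm indY} YE => [|n IH] YE.
  by rewrite big_geq// subrr.
rewrite big_nat_recr//= YE// -IH; first by ring.
by move=> s j jn; apply: YE; exact: ltnW.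
Qed.

(** Markov's inequality. The event is an upper or a lower tail according to the
    sign of [w - z]. *)
Lemma lpp_chernoff w z y m n U : indep_exp P nonorigin (fun=> 1) U ->
  0 < w < 1 -> 0 < z < 1 ->
  (P [set t | (0 <= (w - z) * (lpp (weights w z (U t)) (0%N, 0%N) (m, n) - y))%R] <=
   (expR (ln (w / z) *+ m + ln ((1 - z) / (1 - w)) *+ n - (w - z) * y))%:E)%E.
Proof.
move=> indU w01 z01.
have /andP[w0 w1] := w01; have /andP[z0 z1] := z01.
pose h t := expR ((w - z) * (lpp (weights w z (U t)) (0%N, 0%N) (m, n) - y)).
have mG : measurable_fun setT (fun t => lpp (weights w z (U t)) (0%N, 0%N) (m, n)).
  have [mX _ _] := weights_indep indU w0 z1.
  by apply: (measurable_config_fun (F := fun x => lpp x (0%N, 0%N) (m, n)) mX); exact: measurable_lpp.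
have mE : measurable_fun setT (fun t => (w - z) * (lpp (weights w z (U t)) (0%N, 0%N) (m, n) - y)).
  by apply: measurable_funM => //; exact: measurable_funB.
apply: (@le_trans _ _ (\int[P]_t (h t)%:E)%E).
  apply: probability_le_integral.
  - have m0 : measurable_fun setT (fun _ : T => 0 : R) by [].
    exact: (measurable_set_le m0 mE).
  - exact: measurableT_comp.
  - by move=> t; exact: expR_ge0.
  - by move=> t /= H; rewrite -expR0 ler_expR.
have -> : (\int[P]_t (h t)%:E = (expR (- ((w - z) * y)))%:E *
    \int[P]_t (expR ((w - z) * lpp (weights w z (U t)) (0%N, 0%N) (m, n)))%:E)%E.
  rewrite -ge0_integralZl//.
  - apply: eq_integral => t _; rewrite /h mulrBr expRD EFinM muleC.
    by [].
  - apply/measurable_EFinP; apply: measurableT_comp => //.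
    exact: measurable_funM.
rewrite lpp_mgf// -EFinM lee_fin expRD mulrC expRD -(mulr_natl _ m) -(mulr_natl _ n) !expRM_natl !lnK ?posrE ?divr_gt0 ?subr_gt0//.
Qed.

(** Markov's inequality with half of the rate as exponent, for which the moment
    of the increment is [2]. *)
Lemma top_vertical_increment_tail m n r X x : indep_exp P (boundary_box m n.+1) r X ->
  stationary_rates m n.+1 r ->
  (P [set t | (x <= lpp (X t) (0%N, 0%N) (m, n.+1) - lpp (X t) (0%N, 0%N) (m, n))%R] <=
   (2 * expR (- (r (0%N, n.+1) / 2 * x)))%:E)%E.
Proof.
move=> indX st; have [mX r0 _] := indX.
have [Y [indY YE]] := vertical_increments_indep indX st.
have [mY rY0 ind] := indY.
have kS : (0%N, n.+1) \in [pred k : site | (k.1 == 0%N) && (0 < k.2 <= n.+1)%N].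
  by rewrite inE /= leqnn.
have rho0 := rY0 _ kS; set rho := r (0%N, n.+1) in rho0 *.
pose h t := expR (rho / 2 * Y t (0%N, n.+1)) * expR (- (rho / 2 * x)).
have mh0 : measurable_fun setT (fun y : config R => expR (rho / 2 * y (0%N, n.+1)) * expR (- (rho / 2 * x))).
  apply: measurable_funM => //; apply: measurableT_comp => //; apply: measurable_funM => //.
  exact: measurable_coord.
have mh : measurable_fun setT h by exact: (measurable_config_fun mY mh0).
apply: (@le_trans _ _ (\int[P]_t (h t)%:E)%E).
  apply: probability_le_integral => //.
  - apply: measurable_set_le => //.
    apply: measurable_funB.
      by apply: (measurable_config_fun (F := fun x => lpp x (0%N, 0%N) (m, n.+1)) mX); exact: measurable_lpp.
    by apply: (measurable_config_fun (F := fun x => lpp x (0%N, 0%N) (m, n)) mX); exact: measurable_lpp.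
  - by move=> t; rewrite mulr_ge0// expR_ge0.
  - move=> t /= H; rewrite /h -expRD -expR0 ler_expR YE// -mulrBr mulr_ge0//.
      by rewrite divr_ge0// ltW.
    by rewrite subr_ge0.
pose g (y : config R) : \bar R :=
  (expR (rho / 2 * y (0%N, n.+1)) * expR (- (rho / 2 * x)))%:E.
have mg : measurable_fun setT g by exact/measurable_EFinP.
have g0 y : (0 <= g y)%E by rewrite lee_fin mulr_ge0// expR_ge0.
have -> : (\int[P]_t (h t)%:E = \int[P]_t (2 * expR (- (rho / 2 * x)))%:E)%E.
  apply: etrans (ind _ kS g mg g0) _; apply: eq_integral => t _.
  transitivity (expint rho (fun u : R => (expR (rho / 2 * u))%:E * (expR (- (rho / 2 * x)))%:E)%E).
    by apply: eq_expint => u _; rewrite /g upd_at EFinM.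
  rewrite expint_expR//; last by rewrite ltr_pdivrMr// ltr_pMr// ltr1n.
  rewrite -EFinM; congr (_ * _)%:E; field.
  by rewrite gt_eqF//; lra.
by rewrite integral_probability_cst.
Qed.

End moments.

(** * The mean function of the stationary model *)

Section logarithm.
Import numFieldNormedType.Exports.
Variable R : realType.
Implicit Types t w z : R.

Lemma ln_mean_value (f df : R -> R) t : 1 <= t ->
  (forall x : R, 0 < x -> is_derive x 1 f (df x)) -> (forall x : R, 1 <= x -> 0 <= df x) ->
  f 1 = 0 -> 0 <= f t.
Proof.
rewrite le_eqVlt => /orP[/eqP <- _ _ ->//|t1] fd df0 f1.
have [||c] := @MVT R f df 1 t t1.
- move=> x; by rewrite in_itv/= => /andP[x1 _]; apply: fd; lra.
- apply: derivable_within_continuous => x; rewrite in_itv/= => /andP[x1 _].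
  have x0 : 0 < x by lra.
  by have := fd x x0; move/@ex_derive.
rewrite in_itv/= => /andP[c1 _]; rewrite f1 subr0 => ->.
by rewrite mulr_ge0 ?df0 ?subr_ge0// ltW.
Qed.

(** The derivative of the difference of the two sides is a square. *)
Lemma ln_le_trapezoid t : 1 <= t -> ln t <= 2^-1 * (t - t^-1).
Proof.
move=> t1; rewrite -subr_ge0.
apply: (@ln_mean_value (fun x => 2^-1 * (x - x^-1) - ln x)
  (fun x => (1 - x^-1) ^+ 2 / 2) t t1); last 2 first.
- by move=> x _; rewrite divr_ge0// sqr_ge0.
- by rewrite ln1 invr1; lra.
move=> x x0; have xn0 : x != 0 by rewrite gt_eqF.
have dV := @is_deriveV R id x 1 1 xn0 (is_derive_id x 1).
have D := is_deriveB (is_deriveZ 2^-1 (is_deriveB (is_derive_id x 1) dV)) (is_derive1_ln x0).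
apply: (is_derive_eq (df := _) D).
by rewrite /GRing.scale /=; field.
Qed.

Lemma ln_ge_midpoint t : 1 <= t -> 2 * (t - 1) / (t + 1) <= ln t.
Proof.
move=> t1; rewrite -subr_ge0.
have -> : ln t - 2 * (t - 1) / (t + 1) = ln t - (2 - 4 * (t + 1)^-1).
  by congr (_ - _); field; rewrite gt_eqF//; lra.
apply: (@ln_mean_value (fun x => ln x - (2 - 4 * (x + 1)^-1))
  (fun x => (x - 1) ^+ 2 / (x * (x + 1) ^+ 2)) t t1); last 2 first.
- by move=> x x1; rewrite divr_ge0// ?sqr_ge0// mulr_ge0 ?sqr_ge0//; lra.
- by rewrite ln1; field.
move=> x x0; have xn0 : x != 0 by rewrite gt_eqF.
have x1n0 : x + 1 != 0 by rewrite gt_eqF//; lra.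
have dA := is_deriveD (is_derive_id x 1) (is_derive_cst (1 : R) x 1).
have dV := @is_deriveV R (id + cst 1) x _ 1 x1n0 dA.
have D := is_deriveB (is_derive1_ln x0)
  (is_deriveB (is_derive_cst (2 : R) x 1) (is_deriveZ 4 dV)).
apply: (is_derive_eq (df := _) D).
have -> : (id + cst 1 : R -> R) x = x + 1 by [].
by rewrite /GRing.scale /=; field; rewrite xn0 x1n0.
Qed.

(** Together with [ln_ratio_ge], trapezoidal and midpoint bounds for the integral
    of the convex function [u^-1] between [z] and [w]. *)
Lemma ln_ratio_le w z : 0 < z -> z <= w -> ln (w / z) <= (w - z) * ((w^-1 + z^-1) / 2).
Proof.
move=> z0 zw; have w0 : 0 < w by lra.
have := @ln_le_trapezoid (w / z); rewrite ler_pdivlMr// mul1r => /(_ zw) /le_trans; apply.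
rewrite le_eqVlt; apply/orP; left; apply/eqP; field.
by rewrite !gt_eqF.
Qed.

Lemma ln_ratio_ge w z : 0 < z -> z <= w -> (w - z) * ((w + z) / 2)^-1 <= ln (w / z).
Proof.
move=> z0 zw; have w0 : 0 < w by lra.
have := @ln_ge_midpoint (w / z); rewrite ler_pdivlMr// mul1r => /(_ zw); apply: le_trans.
rewrite le_eqVlt; apply/orP; left; apply/eqP; field.
by rewrite !gt_eqF//; lra.
Qed.

End logarithm.

Section mean_function.
Variables (R : realType) (x y : R).
Hypotheses (x0 : 0 < x) (y0 : 0 < y).

(** First-order value of the bulk passage time, and minimum of [mean x y]. *)
Definition limit_shape (x y : R) : R := (Num.sqrt x + Num.sqrt y) ^+ 2.

(** Expected passage time in the stationary model of parameter [u]. *)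
Definition mean (x y u : R) : R := x / u + y / (1 - u).

Local Notation gam := (limit_shape x y).
Local Notation zt := (zeta (x, y)).

Let sx : 0 < Num.sqrt x. Proof. by rewrite sqrtr_gt0. Qed.
Let sy : 0 < Num.sqrt y. Proof. by rewrite sqrtr_gt0. Qed.
Let xE : x = Num.sqrt x ^+ 2. Proof. by rewrite sqr_sqrtr// ltW. Qed.
Let yE : y = Num.sqrt y ^+ 2. Proof. by rewrite sqr_sqrtr// ltW. Qed.

Lemma limit_shape_bounds : x + y <= gam <= 2 * (x + y).
Proof.
rewrite /limit_shape [in X in X <= _ <= _]xE [in X in X <= _ <= _]yE [in X in _ <= _ <= X]xE [in X in _ <= _ <= X]yE.
move: (Num.sqrt x) (Num.sqrt y) sx sy => a b a0 b0; apply/andP; split.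
  by have := mulr_gt0 a0 b0; nra.
by have := sqr_ge0 (a - b); nra.
Qed.

(** The numerator of the difference is a perfect square because [zeta] minimizes
    the mean. *)
Lemma mean_gap u : 0 < u < 1 -> mean x y u - gam = gam * (u - zt) ^+ 2 / (u * (1 - u)).
Proof.
move=> /andP[u0 u1]; rewrite /mean /limit_shape /zeta /= [in X in X = _]xE [in X in X = _]yE.
rewrite !sqrtr_sqr !ger0_norm ?(ltW sx) ?(ltW sy)//.
move: (Num.sqrt x) (Num.sqrt y) sx sy => a b a0 b0; field.
by rewrite !gt_eqF//= ?subr_gt0// addr_gt0.
Qed.

Lemma mean_ge u : 0 < u < 1 -> gam + 4 * (x + y) * (u - zt) ^+ 2 <= mean x y u.
Proof.
move=> u01; rewrite addrC -lerBrDr mean_gap//; have /andP[u0 u1] := u01.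
have v0 : 0 < u * (1 - u) by rewrite mulr_gt0// subr_gt0.
rewrite ler_pdivlMr//; have /andP[g1 g2] := limit_shape_bounds.
have q0 := sqr_ge0 (u - zt); move: ((u - zt) ^+ 2) q0 => q q0.
have v4 : 4 * (u * (1 - u)) <= 1 by have := sqr_ge0 (u - 2^-1); nra.
have xy : 0 <= x + y by rewrite addr_ge0// ltW.
apply: (@le_trans _ _ ((x + y) * q)); last exact: ler_wpM2r.
rewrite (_ : 4 * (x + y) * q * (u * (1 - u)) = (x + y) * q * (4 * (u * (1 - u)))); last by ring.
by rewrite ler_piMr// mulr_ge0.
Qed.

Lemma mean_le a u : 0 < a -> a <= zt <= 1 - a -> `|u - zt| <= a / 2 ->
  mean x y u <= gam + 8 / a * (x + y) * (u - zt) ^+ 2.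
Proof.
move=> a0 /andP[za az]; rewrite ler_norml => /andP[u1 u2].
have u01 : 0 < u < 1 by apply/andP; split; lra.
rewrite -lerBlDl mean_gap//; have /andP[g1 g2] := limit_shape_bounds.
have v0 : 0 < u * (1 - u) by case/andP: u01 => *; rewrite mulr_gt0// subr_gt0.
rewrite ler_pdivrMr//.
have q0 := sqr_ge0 (u - zt); move: ((u - zt) ^+ 2) q0 => q q0.
have xy : 0 <= x + y by rewrite addr_ge0// ltW.
have v4 : a / 4 <= u * (1 - u).
  have [u2'|u2'] := leP u (1 / 2).
    have h1 : a / 2 <= u by lra.
    have h2 : 1 / 2 <= 1 - u by lra.
    have := ler_pM _ _ h1 h2; rewrite (_ : a / 2 * (1 / 2) = a / 4); last by field.
    by apply; lra.
  have h1 : a / 2 <= 1 - u by lra.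
  have h2 : 1 / 2 <= u by lra.
  have := ler_pM _ _ h2 h1; rewrite (_ : 1 / 2 * (a / 2) = a / 4); last by field.
  by apply; lra.
apply: (@le_trans _ _ (2 * (x + y) * q)); first exact: ler_wpM2r.
rewrite (_ : 8 / a * (x + y) * q * (u * (1 - u)) = 2 * (x + y) * q * ((4 / a) * (u * (1 - u)))); last by field; rewrite gt_eqF.
rewrite ler_peMr//; first by rewrite !mulr_ge0.
by rewrite mulrC mulrA ler_pdivlMr// mul1r mulrC; lra.
Qed.

End mean_function.

Section tails.
Context d (T : measurableType d) (R : realType) (P : probability T R).
Variables (U : T -> config R) (m n : nat).
Hypothesis indU : indep_exp P nonorigin (fun=> 1) U.

Local Notation M := (mean m%:R n%:R).
Local Notation G w z t := (lpp (weights w z (U t)) (0%N, 0%N) (m, n)).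

(** The exponent in [lpp_chernoff] is an integral of the mean, which is convex.
    Near the minimum of the mean, a cruder bound such as the product of the
    length by separate maxima of the two terms would lose the leading order. *)
Lemma lpp_upper_tail w z y : 0 < z -> z < w -> w < 1 ->
  (P [set t | (y <= G w z t)%R] <= (expR ((w - z) * ((M w + M z) / 2 - y)))%:E)%E.
Proof.
move=> z0 zw w1; have w0 : 0 < w by lra. have z1 : z < 1 by lra.
have w01 : 0 < w < 1 by rewrite w0.
have z01 : 0 < z < 1 by rewrite z0.
have := lpp_chernoff y m n indU w01 z01.
have -> : [set t | 0 <= (w - z) * (G w z t - y)] = [set t | y <= G w z t].
  by apply/seteqP; split => t /=; rewrite pmulr_rge0 ?subr_gt0// subr_ge0.
move=> /le_trans; apply; rewrite lee_fin ler_expR mulrBr lerD2r.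
have h1 := ln_ratio_le z0 (ltW zw).
have h2 : ln ((1 - z) / (1 - w)) <= (w - z) * (((1 - z)^-1 + (1 - w)^-1) / 2).
  have := @ln_ratio_le R (1 - z) (1 - w); rewrite subr_gt0 => /(_ w1).
  rewrite (_ : 1 - z - (1 - w) = w - z); last by ring.
  by apply; lra.
rewrite -(mulr_natr (ln (w / z))) -(mulr_natr (ln ((1 - z) / (1 - w)))).
have := lerD (ler_wpM2r (ler0n R m) h1) (ler_wpM2r (ler0n R n) h2).
move=> /le_trans; apply.
rewrite le_eqVlt; apply/orP; left; apply/eqP; rewrite /mean; field.
by rewrite !gt_eqF//= subr_gt0.
Qed.

Lemma lpp_lower_tail w z y : 0 < w -> w < z -> z < 1 ->
  (P [set t | (G w z t <= y)%R] <= (expR ((z - w) * (y - M ((w + z) / 2))))%:E)%E.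
Proof.
move=> w0 wz z1; have z0 : 0 < z by lra. have w1 : w < 1 by lra.
have w01 : 0 < w < 1 by rewrite w0.
have z01 : 0 < z < 1 by rewrite z0.
have := lpp_chernoff y m n indU w01 z01.
have -> : [set t | 0 <= (w - z) * (G w z t - y)] = [set t | G w z t <= y].
  by apply/seteqP; split => t /=; rewrite nmulr_rge0 ?subr_lt0// subr_le0.
move=> /le_trans; apply; rewrite lee_fin ler_expR.
have h1 := ln_ratio_ge w0 (ltW wz).
have h2 : (z - w) * (((1 - w) + (1 - z)) / 2)^-1 <= ln ((1 - w) / (1 - z)).
  have := @ln_ratio_ge R (1 - w) (1 - z); rewrite subr_gt0 => /(_ z1).
  rewrite (_ : 1 - w - (1 - z) = z - w); last by ring.
  by apply; lra.
have e1 : ln (w / z) = - ln (z / w) by rewrite -lnV ?invf_div// posrE divr_gt0.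
have e2 : ln ((1 - z) / (1 - w)) = - ln ((1 - w) / (1 - z)).
  by rewrite -lnV ?invf_div// posrE divr_gt0// subr_gt0.
rewrite -(mulr_natr (ln (w / z))) -(mulr_natr (ln ((1 - z) / (1 - w)))) e1 e2.
have := lerD (ler_wpM2r (ler0n R m) h1) (ler_wpM2r (ler0n R n) h2).
have -> : (z - w) * ((z + w) / 2)^-1 * m%:R + (z - w) * ((1 - w + (1 - z)) / 2)^-1 * n%:R =
   (z - w) * M ((w + z) / 2).
  rewrite /mean; field; rewrite !gt_eqF//=; lra.
lra.
Qed.

End tails.

(** * Coupled passage times *)

Section coupled.
Variable R : realType.
Implicit Types (v : site) (x : config R) (w z : R).

(** Passage times as functions of one family of rate-one weights, which couples
    all values of the parameters. *)
Definition full v w z x : R := lpp (weights w z x) (0%N, 0%N) v.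
Definition hor v w x : R := lpp (weights w 0 x) (1%N, 0%N) v.
Definition ver v z x : R := lpp (weights 1 z x) (0%N, 1%N) v.
Definition blk v x : R := lpp (weights 1 0 x) (1%N, 1%N) v.

Lemma measurable_weights w z : measurable_fun setT (weights w z : config R -> config R).
Proof.
apply: measurable_config => k; rewrite /weights /rescale; case: (k \in nonorigin) => //.
by apply: measurable_funM => //; exact: measurable_coord.
Qed.

Let mcomp u v w z : le_site u v -> measurable_fun setT (fun x => lpp (weights w z x) u v).
Proof.
move=> uv.
exact: (measurable_config_fun (measurable_weights w z) (measurable_lpp (R := R) uv)).
Qed.

Lemma measurable_full v w z : measurable_fun setT (full v w z).
Proof. exact: mcomp. Qed.

Variables m n : nat.
Local Notation v := (m.+1, n.+1).

Lemma measurable_hor w : measurable_fun setT (hor v w).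
Proof. exact: mcomp. Qed.

Lemma measurable_ver z : measurable_fun setT (ver v z).
Proof. exact: mcomp. Qed.

Lemma measurable_blk : measurable_fun setT (blk v).
Proof. exact: mcomp. Qed.

Lemma hor_weights w z x : lpp (weights w z x) (1%N, 0%N) v = hor v w x.
Proof.
by apply: lpp_agree => // -[[|i] [|j]].
Qed.

Lemma ver_weights w z x : lpp (weights w z x) (0%N, 1%N) v = ver v z x.
Proof.
by apply: lpp_agree => // -[[|i] [|j]].
Qed.

Lemma blk_weights w z x : lpp (weights w z x) (1%N, 1%N) v = blk v x.
Proof.
by apply: lpp_agree => // -[[|i] [|j]].
Qed.

Lemma full_max w z x : full v w z x = Num.max (hor v w x) (ver v z x).
Proof. by rewrite /full lpp_origin_max// hor_weights ver_weights. Qed.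

Lemma hor_le_full w z x : hor v w x <= full v w z x.
Proof. by rewrite full_max le_max lexx. Qed.

Lemma ver_le_full w z x : ver v z x <= full v w z x.
Proof. by rewrite full_max le_max lexx orbT. Qed.

Lemma inv_convex (s a b : R) : 0 <= s <= 1 -> 0 < a -> 0 < b ->
  ((1 - s) * a + s * b)^-1 <= (1 - s) * a^-1 + s * b^-1.
Proof.
move=> /andP[s0 s1] a0 b0; have c0 : 0 < (1 - s) * a + s * b.
  have [->|sn0] := eqVneq s 0; first by rewrite mul0r subr0 mul1r addr0.
  have s_gt0 : 0 < s by rewrite lt_neqAle eq_sym sn0.
  by rewrite ltr_wpDl ?mulr_ge0 ?mulr_gt0 ?subr_ge0// ltW.
rewrite -[X in X <= _]mul1r ler_pdivrMr// -subr_ge0.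
rewrite (_ : _ - 1 = s * (1 - s) * (a - b) ^+ 2 / (a * b)); last by field; rewrite !gt_eqF.
by rewrite !(sqr_ge0, divr_ge0, mulr_ge0, subr_ge0, ltW a0, ltW b0) ?s0 ?s1.
Qed.

(** Inversion is convex, so the weights are convex in the parameters, and passage
    times are maxima of sums of weights. *)
Lemma full_convex s w1 z1 w2 z2 x : 0 <= s <= 1 -> 0 < w1 -> 0 < w2 -> z1 < 1 -> z2 < 1 ->
  (forall k, 0 <= x k) ->
  full v ((1 - s) * w1 + s * w2) ((1 - s) * z1 + s * z2) x <=
  (1 - s) * full v w1 z1 x + s * full v w2 z2 x.
Proof.
move=> s01 w10 w20 z11 z21 x0; have /andP[s0 s1] := s01.
apply: lpp_le_comb => //; first by rewrite subr_ge0.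
move=> k; rewrite /weights /rescale; case: ifP => _; last by rewrite !mulr0 addr0.
rewrite !mulrA ![_ * x k]mulrC -!mulrA -mulrDr ler_wpM2l//.
rewrite /rate; case: ifP => _; first exact: inv_convex.
case: ifP => _; last by rewrite invr1; lra.
rewrite (_ : 1 - _ = (1 - s) * (1 - z1) + s * (1 - z2)); last by ring.
by apply: inv_convex; rewrite ?subr_gt0.
Qed.

Lemma hor_anti w1 w x : 0 < w1 -> w1 <= w -> (forall k, 0 <= x k) -> hor v w x <= hor v w1 x.
Proof.
move=> w10 w1w x0; apply: lpp_le => // k; rewrite /weights /rescale; case: ifP => // _.
rewrite ler_wpM2l// /rate; case: ifP => // _.
by rewrite lef_pV2// posrE; lra.
Qed.

Lemma blk_ge0 x : (forall k, 0 <= x k) -> 0 <= blk v x.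
Proof.
move=> x0; apply: lpp_ge0 => // k; rewrite /weights /rescale; case: ifP => // _.
by rewrite divr_ge0// ltW// rate_gt0.
Qed.

End coupled.

Section unions.
Context d (T : measurableType d) (R : realType) (P : probability T R).

Lemma probability_union_le (A B C : set T) (b c : R) :
  measurable A -> measurable B -> measurable C -> A `<=` B `|` C ->
  (P B <= b%:E)%E -> (P C <= c%:E)%E -> (P A <= (b + c)%:E)%E.
Proof.
move=> mA mB mC ABC Bb Cc; rewrite EFinD.
apply: (le_trans _ (leeD Bb Cc)); apply: (@le_trans _ _ (P (B `|` C))).
  by apply: le_measure => //; rewrite inE//; exact: measurableU.
exact: measureU2.
Qed.

Lemma probability_mono (A B : set T) (b : R) :
  measurable A -> measurable B -> A `<=` B -> (P B <= b%:E)%E -> (P A <= b%:E)%E.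
Proof. by move=> mA mB AB; apply: le_trans; apply: le_measure => //; rewrite inE. Qed.

Lemma measurable_event_ge (X : T -> config R) (f : config R -> R) (y : R) :
  measurable_fun setT X -> measurable_fun setT f -> measurable [set t | y <= f (X t)].
Proof.
by move=> mX mf; apply: (@measurable_set_le _ _ _ (fun=> y)) => //; exact: (measurable_config_fun mX).
Qed.

Lemma measurable_event_le (X : T -> config R) (f : config R -> R) (y : R) :
  measurable_fun setT X -> measurable_fun setT f -> measurable [set t | f (X t) <= y].
Proof.
by move=> mX mf; apply: (@measurable_set_le _ _ _ _ (fun=> y)) => //; exact: (measurable_config_fun mX).
Qed.

End unions.

Section estimates.
Context d (T : measurableType d) (R : realType) (P : probability T R).
Variables (m n : nat) (U : T -> config R).
Hypothesis indU : indep_exp P nonorigin (fun=> 1) U.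
Hypothesis U0 : forall t k, 0 <= U t k.

Local Notation v := (m.+1, n.+1).
Local Notation M := (mean m.+1%:R n.+1%:R : R -> R).
Local Notation gam := (limit_shape m.+1%:R n.+1%:R : R).
Local Notation zt := (zeta (m.+1%:R, n.+1%:R) : R).
Local Notation N := (m.+1%:R + n.+1%:R : R).

(** Parameters within [9 * mu] of the characteristic one stay in a compact part
    of the unit interval. *)
Definition window (a mu : R) : Prop :=
  [/\ 0 < a, a <= zt <= 1 - a, 0 < mu & 18 * mu <= a].

(** [81 * (8 / a)] controls the excess of the mean at distance [9 * mu] from its
    minimum; the additional [1] is the room used by exponential bounds. *)
Definition curvature (a : R) : R := 81 * (8 / a) + 1.
Definition decay (a : R) : R := (8 * curvature a)^-1.

Let mU : measurable_fun setT U. Proof. by case: indU. Qed.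
Let N0 : 0 < N. Proof. by rewrite addr_gt0. Qed.
Let x0 : 0 < m.+1%:R :> R. Proof. by []. Qed.
Let y0 : 0 < n.+1%:R :> R. Proof. by []. Qed.

Let curv1 a : 0 < a -> 1 <= curvature a.
Proof. by move=> a0; rewrite /curvature lerDr mulr_ge0// divr_ge0// ltW. Qed.

Lemma decay_bounds a : 0 < a -> 0 < decay a <= 1 / 2.
Proof.
move=> a0; rewrite /decay invr_gt0; have := curv1 a0 => c; apply/andP; split; first by lra.
by rewrite invf_ple ?posrE//; lra.
Qed.

Let M_near a mu u : window a mu -> `|u - zt| <= 9 * mu -> M u <= gam + 81 * (8 / a) * (mu ^+ 2 * N).
Proof.
move=> [a0 azt mu0 mua] u9; have h : `|u - zt| <= a / 2.
  by apply: le_trans u9 _; lra.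
apply: (le_trans (mean_le x0 y0 a0 azt h)); rewrite lerD2l.
have -> : 81 * (8 / a) * (mu ^+ 2 * N) = 8 / a * N * ((9 * mu) ^+ 2) by field; rewrite gt_eqF.
rewrite ler_wpM2l ?mulr_ge0 ?invr_ge0 ?(ltW N0) ?(ltW a0)//.
by move: u9; rewrite ler_norml -subr_ge0 subr_sqr => /andP[? ?]; apply: mulr_ge0; lra.
Qed.

Let near01 a mu u : window a mu -> `|u - zt| <= 9 * mu -> 0 < u < 1.
Proof.
move=> [a0 /andP[? ?] mu0 mua]; rewrite ler_norml => /andP[? ?]; by apply/andP; split; lra.
Qed.

(** Each of the boundaries is completed by a partner at distance [mu] for which
    [lpp_upper_tail] applies; this only increases passage times. *)
Lemma full_upper_tail a mu w z : window a mu -> `|w - zt| <= 8 * mu -> `|z - zt| <= 8 * mu ->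
  (P [set t | (gam + curvature a * (mu ^+ 2 * N) <= full v w z (U t))%R] <=
   (2 * expR (- (mu ^+ 3 * N)))%:E)%E.
Proof.
move=> W; have [a0 azt mu0 mua] := W; move=> w8 z8; set y := gam + _.
have tail u u' : u - u' = mu -> `|u - zt| <= 9 * mu -> `|u' - zt| <= 9 * mu ->
    (P [set t | (y <= full v u u' (U t))%R] <= (expR (- (mu ^+ 3 * N)))%:E)%E.
  move=> uu' u9 u'9; have /andP[u0 u1] := near01 W u9; have /andP[u'0 u'1] := near01 W u'9.
  apply: le_trans (lpp_upper_tail m.+1 n.+1 indU y u'0 _ u1) _; first by lra.
  rewrite lee_fin ler_expR uu'.
  have := M_near W u9; have := M_near W u'9; rewrite /y /curvature.
  move: (M u) (M u') gam (81 * (8 / a)) => p q g c h1 h2.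
  have -> : - (mu ^+ 3 * N) = mu * (- (mu ^+ 2 * N)) by ring.
  by rewrite ler_pM2l//; move: (mu ^+ 2 * N) h1 h2 => e h1 h2; lra.
rewrite mulr2n mulrDl mul1r.
apply: (@probability_union_le _ _ _ _ _ [set t | y <= full v w (w - mu) (U t)]
  [set t | y <= full v (z + mu) z (U t)]).
- by apply: measurable_event_ge => //; exact: measurable_full.
- by apply: measurable_event_ge => //; exact: measurable_full.
- by apply: measurable_event_ge => //; exact: measurable_full.
- move=> t /=; rewrite full_max le_max => /orP[] h; [left|right]; apply: le_trans h _.
    exact: hor_le_full.
  exact: ver_le_full.
- apply: tail; first by ring.
    by apply: le_trans w8 _; lra.
  by move: w8; rewrite !ler_norml => /andP[? ?]; apply/andP; split; lra.
- apply: tail; first by ring.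
    by move: z8; rewrite !ler_norml => /andP[? ?]; apply/andP; split; lra.
  by apply: le_trans z8 _; lra.
Qed.

Lemma full_lower_tail a mu u l y : window a mu -> 0 < l -> `|u - l - zt| <= 9 * mu -> `|u + l - zt| <= 9 * mu ->
  (P [set t | (full v (u - l) (u + l) (U t) <= y)%R] <= (expR (2 * l * (y - M u)))%:E)%E.
Proof.
move=> W l0 h1 h2; have /andP[u0 _] := near01 W h1; have /andP[_ u1] := near01 W h2.
apply: le_trans (lpp_lower_tail m.+1 n.+1 indU y u0 _ u1) _; first by lra.
rewrite lee_fin ler_expR; have -> : (u - l + (u + l)) / 2 = u by field.
by rewrite (_ : u + l - (u - l) = 2 * l)//; ring.
Qed.

(** At [u = zt + mu] the mean exceeds its minimum by some [D] of order
    [mu ^+ 2 * N]. The passage time through the bottom boundary stays below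
    [gam + 3 / 4 * D], whereas the full passage time is close to [gam + D]. The
    latter bound is extrapolated by convexity from the parameters
    [u -+ sg * mu] and [u -+ mu], where tails are available. *)
Lemma ver_dominates a mu : window a mu ->
  (P [set t | (ver v (zt + mu) (U t) <= hor v (zt + mu) (U t))%R] <=
   (4 * expR (- (decay a * (mu ^+ 3 * N))))%:E)%E.
Proof.
move=> W; have [a0 azt mu0 mua] := W; set u := zt + mu; set e := expR (- (decay a * _)).
pose D := M u - gam; pose sg := 4 * decay a.
have /andP[za az] := azt.
have u01 : 0 < u < 1 by apply/andP; rewrite /u; split; lra.
have D4 : 4 * (mu ^+ 2 * N) <= D.
  have := mean_ge x0 y0 u01; rewrite /D (_ : u - zt = mu); last by rewrite /u; ring.
  by lra.
have /andP[dec0 dec1] := decay_bounds a0; have cv := curv1 a0.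
have sgE : sg * (2 * curvature a) = 1.
  by rewrite /sg /decay; field; rewrite gt_eqF//; lra.
have sg0 : 0 < sg by rewrite /sg; lra.
have sg1 : sg <= 1 / 2 by nra.
have q0 : 0 < mu ^+ 2 * N by rewrite mulr_gt0// exprn_gt0.
have e_mu : expR (- (mu ^+ 3 * N)) <= e.
  rewrite ler_expR lerN2 ger_pMl; first by lra.
  by rewrite (_ : mu ^+ 3 * N = mu * (mu ^+ 2 * N)) ?mulr_gt0//; ring.
have E1 : (P [set t | (gam + 3 / 4 * D <= hor v u (U t))%R] <= e%:E)%E.
  apply: (@probability_mono _ _ _ _ _ [set t | gam + 3 / 4 * D <= full v u zt (U t)]).
  - by apply: measurable_event_ge => //; exact: measurable_hor.
  - by apply: measurable_event_ge => //; exact: measurable_full.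
  - by move=> t /= /le_trans; apply; exact: hor_le_full.
  have ztmean : M zt = gam.
    have z01 : 0 < zt < 1 by apply/andP; split; lra.
    by have := mean_gap x0 y0 z01; rewrite subrr expr0n/= mulr0 mul0r => /subr0_eq.
  have /andP[u0 u1] := u01.
  apply: le_trans (lpp_upper_tail m.+1 n.+1 indU _ _ _ u1) _; [lra|rewrite /u; lra|].
  rewrite lee_fin ztmean; apply: le_trans e_mu; rewrite ler_expR.
  have -> : u - zt = mu by rewrite /u; ring.
  have -> : - (mu ^+ 3 * N) = mu * (- (mu ^+ 2 * N)) by ring.
  by rewrite ler_pM2l//; move: D4; rewrite /D; move: (M u) gam (mu ^+ 2 * N) => *; lra.
have E2 : (P [set t | (full v (u - sg * mu) (u + sg * mu) (U t) <= M u - D / 8)%R] <= e%:E)%E.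
  have sgmu : 0 < sg * mu by rewrite mulr_gt0.
  have sgmu1 : sg * mu <= mu by rewrite ger_pMl//; lra.
  apply: le_trans (full_lower_tail _ W sgmu _ _) _.
  - by rewrite /u ler_norml; apply/andP; split; lra.
  - by rewrite /u ler_norml; apply/andP; split; lra.
  rewrite lee_fin ler_expR.
  have -> : 2 * (sg * mu) * (M u - D / 8 - M u) = - (decay a * (mu * D)) by rewrite /sg; field.
  rewrite lerN2 ler_pM2l; last by lra.
  have -> : mu ^+ 3 * N = mu * (mu ^+ 2 * N) by ring.
  by rewrite ler_pM2l//; lra.
have E3 : (P [set t | (gam + curvature a * (mu ^+ 2 * N) <= full v (u - mu) (u + mu) (U t))%R] <=
    (2 * e)%:E)%E.
  apply: le_trans (full_upper_tail W _ _) _.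
  - by rewrite /u ler_norml; apply/andP; split; lra.
  - by rewrite /u ler_norml; apply/andP; split; lra.
  by rewrite lee_fin ler_pM2l.
have -> : 4 * e = e + (e + 2 * e) by ring.
have mh w : measurable_fun setT (hor v w) by exact: measurable_hor.
have mv z : measurable_fun setT (ver v z) by exact: measurable_ver.
have mf w z : measurable_fun setT (full v w z) by exact: measurable_full.
apply: (probability_union_le (B := [set t | gam + 3 / 4 * D <= hor v u (U t)])
  (C := [set t | full v (u - sg * mu) (u + sg * mu) (U t) <= M u - D / 8] `|`
        [set t | gam + curvature a * (mu ^+ 2 * N) <= full v (u - mu) (u + mu) (U t)])) => //.
- by apply: measurable_set_le; exact: (measurable_config_fun mU).
- exact: measurable_event_ge.
- by apply: measurableU; [exact: measurable_event_le|exact: measurable_event_ge].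
- move=> t /= vh.
  have [h1|h1] := leP (gam + 3 / 4 * D) (hor v u (U t)); [by left|right].
  have [h2|h2] := leP (full v (u - sg * mu) (u + sg * mu) (U t)) (M u - D / 8); [by left|right].
  (* otherwise [full_convex] bounds the value at [u -+ sg * mu] too low *)
  rewrite leNgt; apply/negP => h3.
  have Fu : full v u u (U t) = hor v u (U t) by rewrite full_max; apply/max_idPl.
  have s01 : 0 <= sg <= 1 by apply/andP; split; lra.
  have /andP[u0 u1] := u01.
  have c1 : 0 < u - mu by rewrite /u; lra.
  have c2 : u + mu < 1 by rewrite /u; lra.
  have := full_convex m n s01 u0 c1 u1 c2 (U0 t).
  have -> : (1 - sg) * u + sg * (u - mu) = u - sg * mu by ring.
  have -> : (1 - sg) * u + sg * (u + mu) = u + sg * mu by ring.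
  rewrite Fu => cvx.
  move: h2; rewrite ltNge => /negP; apply.
  have h1' : (1 - sg) * hor v u (U t) <= (1 - sg) * (gam + 3 / 4 * D).
    by rewrite ler_pM2l ?ltW//; lra.
  have h3' : sg * full v (u - mu) (u + mu) (U t) <= sg * (gam + curvature a * (mu ^+ 2 * N)).
    by rewrite ler_pM2l// ltW.
  have sgq : sg * (curvature a * (mu ^+ 2 * N)) = mu ^+ 2 * N / 2.
    transitivity (sg * (2 * curvature a) * (mu ^+ 2 * N) / 2); first by field.
    by rewrite sgE mul1r.
  have sD : 0 <= sg * D by apply: mulr_ge0; lra.
  have MD : M u = gam + D by rewrite /D; ring.
  rewrite mulrDr sgq in h3'.
  apply: (le_trans cvx); apply: (le_trans (lerD h1' h3')); rewrite MD.
  have -> : (1 - sg) * (gam + 3 / 4 * D) = gam + 3 / 4 * D - sg * gam - 3 / 4 * (sg * D) by ring.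
  have arith (g D' q sg_g sg_D : R) : 4 * q <= D' -> 0 <= sg_D -> 0 < q ->
      g + 3 / 4 * D' - sg_g - 3 / 4 * sg_D + (sg_g + q / 2) <= g + D' - D' / 8 by lra.
  exact: arith.
- apply: (probability_union_le (B := [set t | full v (u - sg * mu) (u + sg * mu) (U t) <= M u - D / 8])
   (C := [set t | gam + curvature a * (mu ^+ 2 * N) <= full v (u - mu) (u + mu) (U t)])) => //.
  + by apply: measurableU; [exact: measurable_event_le|exact: measurable_event_ge].
  + exact: measurable_event_le.
  + exact: measurable_event_ge.
Qed.

End estimates.

(** * Removing the boundary *)

Section relabelling.
Variable R : realType.
Implicit Types (x : config R) (w z : R).

Definition relabel (sigma : site -> site) x : config R :=
  rescale nonorigin (fun=> 1) sigma x.

Lemma relabel_ge0 sigma x : (forall k, 0 <= x k) -> forall k, 0 <= relabel sigma x k.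
Proof. by move=> x0 k; rewrite /relabel /rescale; case: ifP => // _; rewrite divr1. Qed.

Lemma relabel_indep d (T : measurableType d) (P : probability T R) sigma (U : T -> config R) :
  {in nonorigin &, injective sigma} -> (forall k, k \in nonorigin -> sigma k \in nonorigin) ->
  indep_exp P nonorigin (fun=> 1) U ->
  indep_exp P nonorigin (fun=> 1) (fun t => relabel sigma (U t)).
Proof. by move=> inj sS indU; exact: indep_exp_reindex indU inj sS _. Qed.

Definition swap (k : site) : site := (k.2, k.1).

Lemma weights_swap w z x :
  weights w z (relabel swap x) = transpose (weights (1 - z) (1 - w) x).
Proof.
apply/funext => k; rewrite /transpose /weights /relabel /rescale.
have -> : ((k.2, k.1) \in nonorigin) = (k \in nonorigin).
  by case: k => [[|i] [|j]].
have [kS|//] := boolP (k \in nonorigin); rewrite divr1; congr (_ / _).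
by case: k kS => [[|i] [|j]] _ //; rewrite /rate /=; ring.
Qed.

Lemma hor_swap m n w x : hor (n.+1, m.+1) w (relabel swap x) = ver (m.+1, n.+1) (1 - w) x.
Proof.
rewrite -(ver_weights m n (1 - 0)) -(@lpp_transpose _ _ (0%N, 1%N) (m.+1, n.+1))//=.
by rewrite /hor weights_swap.
Qed.

Lemma blk_swap m n x : blk (n.+1, m.+1) (relabel swap x) = blk (m.+1, n.+1) x.
Proof.
rewrite -(blk_weights m n (1 - 0) (1 - 1)) -(@lpp_transpose _ _ (1%N, 1%N) (m.+1, n.+1))//=.
by rewrite /blk weights_swap.
Qed.

Lemma zeta_swap (a b : R) : 0 < a -> 0 < b -> zeta (b, a) = 1 - zeta (a, b).
Proof.
move=> a0 b0; rewrite /zeta /=.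
have : 0 < Num.sqrt a by rewrite sqrtr_gt0.
have : 0 < Num.sqrt b by rewrite sqrtr_gt0.
move: (Num.sqrt a) (Num.sqrt b) => p q q0 p0; field.
by rewrite !gt_eqF// addr_gt0.
Qed.

(** Half-turn of the rectangle with corners [(1, 0)] and [(m.+1, n.+1)], onto
    the rectangle with corners [(1, 1)] and [(m.+1, n.+2)]. The two boundary
    lines receive labels that the half-turn does not use, and the rest of the
    quadrant is pushed away to keep the relabelling injective. *)
Definition half_turn (m n : nat) (k : site) : site :=
  if (k.1 <= m.+1)%N && (k.2 <= n.+2)%N then
    if k.1 == 0%N then k
    else if k.2 == 0%N then (m.+1 + k.1, 0)%N
    else (m.+2 - k.1, n.+2 - k.2)%N
  else (k.1 + (m.+1 + m.+2), k.2)%N.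

Lemma half_turn_inj m n : injective (half_turn m n).
Proof.
move=> [a b] [c e]; rewrite /half_turn /=.
do ?[case: ifP => ?]; move=> E;
  have := congr1 fst E; have := congr1 snd E => /= ? ?;
  by suff [-> ->] : a = c /\ b = e by []; lia.
Qed.

Lemma half_turn_nonorigin m n k : k \in nonorigin -> half_turn m n k \in nonorigin.
Proof.
case: k => a b; rewrite !inE /half_turn /= => /eqP ab; apply/eqP.
do ?[case: ifP => ?] => //= E;
  have := congr1 fst E; have := congr1 snd E => /= ? ?; try lia.
Qed.

(** Rates of the stationary model with parameter [z] in which the weights of
    row [n.+2] have rate [w]. *)
Definition top_row_rate n w z : site -> R := fun k =>
  if k.2 == n.+2 then (if k.1 == 0%N then w - z else w) else rate z z k.

Definition top_row_weights n w z x : config R :=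
  rescale nonorigin (top_row_rate n w z) idfun x.

Variables m n : nat.
Local Notation v := (m.+1, n.+1).

Lemma hor_half_turn w z x :
  hor v w x = lpp (top_row_weights n w z (relabel (half_turn m n) x)) (1%N, 1%N) (m.+1, n.+2).
Proof.
rewrite -(@lpp_reverse _ (weights w 0 x) _ v m n.+1)//=.
  by rewrite subnn subSnn.
move=> i j im jn; rewrite /weights /top_row_weights /relabel /rescale /=.
rewrite /half_turn /= ltnS im ltnS jn /=.
rewrite [(_, _) \in _]inE xpair_eqE subn_eq0 leqNgt ltnS im /=.
rewrite /rate /top_row_rate /= divr1 !subSS subn_eq0 subn_eq0 [(m < i)%N]ltnNge im /=.
have [->|jn'] := eqVneq j n.+1; first by rewrite leqnn eqxx.
have -> : (n < j)%N = false by lia.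
have -> : (j.+1 == n.+2) = false by lia.
by [].
Qed.

Lemma blk_half_turn w z x :
  blk v x = lpp (top_row_weights n w z (relabel (half_turn m n) x)) (1%N, 1%N) v.
Proof.
rewrite -(@lpp_reverse _ (weights 1 0 x) _ v m n)//=.
  by rewrite !subSnn.
move=> i j im jn; rewrite /weights /top_row_weights /relabel /rescale /=.
rewrite /half_turn /= ltnS im ltnS (leqW jn) /=.
rewrite [(_, _) \in _]inE xpair_eqE subn_eq0 leqNgt ltnS im /=.
rewrite /rate /top_row_rate /= divr1 !subSS subn_eq0 subn_eq0 [(m < i)%N]ltnNge im /=.
have -> : (n < j)%N = false by lia.
have -> : (j.+1 == n.+2) = false by lia.
by [].
Qed.

Lemma top_row_weights_below w z x k : (k.2 <= n.+1)%N ->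
  top_row_weights n w z x k = weights z z x k.
Proof.
move=> kn; rewrite /top_row_weights /weights /rescale /top_row_rate.
by have -> : (k.2 == n.+2) = false by lia.
Qed.

End relabelling.

Section boundary_removal.
Context d (T : measurableType d) (R : realType) (P : probability T R).

Section from_below.
Variables (m n : nat) (U : T -> config R).
Hypothesis indU : indep_exp P nonorigin (fun=> 1) U.
Hypothesis U0 : forall t k, 0 <= U t k.
Local Notation v := (m.+1, n.+1).
Local Notation zt := (zeta (m.+1%:R, n.+1%:R) : R).
Local Notation N := (m.+1%:R + n.+1%:R : R).

(** After the half-turn, the bottom boundary is a row of rate [zt + 2 * mu] on
    top of the bulk, in a stationary model of parameter [zt + mu]. By
    [bulk_top_increment] the difference is at most one vertical increment of
    that model, of rate [mu], as soon as its left boundary dominates. *)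
Lemma hor_minus_blk_tail a mu : window m n a mu ->
  (P [set t | (mu ^+ 2 * N <= hor v (zt + 2 * mu) (U t) - blk v (U t))%R] <=
   (6 * expR (- (decay a * (mu ^+ 3 * N))))%:E)%E.
Proof.
move=> W; have [a0 /andP[za az] mu0 mua] := W.
have /andP[dec0 dec1] := decay_bounds a0.
pose z := zt + mu; pose w := zt + 2 * mu; pose q := mu ^+ 2 * N.
pose U' t := relabel (half_turn m n) (U t).
have indU' : indep_exp P nonorigin (fun=> 1) U'.
  apply: relabel_indep => //; first by move=> k l _ _; exact: half_turn_inj.
  exact: half_turn_nonorigin.
have U'0 t k : 0 <= U' t k by apply: relabel_ge0.
pose r := top_row_rate n w z.
pose Y t := top_row_weights n w z (U' t).
have indY : indep_exp P nonorigin r Y.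
  apply: indep_exp_reindex indU' _ _ _ => // k _.
  rewrite /r /top_row_rate /rate /w /z; do ?[case: ifP => _]; lra.
have st : stationary_rates m.+1 n.+2 r.
  move=> i j _ jn; rewrite /r /top_row_rate /rate /=.
  by case: eqP => _; [rewrite addrC subrK|lra].
have topY := top_vertical_increment_tail q (indep_exp_sub indY _) st.
have {}topY : (P [set t | (q <= lpp (Y t) (0%N, 0%N) (m.+1, n.+2) - lpp (Y t) (0%N, 0%N) v)%R] <=
    (2 * expR (- (decay a * (mu ^+ 3 * N))))%:E)%E.
  apply: le_trans (topY _) _; first by move=> k; rewrite inE => /and3P[].
  rewrite lee_fin ler_pM2l// ler_expR lerN2 /r /top_row_rate eqxx /=.
  have -> : w - z = mu by rewrite /w /z; ring.
  have -> : mu / 2 * q = 1 / 2 * (mu ^+ 3 * N) by rewrite /q; field.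
  by rewrite ler_wpM2r// mulr_ge0 ?exprn_ge0 ?addr_ge0// ltW.
have verY := ver_dominates (n := n) (m := m) indU' U'0 W.
have -> (e : R) : 6 * e = 4 * e + 2 * e by ring.
have mU : measurable_fun setT U by case: indU.
have mU' : measurable_fun setT U' by case: indU'.
have mY : measurable_fun setT Y by case: indY.
apply: (probability_union_le _ _ _ _ verY topY).
- apply: (@measurable_set_le _ _ _ (fun=> q)) => //; apply: measurable_funB.
    by apply: (measurable_config_fun mU); exact: measurable_hor.
  by apply: (measurable_config_fun mU); exact: measurable_blk.
- apply: measurable_set_le; apply: (measurable_config_fun mU').
    exact: measurable_ver.
  exact: measurable_hor.
- apply: (@measurable_set_le _ _ _ (fun=> q)) => //; apply: measurable_funB.
    by apply: (measurable_config_fun (F := fun x => lpp x (0%N, 0%N) (m.+1, n.+2)) mY); exact: measurable_lpp.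
  by apply: (measurable_config_fun (F := fun x => lpp x (0%N, 0%N) v) mY); exact: measurable_lpp.
move=> t /= qt; have [|vh] := leP (ver v (zt + mu) (U' t)) (hor v (zt + mu) (U' t)); [by left|right].
apply: (le_trans qt); rewrite (hor_half_turn m n w z) (blk_half_turn m n w z).
apply: bulk_top_increment => //.
have below u : le_site u v -> lpp (Y t) u v = lpp (weights z z (U' t)) u v.
  by move=> uv; apply: lpp_agree => // k _ /andP[_ kn]; exact: top_row_weights_below.
by rewrite !below// hor_weights ver_weights ltW.
Qed.

End from_below.

Section both_sides.
Variables (m n : nat) (U : T -> config R).
Hypothesis indU : indep_exp P nonorigin (fun=> 1) U.
Hypothesis U0 : forall t k, 0 <= U t k.
Local Notation v := (m.+1, n.+1).
Local Notation gam := (limit_shape m.+1%:R n.+1%:R : R).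
Local Notation zt := (zeta (m.+1%:R, n.+1%:R) : R).
Local Notation N := (m.+1%:R + n.+1%:R : R).

Let mU : measurable_fun setT U. Proof. by case: indU. Qed.
Let mdiff (y : R) (f g : config R -> R) : measurable_fun setT f -> measurable_fun setT g ->
  measurable [set t | y <= f (U t) - g (U t)].
Proof.
move=> mf mg; apply: (@measurable_set_le _ _ _ (fun=> y)) => //.
by apply: measurable_funB; exact: (measurable_config_fun mU).
Qed.

Lemma swap_indep : indep_exp P nonorigin (fun=> 1) (fun t => relabel swap (U t)).
Proof.
apply: relabel_indep => //; first by move=> [a b] [c e] _ _ [-> ->].
by move=> [[|i] [|j]].
Qed.

Lemma window_swap a mu : window m n a mu -> @window R n m a mu.
Proof.
move=> [a0 /andP[za az] mu0 mua]; split => //.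
by rewrite zeta_swap//; apply/andP; split; lra.
Qed.

Lemma ver_minus_blk_tail a mu : window m n a mu ->
  (P [set t | (mu ^+ 2 * N <= ver v (zt - 2 * mu) (U t) - blk v (U t))%R] <=
   (6 * expR (- (decay a * (mu ^+ 3 * N))))%:E)%E.
Proof.
move=> W; have swap0 t k : 0 <= relabel swap (U t) k by exact: relabel_ge0.
have := hor_minus_blk_tail swap_indep swap0 (window_swap W).
rewrite [n.+1%:R + _]addrC zeta_swap//.
have -> : [set t | mu ^+ 2 * N <= hor (n.+1, m.+1) (1 - zt + 2 * mu) (relabel swap (U t)) -
                                  blk (n.+1, m.+1) (relabel swap (U t))] =
          [set t | mu ^+ 2 * N <= ver v (zt - 2 * mu) (U t) - blk v (U t)].
  apply/seteqP; split => t /=; rewrite hor_swap blk_swap;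
    by rewrite (_ : 1 - (1 - zt + 2 * mu) = zt - 2 * mu)//; ring.
by [].
Qed.

(** With the repelling parameters [zt + 2 * mu] and [zt - 2 * mu], the full passage
    time exceeds the bulk one by little. Convexity bounds it from below, since
    the midpoint of these parameters and of the strongly attracting
    [zt - 4 * mu], [zt + 4 * mu] is the attracting pair [zt - mu], [zt + mu]. *)
Lemma blk_lower_tail a mu : window m n a mu ->
  (P [set t | (blk v (U t) <= gam - (curvature a + 3) * (mu ^+ 2 * N))%R] <=
   (15 * expR (- (decay a * (mu ^+ 3 * N))))%:E)%E.
Proof.
move=> W; have [a0 /andP[za az] mu0 mua] := W.
have /andP[dec0 dec1] := decay_bounds a0.
set e := expR _; pose q := mu ^+ 2 * N.
have N0 : 0 < N by rewrite addr_gt0.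
have q0 : 0 < q by rewrite mulr_gt0// exprn_gt0.
have e_mu : expR (- (mu ^+ 3 * N)) <= e.
  rewrite ler_expR lerN2 ger_pMl; first by lra.
  by rewrite (_ : mu ^+ 3 * N = mu * (mu ^+ 2 * N)) ?mulr_gt0//; ring.
have F1 := hor_minus_blk_tail indU U0 W.
have F2 := ver_minus_blk_tail W.
have F3 : (P [set t | (full v (zt - mu) (zt + mu) (U t) <= gam - q)%R] <= e%:E)%E.
  apply: le_trans (full_lower_tail indU _ W mu0 _ _) _.
  - by rewrite ler_norml; apply/andP; split; lra.
  - by rewrite ler_norml; apply/andP; split; lra.
  rewrite lee_fin; apply: le_trans e_mu; rewrite ler_expR.
  have z01 : 0 < zt < 1 by apply/andP; split; lra.
  have -> : mean m.+1%:R n.+1%:R zt = gam.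
    have := @mean_gap R m.+1%:R n.+1%:R (ltr0Sn _ _) (ltr0Sn _ _) zt z01.
    by rewrite subrr expr0n/= mulr0 mul0r => /subr0_eq.
  rewrite (_ : 2 * mu * _ = - (2 * (mu * q))); last by ring.
  rewrite (_ : mu ^+ 3 * N = mu * q); last by rewrite /q; ring.
  by have := mulr_gt0 mu0 q0; lra.
have F4 : (P [set t | (gam + curvature a * q <= full v (zt - 4 * mu) (zt + 4 * mu) (U t))%R] <=
    (2 * e)%:E)%E.
  apply: le_trans (full_upper_tail indU W _ _) _.
  - by rewrite ler_norml; apply/andP; split; lra.
  - by rewrite ler_norml; apply/andP; split; lra.
  by rewrite lee_fin ler_pM2l.
have -> : 15 * e = (6 * e + 6 * e) + (e + 2 * e) by ring.
have mh w : measurable_fun setT (hor v w : config R -> R) by exact: measurable_hor.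
have mv z : measurable_fun setT (ver v z : config R -> R) by exact: measurable_ver.
have mf w z : measurable_fun setT (full v w z : config R -> R) by exact: measurable_full.
have mb : measurable_fun setT (blk v : config R -> R) by exact: measurable_blk.
apply: (probability_union_le _ _ _ _
  (probability_union_le _ _ _ (fun=> id) F1 F2)
  (probability_union_le _ _ _ (fun=> id) F3 F4)).
- exact: measurable_event_le.
- by apply: measurableU; exact: mdiff.
- by apply: measurableU; [exact: measurable_event_le|exact: measurable_event_ge].
- move=> t /= small.
  have [h1|h1] := leP q (hor v (zt + 2 * mu) (U t) - blk v (U t)); [by left; left|].
  have [h2|h2] := leP q (ver v (zt - 2 * mu) (U t) - blk v (U t)); [by left; right|right].
  have [h3|h3] := leP (full v (zt - mu) (zt + mu) (U t)) (gam - q); [by left|right].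
  rewrite leNgt; apply/negP => h4.
  have w1 : 0 < zt + 2 * mu by lra.
  have w2 : 0 < zt - 4 * mu by lra.
  have z1 : zt - 2 * mu < 1 by lra.
  have z2 : zt + 4 * mu < 1 by lra.
  have s01 : 0 <= (1 / 2 : R) <= 1 by apply/andP; split; lra.
  have := full_convex m n s01 w1 w2 z1 z2 (U0 t).
  have -> : (1 - 1 / 2) * (zt + 2 * mu) + 1 / 2 * (zt - 4 * mu) = zt - mu by field.
  have -> : (1 - 1 / 2) * (zt - 2 * mu) + 1 / 2 * (zt + 4 * mu) = zt + mu by field.
  have h5 : full v (zt + 2 * mu) (zt - 2 * mu) (U t) < blk v (U t) + q.
    by rewrite full_max gt_max -!ltrBlDl h1 h2.
  have arith (f0 f1 f2 b c q' g : R) : b <= g - (c + 3) * q' -> g - q' < f0 ->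
      f2 < g + c * q' -> f1 < b + q' -> f0 <= (1 - 1 / 2) * f1 + 1 / 2 * f2 -> False by lra.
  exact: arith small h3 h4 h5.
- by apply: measurableU; exact: mdiff.
- exact: mdiff.
- exact: mdiff.
- by apply: measurableU; [exact: measurable_event_le|exact: measurable_event_ge].
- exact: measurable_event_le.
- exact: measurable_event_ge.
Qed.

End both_sides.
End boundary_removal.

(** * Tail of the boundary effect *)

Section boundary_effect.
Context d (T : measurableType d) (R : realType) (P : probability T R).
Variables (m n : nat) (U : T -> config R).
Hypothesis indU : indep_exp P nonorigin (fun=> 1) U.
Hypothesis U0 : forall t k, 0 <= U t k.
Local Notation v := (m.+1, n.+1).
Local Notation M := (mean m.+1%:R n.+1%:R : R -> R).
Local Notation gam := (limit_shape m.+1%:R n.+1%:R : R).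
Local Notation zt := (zeta (m.+1%:R, n.+1%:R) : R).
Local Notation N := (m.+1%:R + n.+1%:R : R).

Let mU : measurable_fun setT U. Proof. by case: indU. Qed.
(** The last summand keeps the scale of [blk_lower_tail_linear] in the window. *)
Definition spread (a : R) : R := curvature a + 3 + 18 * (36 / a ^+ 2).

Definition boundary_rate (a : R) : R := Num.min (a / 64) (decay a / (2 * spread a) ^+ 2).

Lemma spread_ge4 a : 0 < a -> 4 <= spread a.
Proof.
move=> a0; have h1 : 0 <= 18 * (36 / a ^+ 2) by rewrite mulr_ge0// divr_ge0// exprn_ge0// ltW.
have h2 : 0 <= 81 * (8 / a) by rewrite mulr_ge0// divr_ge0// ltW.
by rewrite /spread /curvature; lra.
Qed.

Lemma boundary_rate_gt0 a : 0 < a -> 0 < boundary_rate a.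
Proof.
move=> a0; have := spread_ge4 a0 => A4; have /andP[dec0 _] := decay_bounds a0.
by rewrite /boundary_rate lt_min divr_gt0//= divr_gt0// exprn_gt0//; lra.
Qed.

(** The parameters [zt - b] and [zt - 2 * b], with [b] a small multiple of
    [theta], exceed the minimum of the mean by a small multiple of
    [theta ^+ 2 * N], hence of [s]. *)
Lemma hor_upper_tail a theta s w : 0 < a -> a <= zt <= 1 - a -> 0 < theta <= 1 ->
  theta ^+ 2 * N <= s -> zt - a / 16 * theta <= w ->
  (P [set t | (gam + s / 2 <= hor v w (U t))%R] <= (expR (- (a / 64 * (theta * s))))%:E)%E.
Proof.
move=> a0 azt /andP[th0 th1] ths wz; have /andP[za az] := azt.
pose b := a / 16 * theta; pose w1 := zt - b.
have b0 : 0 < b by rewrite mulr_gt0// divr_gt0.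
have ba : b <= a / 16 by rewrite /b ger_pMr// divr_gt0.
have s0 : 0 <= s by apply: le_trans ths; rewrite mulr_ge0 ?sqr_ge0// addr_ge0.
apply: (@probability_mono _ _ _ _ _ [set t | gam + s / 2 <= full v w1 (w1 - b) (U t)]).
- by apply: measurable_event_ge => //; exact: measurable_hor.
- by apply: measurable_event_ge => //; exact: measurable_full.
- move=> t /= h; apply: (le_trans h); apply: le_trans (hor_le_full _ _ _ (w1 - b) _).
  by apply: hor_anti => //; rewrite /w1; lra.
apply: le_trans (lpp_upper_tail m.+1 n.+1 indU _ _ _ _) _.
- by rewrite /w1; lra.
- by lra.
- by rewrite /w1; lra.
rewrite lee_fin ler_expR.
have near u : `|u - zt| <= 2 * b -> M u <= gam + s / 8.
  move=> ub; have ua : `|u - zt| <= a / 2 by apply: le_trans ub _; lra.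
  apply: le_trans (mean_le _ _ a0 azt ua) _ => //; rewrite lerD2l.
  have sq : (u - zt) ^+ 2 <= (2 * b) ^+ 2.
    rewrite -subr_ge0 subr_sqr; move: ub; rewrite ler_norml => /andP[? ?].
    by apply: mulr_ge0; lra.
  have c0 : 0 <= 8 / a * N by rewrite mulr_ge0 ?divr_ge0 ?addr_ge0// ltW.
  apply: (le_trans (ler_wpM2l c0 sq)).
  have -> : 8 / a * N * (2 * b) ^+ 2 = a / 8 * (theta ^+ 2 * N).
    by rewrite /b; field; rewrite gt_eqF.
  apply: (@le_trans _ _ (a / 8 * s)); first by rewrite ler_pM2l// divr_gt0.
  by rewrite [s / 8]mulrC ler_wpM2r//; lra.
have h1 : M w1 <= gam + s / 8.
  by apply: near; rewrite /w1 ler_norml; apply/andP; split; lra.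
have h2 : M (w1 - b) <= gam + s / 8.
  by apply: near; rewrite /w1 ler_norml; apply/andP; split; lra.
have -> : w1 - (w1 - b) = b by ring.
have -> : - (a / 64 * (theta * s)) = b * (- (s / 4)) by rewrite /b; field.
rewrite ler_pM2l//; move: h1 h2; move: (M w1) (M (w1 - b)) gam => p q g h1 h2; lra.
Qed.

(** The scale [mu] is such that [spread a * (mu ^+ 2 * N)] is [s / 2]. Above
    [2 * gam] the event is empty, the weights being nonnegative. *)
Lemma blk_lower_tail_linear a theta s : 0 < a -> a <= zt <= 1 - a -> 0 < theta <= 1 ->
  theta ^+ 2 * N <= s ->
  (P [set t | (blk v (U t) <= gam - s / 2)%R] <=
   (15 * expR (- (decay a / (2 * spread a) ^+ 2 * (theta * s))))%:E)%E.
Proof.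
move=> a0 azt /andP[th0 th1] ths.
have N0 : 0 < N by rewrite addr_gt0.
have A4 := spread_ge4 a0; set A := spread a in A4 *.
have A0 : 0 < A by lra.
have s0 : 0 < s by apply: lt_le_trans ths; rewrite mulr_gt0// exprn_gt0.
have /andP[g1 g2] := limit_shape_bounds (ltr0Sn R m) (ltr0Sn R n).
have /andP[dec0 dec1] := decay_bounds a0.
have [sg|sg] := leP s (2 * gam); last first.
  have -> : [set t | blk v (U t) <= gam - s / 2] = set0.
    apply/seteqP; split => // t /= h.
    by have := blk_ge0 m n (U0 t); lra.
  by rewrite measure0 lee_fin mulr_ge0// expR_ge0.
pose mu := Num.sqrt (s / (2 * A * N)).
have den0 : 0 < 2 * A * N by rewrite !mulr_gt0.
have mu0 : 0 < mu by rewrite sqrtr_gt0 divr_gt0.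
have mu2 : mu ^+ 2 = s / (2 * A * N) by rewrite sqr_sqrtr// divr_ge0// ltW.
have mu2N : mu ^+ 2 * N = s / (2 * A) by rewrite mu2; field; rewrite !gt_eqF.
have mua : 18 * mu <= a.
  rewrite -(ler_pXn2r (n := 2))// ?nnegrE ?mulr_ge0 ?(ltW mu0) ?(ltW a0)//.
  rewrite exprMn mu2 mulrA ler_pdivrMr//.
  have h : 18 * 36 <= a ^+ 2 * A.
    have -> : 18 * 36 = a ^+ 2 * (18 * (36 / a ^+ 2)) :> R by field; rewrite gt_eqF.
    rewrite ler_pM2l ?exprn_gt0// /A /spread /curvature.
    have : 0 <= 81 * (8 / a) by rewrite mulr_ge0// divr_ge0// ltW.
    lra.
  apply: (@le_trans _ _ (18 * 36 * (2 * N))); last first.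
    rewrite (_ : a ^+ 2 * (2 * A * N) = a ^+ 2 * A * (2 * N)); last by ring.
    by rewrite ler_wpM2r// mulr_ge0// ltW.
  by move: sg g2; rewrite -[18 ^+ 2]/(18 * 18); move: gam N => g N' *; lra.
have W : window m n a mu by [].
apply: (@probability_mono _ _ _ _ _ [set t | blk v (U t) <= gam - (curvature a + 3) * (mu ^+ 2 * N)]).
- by apply: measurable_event_le => //; exact: measurable_blk.
- by apply: measurable_event_le => //; exact: measurable_blk.
- move=> t /= h; apply: (le_trans h); rewrite lerD2l lerN2 mu2N.
  have -> : s / 2 = A * (s / (2 * A)) by field; rewrite gt_eqF.
  rewrite ler_pM2r; last by rewrite divr_gt0// mulr_gt0.
  by rewrite /A /spread lerDl mulr_ge0// divr_ge0// exprn_ge0// ltW.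
apply: le_trans (blk_lower_tail indU U0 W) _.
rewrite lee_fin ler_pM2l// ler_expR lerN2.
have -> : mu ^+ 3 * N = mu * (s / (2 * A)) by rewrite -mu2N; ring.
have thmu : theta / (2 * A) <= mu.
  rewrite -(ler_pXn2r (n := 2))// ?nnegrE ?(ltW mu0)//; last by rewrite divr_ge0// ?(ltW th0)//; lra.
  rewrite mu2 ler_pdivlMr//.
  apply: le_trans ths.
  rewrite (_ : _ * (2 * A * N) = theta ^+ 2 * N * (2 * A)^-1); last by field; rewrite gt_eqF.
  rewrite ler_piMr//; first by rewrite mulr_ge0 ?sqr_ge0// ltW.
  by rewrite invf_le1; lra.
rewrite (_ : decay a / (2 * A) ^+ 2 * (theta * s) = decay a * (theta / (2 * A) * (s / (2 * A)))); last by field; rewrite gt_eqF.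
by rewrite ler_pM2l// ler_pM2r// divr_gt0// mulr_gt0.
Qed.

Lemma hor_minus_blk_large_tail a theta s w : 0 < a -> a <= zt <= 1 - a -> 0 < theta <= 1 ->
  theta ^+ 2 * N <= s -> zt - a / 16 * theta <= w ->
  (P [set t | (s <= hor v w (U t) - blk v (U t))%R] <=
   (16 * expR (- (boundary_rate a * (theta * s))))%:E)%E.
Proof.
move=> a0 azt th ths wz; have /andP[th0 th1] := th.
have N0 : 0 < N by rewrite addr_gt0.
have s0 : 0 < s by apply: lt_le_trans ths; rewrite mulr_gt0// exprn_gt0.
set e := expR _; have -> : 16 * e = e + 15 * e by ring.
have ths0 : 0 < theta * s by rewrite mulr_gt0.
apply: (probability_union_le (B := [set t | gam + s / 2 <= hor v w (U t)])
  (C := [set t | blk v (U t) <= gam - s / 2])).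
- apply: (@measurable_set_le _ _ _ (fun=> s)) => //; apply: measurable_funB; apply: (measurable_config_fun mU).
    exact: measurable_hor.
  exact: measurable_blk.
- by apply: measurable_event_ge => //; exact: measurable_hor.
- by apply: measurable_event_le => //; exact: measurable_blk.
- move=> t /= h; have [h1|h1] := leP (gam + s / 2) (hor v w (U t)); [by left|right].
  move: h h1; move: (hor v w (U t)) (blk v (U t)) gam => p q g; lra.
- apply: le_trans (hor_upper_tail a0 azt th ths wz) _.
  by rewrite lee_fin ler_expR lerN2 ler_pM2r// /boundary_rate ge_min lexx.
- apply: le_trans (blk_lower_tail_linear a0 azt th ths) _.
  by rewrite lee_fin ler_pM2l// ler_expR lerN2 ler_pM2r// /boundary_rate ge_min lexx orbT.
Qed.

End boundary_effect.

(** * Transfer to the given environment *)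

Lemma cone_zeta (R : realType) (delta : R) (x : R * R) : 0 < delta -> cone delta x ->
  Num.sqrt delta / (1 + Num.sqrt delta) <= zeta x <= 1 - Num.sqrt delta / (1 + Num.sqrt delta).
Proof.
case: x => x y d0 [/= x0 y0 xy yx].
have sd : 0 < Num.sqrt delta by rewrite sqrtr_gt0.
have sx : 0 < Num.sqrt x by rewrite sqrtr_gt0.
have sy : 0 < Num.sqrt y by rewrite sqrtr_gt0.
have h1 : Num.sqrt delta * Num.sqrt y <= Num.sqrt x by rewrite -sqrtrM ?ler_sqrt// ltW.
have h2 : Num.sqrt delta * Num.sqrt x <= Num.sqrt y by rewrite -sqrtrM ?ler_sqrt// ltW.
rewrite /zeta /=; move: (Num.sqrt delta) (Num.sqrt x) (Num.sqrt y) sd sx sy h1 h2 => e p q e0 p0 q0 h1 h2.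
have pq : 0 < p + q by rewrite addr_gt0.
have e1 : 0 < 1 + e by rewrite addr_gt0.
have -> : 1 - e / (1 + e) = (1 + e)^-1 by field; rewrite gt_eqF.
apply/andP; split.
  by rewrite ler_pdivrMr// mulrAC ler_pdivlMr//; nra.
by rewrite ler_pdivrMr// mulrC ler_pdivlMr//; nra.
Qed.

Section scales.
Variables (R : realType) (s L : R).
Hypotheses (s1 : 1 <= s) (L1 : 1 <= L).

Let theta := Num.min (s `^ (1 / 2) * L `^ (- (1 / 3))) 1.

(** The minimum defining [theta] selects the regime of the exponent. With [p] the
    square root of [s] and [g] the cube root of [L], all claims are algebra from
    [p * p = s] and [g * g * g = L]. *)
Lemma scale_bounds :
  [/\ 0 < theta <= 1, theta ^+ 2 * L <= s * L `^ (1 / 3),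
      theta * (s * L `^ (1 / 3)) = Num.min (s `^ (3 / 2)) (s * L `^ (1 / 3)) &
      s <= theta * (s * L `^ (1 / 3))].
Proof.
have s1' := s1; have L1' := L1.
have s0 : 0 < s by lra.
have L0 : 0 < L by lra.
have sE : s `^ (1 / 2) * s `^ (1 / 2) = s.
  rewrite -powRD; last by rewrite (gt_eqF s0) implybT.
  by rewrite (_ : 1 / 2 + 1 / 2 = 1) ?powRr1 ?ltW//; field.
have LE : L `^ (1 / 3) * L `^ (1 / 3) * L `^ (1 / 3) = L.
  rewrite -!powRD; try by rewrite (gt_eqF L0) implybT.
  by rewrite (_ : 1 / 3 + 1 / 3 + 1 / 3 = 1) ?powRr1 ?ltW//; field.
have s32 : s `^ (3 / 2) = s * s `^ (1 / 2).
  transitivity (s `^ 1 * s `^ (1 / 2)); last by rewrite powRr1// ltW.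
  rewrite -powRD; last by rewrite (gt_eqF s0) implybT.
  by congr (_ `^ _); field.
have p1 : 1 <= s `^ (1 / 2) by rewrite -[leLHS](powRr0 s) ler_powR//; lra.
have g1 : 1 <= L `^ (1 / 3) by rewrite -[leLHS](powRr0 L) ler_powR//; lra.
rewrite /theta s32 powRN; move: (s `^ (1 / 2)) (L `^ (1 / 3)) sE LE p1 g1 => p g sE LE p1 g1.
have g0 : 0 < g by lra.
have pg0 : 0 < p * g^-1 by rewrite divr_gt0//; lra.
have th0 : 0 < Num.min (p * g^-1) 1 by rewrite lt_min pg0 ltr01.
have thE : Num.min (p * g^-1) 1 * (s * g) = Num.min (s * p) (s * g).
  rewrite minr_pMl; last by rewrite mulr_ge0// ltW.
  by rewrite mul1r; congr (Num.min _ _); field; rewrite gt_eqF.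
split=> //.
- by rewrite th0 ge_min lexx orbT.
- apply: (@le_trans _ _ ((p * g^-1) ^+ 2 * L)).
    rewrite ler_pM2r// ler_pXn2r ?nnegrE ?(ltW th0) ?(ltW pg0)//.
    by rewrite ge_min lexx.
  by rewrite -LE -sE le_eqVlt; apply/orP; left; apply/eqP; field; rewrite gt_eqF.
- by rewrite thE le_min !ler_peMr// ltW.
Qed.

End scales.

Section environment.
Context (R : realType) (d : measure_display) (T : measurableType d).
Variables (P : probability T R) (om : site -> {RV P >-> R}).
Variable omb : R -> R -> site -> {RV P >-> R}.
Hypothesis W : lpp_weights om omb.
Variables w z : R.
Hypotheses (w0 : 0 < w) (z1 : z < 1).

Let X k := omb w z k.
Let U t := normalized (rate w z) X t.

Lemma boundary_rates k : k \in nonorigin -> exponential_rv (rate w z k) (X k).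
Proof.
case: k => [[|i] [|j]] // _ A mA; rewrite /rate /X /=.
- exact: (ver_weights_exp W).
- exact: (hor_weights_exp W).
- rewrite -(bulk_weights_exp W i j)//; rewrite /distribution /pushforward.
  congr (P _); apply/seteqP; split => t /=; by rewrite (bulk_weights W).
Qed.

Lemma normalized_indep : indep_exp P nonorigin (fun=> 1) U.
Proof.
apply: indep_exp_normalized; first exact: (weights_independent W).
- by move=> k _; exact: rate_gt0.
- exact: boundary_rates.
Qed.

Lemma negative_null (s : seq site) : {subset s <= nonorigin} ->
  measurable [set t | exists2 k, k \in s & X k t < 0] /\
  P [set t | exists2 k, k \in s & X k t < 0] = 0%E.
Proof.
elim: s => [_|k s IH ks].
  rewrite (_ : [set t | _] = set0) ?measure0//.
  by apply/seteqP; split => // t [].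
have [|mI PI] := IH; first by move=> l ls; apply: ks; rewrite in_cons ls orbT.
have kS : k \in nonorigin by apply: ks; rewrite mem_head.
have -> : [set t | exists2 k', k' \in k :: s & X k' t < 0] =
    [set t | X k t < 0] `|` [set t | exists2 k, k \in s & X k t < 0].
  apply/seteqP; split => t /=.
    by move=> [l]; rewrite in_cons => /orP[/eqP ->|ls h]; [left|right; exists l].
  move=> [h|[l ls h]]; first by exists k => //; rewrite mem_head.
  by exists l => //; rewrite in_cons ls orbT.
have mk : measurable [set t | X k t < 0].
  have m0 : measurable_fun setT (fun _ : T => 0 : R) by [].
  have := measurable_fun_ltr (measurable_funPT (X k)) m0.
  by move=> /(_ measurableT [set true]); rewrite setTI; apply.
split; first exact: measurableU.
rewrite measureU0//.
exact: exponential_rv_lt0 (rate_gt0 _ w0 z1) (boundary_rates kS).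
Qed.

Variables m n : nat.
Local Notation v := (m.+1, n.+1).

Let box : seq site := [seq k <- [seq (i, j) | i <- iota 0 m.+2, j <- iota 0 n.+2] | k \in nonorigin].

Let inbox k : k \in nonorigin -> le_site k v -> k \in box.
Proof.
move=> kS /andP[k1 k2]; rewrite mem_filter kS /=.
case: k k1 k2 kS => a b /= k1 k2 _.
suff : (a, b) \in ([seq (i, j) | i <- iota 0 m.+2, j <- iota 0 n.+2] : seq (nat * nat)) by [].
by apply/allpairsP; exists (a, b); rewrite !mem_iota /= !add0n !ltnS.
Qed.

Lemma nonnegative_weights t : ~ (exists2 k, k \in box & X k t < 0) ->
  forall k, k \in nonorigin -> le_site k v -> weights w z (U t) k = X k t.
Proof.
move=> H k kS kv; rewrite /weights /rescale kS /U /normalized kS.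
have X0 : 0 <= X k t by rewrite leNgt; apply/negP => Xk; apply: H; exists k => //; exact: inbox.
have r0 := rate_gt0 k w0 z1.
rewrite (max_idPr _) ?mulr_ge0// 1?ltW//.
by rewrite mulrC mulKf// gt_eqF.
Qed.

(** Almost surely the weights in the rectangle are nonnegative, and then the
    truncation in [normalized] is invisible there. *)
Lemma environment_transfer (f : T -> R) (g : config R -> R) (s b : R) :
  measurable_fun setT f -> measurable_fun setT g ->
  (forall t, ~ (exists2 k, k \in box & X k t < 0) -> f t = g (U t)) ->
  (P [set t | (s <= g (U t))%R] <= b%:E)%E ->
  (P [set t | (s <= f t)%R] <= b%:E)%E.
Proof.
move=> mf mg fg gb; have [mU _ _] := normalized_indep.
have [|mN PN] := @negative_null box; first by move=> k; rewrite mem_filter => /andP[].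
rewrite -[b]addr0; apply: (probability_union_le _ _ mN _ gb).
- exact: (@measurable_set_le _ _ _ (fun=> s)).
- by apply: (@measurable_set_le _ _ _ (fun=> s)) => //; exact: (measurable_config_fun mU).
- move=> t /= h; have [?|/fg fE] := pselect (exists2 k, k \in box & X k t < 0); first by right.
  by left; rewrite -fE.
- by rewrite PN.
Qed.

Let mrv (Z : site -> {RV P >-> R}) u : le_site u v ->
  measurable_fun setT (fun t => lpp (fun q => Z q t) u v).
Proof.
move=> uv; have mZ : measurable_fun setT (fun t => (fun q => Z q t) : config R).
  by apply: measurable_config => k; exact: measurable_funPT.
exact: (measurable_config_fun mZ (measurable_lpp (R := R) uv)).
Qed.

Lemma G_bulk_blk t : ~ (exists2 k, k \in box & X k t < 0) -> G_bulk om v t = blk v (U t).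
Proof.
move=> H; rewrite -(blk_weights m n w z); apply: lpp_agree => // -[[|i] [|j]]// _ kv.
by rewrite (nonnegative_weights H)// /X (bulk_weights W).
Qed.

Lemma G_hor_tail s b : (P [set t | (s <= hor v w (U t) - blk v (U t))%R] <= b%:E)%E ->
  (P [set t | (s <= G_hor (omb w z) v t - G_bulk om v t)%R] <= b%:E)%E.
Proof.
apply: (environment_transfer (g := fun x => hor v w x - blk v x)).
- by apply: measurable_funB; exact: mrv.
- by apply: measurable_funB; [exact: measurable_hor|exact: measurable_blk].
- move=> t H; rewrite (G_bulk_blk H); congr (_ - _).
  rewrite -(hor_weights m n w z); apply: lpp_agree => // -[[|i] j]// _ kv.
  by rewrite (nonnegative_weights H).
Qed.

Lemma G_ver_tail s b : (P [set t | (s <= ver v z (U t) - blk v (U t))%R] <= b%:E)%E ->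
  (P [set t | (s <= G_ver (omb w z) v t - G_bulk om v t)%R] <= b%:E)%E.
Proof.
apply: (environment_transfer (g := fun x => ver v z x - blk v x)).
- by apply: measurable_funB; exact: mrv.
- by apply: measurable_funB; [exact: measurable_ver|exact: measurable_blk].
- move=> t H; rewrite (G_bulk_blk H); congr (_ - _).
  rewrite -(ver_weights m n w z); apply: lpp_agree => // -[i [|j]]// _ kv.
  by rewrite (nonnegative_weights H)//; rewrite inE xpair_eqE andbF.
Qed.

End environment.

Theorem theorem2p6 (R : realType) (delta : R) (delta_gt0 : 0 < delta) :
  exists (c0 eps0 : R) (N0 : nat) (s0 : R),
    [/\ 0 < c0, 0 < eps0, (0 < N0)%N & 0 < s0] /\
    forall (d : measure_display) (T : measurableType d) (P : probability T R)
      (om : nat * nat -> {RV P >-> R})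
      (omb : R -> R -> nat * nat -> {RV P >-> R}),
      lpp_weights om omb ->
    forall (v : nat * nat) (s w z : R),
      cone delta (real_point R v) -> (N0 <= v.1)%N -> (N0 <= v.2)%N ->
      s0 <= s -> 0 < w -> z < 1 ->
      (zeta (real_point R v)
         - eps0 * Num.min (s `^ (1 / 2) * l1norm R v `^ (- (1 / 3))) 1 <= w ->
       (P [set t | (s * l1norm R v `^ (1 / 3)
                      <= G_hor (omb w z) v t - G_bulk om v t)%R]
        <= (expR (- (c0 * Num.min (s `^ (3 / 2))
                                  (s * l1norm R v `^ (1 / 3)))))%:E)%E) /\
      (z <= zeta (real_point R v)
         + eps0 * Num.min (s `^ (1 / 2) * l1norm R v `^ (- (1 / 3))) 1 ->
       (P [set t | (s * l1norm R v `^ (1 / 3)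
                      <= G_ver (omb w z) v t - G_bulk om v t)%R]
        <= (expR (- (c0 * Num.min (s `^ (3 / 2))
                                  (s * l1norm R v `^ (1 / 3)))))%:E)%E).
Proof.
pose a := Num.sqrt delta / (1 + Num.sqrt delta); pose c := boundary_rate a.
have sd : 0 < Num.sqrt delta by rewrite sqrtr_gt0.
have a0 : 0 < a by rewrite divr_gt0// addr_gt0.
have c0 : 0 < c by exact: boundary_rate_gt0.
exists (c / 2), (a / 16), 1%N, (1 + 32 / c); split.
  by split; rewrite ?divr_gt0// addr_gt0// divr_gt0.
move=> d T P om omb W [[|m] [|n]] s w z // cv _ _ s0 w0 z1.
have azt := cone_zeta delta_gt0 cv; rewrite -/a /real_point /= in azt *.
have c32 : 0 < 32 / c by rewrite divr_gt0.
have s1 : 1 <= s by apply: le_trans s0; lra.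
have LE : l1norm R (m.+1, n.+1) = m.+1%:R + n.+1%:R by rewrite /l1norm natrD.
have L1 : 1 <= l1norm R (m.+1, n.+1) by rewrite /l1norm /= ler1n addSn.
have [th ths thE sth] := scale_bounds s1 L1; rewrite -thE.
move: (Num.min _ 1) th ths {thE} sth => theta th ths sth.
set S := s * _ in ths sth *.
(* the constant 16 of the union bound is absorbed in half of the exponent *)
have absorb : 16 * expR (- (c * (theta * S))) <= expR (- (c / 2 * (theta * S))).
  have -> : - (c * (theta * S)) = - (c / 2 * (theta * S)) - c / 2 * (theta * S) by field.
  rewrite expRD mulrCA ger_pMr ?expR_gt0// expRN ler_pdivrMr ?expR_gt0// mul1r.
  apply: le_trans (expR_ge1Dx _).
  have : c / 2 * (32 / c) <= c / 2 * (theta * S).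
    by rewrite ler_pM2l ?divr_gt0//; apply: le_trans sth; apply: le_trans s0; lra.
  rewrite (_ : c / 2 * (32 / c) = 16); first by lra.
  by field; rewrite gt_eqF.
have indU := normalized_indep W w0 z1.
have U0 t k := normalized_ge0 (rate w z) (omb w z) t k.
rewrite LE in ths.
split=> [wz|zz].
  apply: (G_hor_tail W w0 z1).
  apply: le_trans (hor_minus_blk_large_tail indU U0 a0 azt th ths wz) _.
  by rewrite lee_fin.
apply: (G_ver_tail W w0 z1).
have swap0 t k := relabel_ge0 swap (U0 t) k.
have azt' : a <= zeta (n.+1%:R, m.+1%:R) <= 1 - a.
  by rewrite zeta_swap//; move: azt => /andP[? ?]; apply/andP; split; lra.
have wz' : zeta (n.+1%:R, m.+1%:R) - a / 16 * theta <= 1 - z.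
  by rewrite zeta_swap//; lra.
rewrite addrC in ths.
have := hor_minus_blk_large_tail (swap_indep indU) swap0 a0 azt' th ths wz'.
have -> : [set t | S <= hor (n.+1, m.+1) (1 - z) (relabel swap (normalized (rate w z) (omb w z) t)) -
                        blk (n.+1, m.+1) (relabel swap (normalized (rate w z) (omb w z) t))] =
          [set t | S <= ver (m.+1, n.+1) z (normalized (rate w z) (omb w z) t) -
                        blk (m.+1, n.+1) (normalized (rate w z) (omb w z) t)].
  apply/seteqP; split => t /=; rewrite hor_swap blk_swap;
    by rewrite (_ : 1 - (1 - z) = z)//; ring.
by move=> /le_trans; apply; rewrite lee_fin.
Qed.
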